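(* Let $X$ be a complex nilmanifold of complex dimension $5$ defined by a $(1,0)$-coframe $\{\omega^k\}_{k=1}^5$ with $$d\omega^1=d\omega^2=d\omega^3=d\omega^4=0,\qquad d\omega^5=A_{12}\,\omega^{12}+A_{34}\,\omega^{34}+\omega^{1\bar1}+\omega^{2\bar2}+\omega^{3\bar3}+b\,\omega^{4\bar4},$$ with $A_{12},A_{34}\in\mathbb C\setminus\{0\}$ and $b\in(-1,0)$ satisfying $|A_{12}|^2+|A_{34}|^2=6(b+1)$. Then $X$ admits an astheno-Kähler metric $F'$ (which is also strongly Gauduchon) and a balanced metric $F''$, and the Frölicher spectral sequence of $X$ has $d_3\neq0$.
   Context: A complex nilmanifold $X=(M,J)$ is a nilmanifold $M=\Gamma\backslash G$ (compact quotient of a connected, simply connected real nilpotent Lie group $G$ by a lattice $\Gamma$) endowed with an invariant complex structure $J$, i.e. one induced by an integrable complex structure on the Lie algebra $\mathfrak g$ of $G$; structure equations are for a basis of invariant $(1,0)$-forms. Hermitian metrics are identified with their fundamental forms $F$. On a complex manifold of complex dimension $n$, $F$ is astheno-Kähler if $\partial\bar\partial F^{n-2}=0$; strongly Gauduchon if there exists an $(n,n-2)$-form $\gamma$ with $\partial F^{n-1}=\bar\partial\gamma$; balanced if $dF^{n-1}=0$. The Frölicher spectral sequence $(E_r(X),d_r)_{r\geq1}$ is the spectral sequence of the double complex $(\Omega^{*,*}(X),\partial,\bar\partial)$ with first page the Dolbeault cohomology $E_1^{p,q}=H^{p,q}_{\bar\partial}(X)$ and $d_r:E_r^{p,q}\to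 E_r^{p+r,q-r+1}$. Notation: $\omega^{jk}=\omega^j\wedge\omega^k$, $\omega^{j\bar k}=\omega^j\wedge\overline{\omega^k}$. *)

(* Defs.v *)
From mathcomp Require Import all_boot all_order all_algebra.
From mathcomp Require Import all_classical all_reals all_analysis.
From mathcomp.real_closed Require Import complex.

Set Implicit Arguments.
Unset Strict Implicit.
Unset Printing Implicit Defensive.

Import Order.TTheory GRing.Theory Num.Theory.
Import numFieldNormedType.Exports.

Local Open Scope classical_set_scope.
Local Open Scope ring_scope.

(** * Smooth functions *)

Fixpoint Ck (R : realType) (V : normedModType R) (k : nat) (f : V -> R) : Prop :=
  match k with
  | 0 => continuous f
  | k'.+1 => (forall x, differentiable f x) /\ (forall v, Ck k' ('D_v f))
  end.

(* For a finite-dimensional [V] this is the usual class C^oo. *)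
Definition smooth (R : realType) (V : normedModType R) (f : V -> R) : Prop :=
  forall k, Ck k f.

Definition smooth_map (R : realType) (V : normedModType R) (m : nat)
    (f : V -> 'rV[R]_m) : Prop :=
  forall i, smooth (fun x => f x 0 i).

Definition csmooth (R : realType) (V : normedModType R) (f : V -> R[i]) : Prop :=
  smooth (fun x => complex.Re (f x)) /\ smooth (fun x => complex.Im (f x)).

Definition cderive (R : realType) (V : normedModType R) (f : V -> R[i])
    (v x : V) : R[i] :=
  ('D_v (fun y => complex.Re (f y)) x +i* 'D_v (fun y => complex.Im (f y)) x)%C.

(** * The complex exterior algebra of (R^m)^*

    [a I] is the coefficient of a on dx_{i_1} /\ ... /\ dx_{i_k}, where
    I = {i_1 < ... < i_k}. *)

Notation ext R m := {ffun {set 'I_m} -> R[i]}.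

Definition inversions (m : nat) (I J : {set 'I_m}) : nat :=
  #|[set ij : 'I_m * 'I_m | [&& ij.1 \in I, ij.2 \in J & ij.2 < ij.1]%N]|.

Definition ext_wedge (R : realType) (m : nat) (a b : ext R m) : ext R m :=
  [ffun K : {set 'I_m} => \sum_(I : {set 'I_m} | I \subset K)
     (-1) ^+ inversions I (K :\: I) * a I * b (K :\: I)].

Definition ext1 (R : realType) (m : nat) : ext R m :=
  [ffun I : {set 'I_m} => (I == finset.set0)%:R].

Definition ext_scale (R : realType) (m : nat) (c : R[i]) (a : ext R m) : ext R m :=
  [ffun I : {set 'I_m} => c * a I].

Definition ext_conj (R : realType) (m : nat) (a : ext R m) : ext R m :=
  [ffun I : {set 'I_m} => (a I)^*%C].

(* The covector with coordinates [u]. *)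
Definition covector (R : realType) (m : nat) (u : 'rV[R[i]]_m) : ext R m :=
  [ffun I : {set 'I_m} => \sum_(i < m | I == [set i]%SET) u 0 i].

(* u_{i_1} /\ ... /\ u_{i_k} for I = {i_1 < ... < i_k}; [enum I] is increasing. *)
Definition wedge_family (R : realType) (m : nat) (u : 'I_m -> 'rV[R[i]]_m)
    (I : {set 'I_m}) : ext R m :=
  \big[@ext_wedge R m/ext1 R m]_(i <- enum I) covector (u i).

(* The algebra endomorphism sending dx_i to the i-th row of [A]. *)
Definition ext_map (R : realType) (m : nat) (A : 'M[R[i]]_m) (a : ext R m) : ext R m :=
  \sum_(I : {set 'I_m}) ext_scale (a I) (wedge_family (fun i => row i A) I).

(* The value a(v, w) of the degree 2 part of [a]. *)
Definition ext_eval2 (R : realType) (m : nat) (a : ext R m) (v w : 'rV[R]_m) : R[i] :=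
  \sum_(i < m) \sum_(j < m | (i < j)%N)
    a [set i; j]%SET * (v 0 i * w 0 j - v 0 j * w 0 i)%:C%C.

(** * Differential forms on R^m (of mixed degree, complex valued) *)

Notation cform R m := ('rV[R]_m -> ext R m).

Definition smooth_form (R : realType) (m : nat) (al : cform R m) : Prop :=
  forall I, csmooth (fun x => al x I).

Definition fwedge (R : realType) (m : nat) (al be : cform R m) : cform R m :=
  fun x => ext_wedge (al x) (be x).

Definition fpow (R : realType) (m : nat) (al : cform R m) (k : nat) : cform R m :=
  iter k (fwedge al) (fun=> ext1 R m).

Definition fscale (R : realType) (m : nat) (c : R[i]) (al : cform R m) : cform R m :=
  fun x => ext_scale c (al x).

Definition fconj (R : realType) (m : nat) (al : cform R m) : cform R m :=
  fun x => ext_conj (al x).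

Definition dform (R : realType) (m : nat) (al : cform R m) : cform R m :=
  fun x => \sum_(i < m)
    ext_wedge (covector (delta_mx 0 i))
          [ffun I : {set 'I_m} => cderive (fun y => al y I) (delta_mx 0 i) x].

(* Tangent vectors are rows v, and the differential of [phi] at [x] is
   v |-> v *m 'J phi x; hence the transpose. *)
Definition pullback (R : realType) (m : nat) (phi : 'rV[R]_m -> 'rV[R]_m)
    (al : cform R m) : cform R m :=
  fun x => ext_map (map_mx (real_complex R) ('J phi x)^T) (al (phi x)).

(** * Types of forms with respect to an almost complex structure

    [J x] acts on tangent vectors by v |-> v *m J x. *)

Definition acs (R : realType) (m : nat) : Type := 'rV[R]_m -> 'M[R]_m.

(* The i-th rows of (1 - i J^T)/2 and (1 + i J^T)/2 are the (1,0)- and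
   (0,1)-parts of dx_i. *)
Definition proj10 (R : realType) (m : nat) (J : 'M[R]_m) : 'M[R[i]]_m :=
  2^-1 *: (1%:M - 'i%C *: map_mx (real_complex R) J^T).

Definition proj01 (R : realType) (m : nat) (J : 'M[R]_m) : 'M[R[i]]_m :=
  2^-1 *: (1%:M + 'i%C *: map_mx (real_complex R) J^T).

(* The (p,q)-component: in each dx_{i_1} /\ ... /\ dx_{i_k} write every factor as
   the sum of its (1,0)- and (0,1)-parts and keep the products with p factors of
   the first kind (those indexed by S) and q of the second. *)
Definition ext_part (R : realType) (m : nat) (J : 'M[R]_m) (p q : nat)
    (a : ext R m) : ext R m :=
  \sum_(I : {set 'I_m})
   \sum_(S : {set 'I_m} | [&& S \subset I, #|S| == p & #|I :\: S| == q])
     ext_scale (a I)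
       (wedge_family (fun i => row i (if i \in S then proj10 J else proj01 J)) I).

Definition type_part (R : realType) (m : nat) (J : acs R m) (p q : nat)
    (al : cform R m) : cform R m :=
  fun x => ext_part (J x) p q (al x).

Definition has_type (R : realType) (m : nat) (J : acs R m) (p q : nat)
    (al : cform R m) : Prop :=
  type_part J p q al = al.

Definition del (R : realType) (m : nat) (J : acs R m) (al : cform R m) : cform R m :=
  \sum_(p < m.+1) \sum_(q < m.+1) type_part J p.+1 q (dform (type_part J p q al)).

Definition delbar (R : realType) (m : nat) (J : acs R m) (al : cform R m) : cform R m :=
  \sum_(p < m.+1) \sum_(q < m.+1) type_part J p q.+1 (dform (type_part J p q al)).

(** * Complex nilmanifolds *)

(* A Lie group whose underlying manifold is R^m.  Up to isomorphism these include
   all connected, simply connected nilpotent Lie groups of dimension m, for which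
   exp is a diffeomorphism. *)
Record lieGroup (R : realType) (m : nat) := LieGroup {
  gmul : 'rV[R]_m -> 'rV[R]_m -> 'rV[R]_m;
  gone : 'rV[R]_m;
  ginv : 'rV[R]_m -> 'rV[R]_m;
  gmulA : forall x y z, gmul x (gmul y z) = gmul (gmul x y) z;
  gmul1 : forall x, gmul gone x = x;
  gmulV : forall x, gmul (ginv x) x = gone;
  gmul_smooth : smooth_map (fun xy : 'rV[R]_m * 'rV[R]_m => gmul xy.1 xy.2);
  ginv_smooth : smooth_map ginv }.

Definition gcomm (R : realType) (m : nat) (G : lieGroup R m) (x y : 'rV[R]_m) :=
  gmul G (gmul G x y) (gmul G (ginv G x) (ginv G y)).

Fixpoint upper_central (R : realType) (m : nat) (G : lieGroup R m) (k : nat) :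
    set 'rV[R]_m :=
  match k with
  | 0 => [set gone G]
  | k'.+1 => [set x | forall y, upper_central G k' (gcomm G x y)]
  end.

Definition nilpotent_group (R : realType) (m : nat) (G : lieGroup R m) : Prop :=
  exists k, upper_central G k = setT.

(* A discrete cocompact subgroup. *)
Definition is_lattice (R : realType) (m : nat) (G : lieGroup R m)
    (Gam : set 'rV[R]_m) : Prop :=
  [/\ Gam (gone G),
      forall x y, Gam x -> Gam y -> Gam (gmul G x y),
      forall x, Gam x -> Gam (ginv G x),
      exists2 U, nbhs (gone G) U & Gam `&` U = [set gone G]
    & exists2 K, compact K &
        forall g, exists2 x, Gam x & exists2 y, K y & g = gmul G x y].

Definition left_invariant (R : realType) (m : nat) (G : lieGroup R m)
    (al : cform R m) : Prop :=
  forall g, pullback (gmul G g) al = al.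

Record invariant_complex_structure (R : realType) (m : nat) (G : lieGroup R m)
    (J : acs R m) : Prop := InvariantComplexStructure {
  ics_smooth : forall i j, smooth (fun x => J x i j);
  ics_sqr : forall x, J x *m J x = - 1%:M;
  ics_invariant : forall g x,
    J x *m 'J (gmul G g) x = 'J (gmul G g) x *m J (gmul G g x);
  ics_integrable : forall al : cform R m,
    smooth_form al -> has_type J 1 0 al -> type_part J 0 2 (dform al) = 0 }.

(* X = (Gam \ G, J), of complex dimension n. *)
Record complexNilmanifold (R : realType) (n : nat) := ComplexNilmanifold {
  cn_group : lieGroup R (2 * n);
  cn_nilpotent : nilpotent_group cn_group;
  cn_lattice : set 'rV[R]_(2 * n);
  cn_latticeP : is_lattice cn_group cn_lattice;
  cn_J : acs R (2 * n);
  cn_JP : invariant_complex_structure cn_group cn_J }.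

(* Smooth forms on Gam \ G are the Gam-invariant smooth forms on G. *)
Definition form_on (R : realType) (n : nat) (X : complexNilmanifold R n)
    (al : cform R (2 * n)) : Prop :=
  smooth_form al /\
  forall g, cn_lattice X g -> pullback (gmul (cn_group X) g) al = al.

Definition Omega (R : realType) (n : nat) (X : complexNilmanifold R n) (p q : nat) :
    set (cform R (2 * n)) :=
  [set al | form_on X al /\ has_type (cn_J X) p q al].

Definition coframe10 (R : realType) (n : nat) (X : complexNilmanifold R n)
    (w : n.-tuple (cform R (2 * n))) : Prop :=
  [/\ forall k, smooth_form (tnth w k),
      forall k, left_invariant (cn_group X) (tnth w k),
      forall k, has_type (cn_J X) 1 0 (tnth w k)
    & forall x (c : 'I_n -> R[i]),
        \sum_(k < n) ext_scale (c k) (tnth w k x) = 0 -> forall k, c k = 0].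

(** * Hermitian metrics, identified with their fundamental forms *)

Definition hermitian_metric (R : realType) (n : nat) (X : complexNilmanifold R n)
    (F : cform R (2 * n)) : Prop :=
  [/\ Omega X 1 1 F, fconj F = F
    & forall x v, v != 0 -> 0 < ext_eval2 (F x) v (v *m cn_J X x)].

Definition astheno_Kahler (R : realType) (n : nat) (X : complexNilmanifold R n)
    (F : cform R (2 * n)) : Prop :=
  del (cn_J X) (delbar (cn_J X) (fpow F (n - 2))) = 0.

Definition strongly_Gauduchon (R : realType) (n : nat) (X : complexNilmanifold R n)
    (F : cform R (2 * n)) : Prop :=
  exists2 ga, Omega X n (n - 2) ga &
    del (cn_J X) (fpow F (n - 1)) = delbar (cn_J X) ga.

Definition balanced (R : realType) (n : nat) (X : complexNilmanifold R n)
    (F : cform R (2 * n)) : Prop :=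
  dform (fpow F (n - 1)) = 0.

(** * The Froelicher spectral sequence

    The spectral sequence of the total complex of (Omega^{*,*}(X), del, delbar),
    filtered by the first degree. *)

Definition Dtot (R : realType) (n : nat) (X : complexNilmanifold R n)
    (al : cform R (2 * n)) : cform R (2 * n) :=
  del (cn_J X) al + delbar (cn_J X) al.

Definition Atot (R : realType) (n : nat) (X : complexNilmanifold R n) (k : int) :
    set (cform R (2 * n)) :=
  [set al | form_on X al /\ forall x I, al x I != 0 -> #|I|%:Z = k].

Definition Fil (R : realType) (n : nat) (X : complexNilmanifold R n) (p k : int) :
    set (cform R (2 * n)) :=
  [set al | Atot X k al /\
            forall p' q' : nat, p'%:Z < p -> type_part (cn_J X) p' q' al = 0].

Definition Zr (R : realType) (n : nat) (X : complexNilmanifold R n) (r p q : int) :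
    set (cform R (2 * n)) :=
  [set al | Fil X p (p + q) al /\ Fil X (p + r) (p + q + 1) (Dtot X al)].

Definition Br (R : realType) (n : nat) (X : complexNilmanifold R n) (r p q : int) :
    set (cform R (2 * n)) :=
  [set al | exists2 be, Zr X (r - 1) (p + 1) (q - 1) be &
            exists2 ga, Zr X (r - 1) (p - r + 1) (q + r - 2) ga &
              al = be + Dtot X ga].

(* E_r^{p,q} = Z_r^{p,q} / B_r^{p,q} for r >= 1, its elements being cosets; the
   zero element is [Br X r p q]. *)
Definition Er_coset (R : realType) (n : nat) (X : complexNilmanifold R n) (r p q : int)
    (al : cform R (2 * n)) : set (cform R (2 * n)) :=
  [set al + be | be in Br X r p q].

Definition Er (R : realType) (n : nat) (X : complexNilmanifold R n) (r p q : int) :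
    set (set (cform R (2 * n))) :=
  [set Er_coset X r p q al | al in Zr X r p q].

(* d_r : E_r^{p,q} -> E_r^{p+r,q-r+1}, the class of al going to that of D al. *)
Definition dr (R : realType) (n : nat) (X : complexNilmanifold R n) (r p q : int)
    (c : set (cform R (2 * n))) : set (cform R (2 * n)) :=
  \bigcup_(al in c) Er_coset X r (p + r) (q - r + 1) (Dtot X al).

Definition dr_neq0 (R : realType) (n : nat) (X : complexNilmanifold R n) (r : int) : Prop :=
  exists p q : int, exists2 c, Er X r p q c &
    dr X r p q c <> Br X r (p + r) (q - r + 1).

(* Main.v *)
Require Import Defs.
From mathcomp Require Import all_boot all_order all_algebra.
From mathcomp Require Import all_classical all_reals all_analysis.
From mathcomp.real_closed Require Import complex.
From mathcomp Require Import ring lra.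

Set Implicit Arguments.
Unset Strict Implicit.
Unset Printing Implicit Defensive.

Import mathcomp.boot.fintype mathcomp.boot.finset.
Import Order.TTheory GRing.Theory Num.Theory.
Import numFieldNormedType.Exports.

Local Open Scope ring_scope.

(* Write a = A12, c = A34. In the coframe, F = i (w^{1 1bar} + w^{2 2bar} + w^{3 3bar}
   + e w^{4 4bar} + w^{5 5bar}) is a metric for e > 0: for e = 1 the form del delbar F^3 is a
   multiple of |a|^2 + |c|^2 - 6 (b + 1) and del F^4 = delbar gam with gam a multiple of
   w^{12345} wbar^{345}, while for e = - b / 3 the form F^4 is closed.

   The differential d_3 : E_3^{0,3} -> E_3^{3,1} maps the class of an invariant form alpha
   with leading term wbar^{135} to that of an invariant (3,1)-form D alpha.  Suppose
   D alpha = beta + D gam with beta of filtration 4 and gam of filtration 1, not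
   necessarily invariant.  There is a linear form L on invariant forms that vanishes in
   filtration 4 and on D of the invariant 3-forms of filtration 1, but not at D alpha.
   Applying L to the coefficients of the equation leaves a divergence
   sum_i X_i f_i = L (D alpha) <> 0 along the invariant vector fields, with f_i smooth on
   the nilmanifold.  For small t this bounds sum_i (f_i (x h_i) - f_i x) below by a
   positive constant, where h_i is the point 1 + t v_i of R^10, v_i being the value of
   X_i at the unit (after passing to real fields), and averaging over suitable right
   translates, which exist since the group is nilpotent, gives a contradiction.  This
   replaces integration over the nilmanifold. *)

(** The pages of the spectral sequence are formed from all smooth forms on the quotient, so D alpha
    has to be tested against an arbitrary gam; a computation with invariant forms alone would not
    decide it. Left-invariant fields generate right translations, which descend to the quotient by
    the left action of the lattice; hence the averages over right translates.

    The coframe followed by its conjugates is a frame in which types have constant coefficients. In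
    it del and delbar are derivatives along the dual fields plus two constant antiderivations, so
    each claim on invariant forms is a polynomial identity in a, c, their conjugates and b. These
    identities are proved over a commutative ring with the conjugates as independent variables.

    The sign of b enters twice: it makes e = - b / 3 positive, and it makes b |a|^2 - |c|^2, which
    is L (D alpha) up to a nonzero factor, different from 0. *)

Local Notation "a \w b" := (ext_wedge a b) (at level 40, left associativity).

(** * The exterior algebra *)

Section ExteriorAlgebra.
Context {R : realType} {m : nat}.
Implicit Types (a b c : ext R m) (k : R[i]) (I J : {set 'I_m}).

Definition ext_basis I : ext R m := [ffun J : {set 'I_m} => (J == I)%:R].

Lemma ext_scaleDr k a b : ext_scale k (a + b) = ext_scale k a + ext_scale k b.
Proof. by apply/ffunP => I; rewrite !ffunE mulrDr. Qed.

Lemma ext_scaleDl k l a : ext_scale (k + l) a = ext_scale k a + ext_scale l a.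
Proof. by apply/ffunP => I; rewrite !ffunE mulrDl. Qed.

Lemma ext_scaleA k l a : ext_scale k (ext_scale l a) = ext_scale (k * l) a.
Proof. by apply/ffunP => I; rewrite !ffunE mulrA. Qed.

Lemma ext_scale1 a : ext_scale 1 a = a.
Proof. by apply/ffunP => I; rewrite !ffunE mul1r. Qed.

Lemma ext_scale0l a : ext_scale 0 a = 0.
Proof. by apply/ffunP => I; rewrite !ffunE mul0r. Qed.

Lemma ext_scale0r k : ext_scale k (0 : ext R m) = 0.
Proof. by apply/ffunP => I; rewrite !ffunE mulr0. Qed.

Lemma ext_scaleNl k a : ext_scale (- k) a = - ext_scale k a.
Proof. by apply/ffunP => I; rewrite !ffunE mulNr. Qed.

Lemma ext_scaleNr k a : ext_scale k (- a) = - ext_scale k a.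
Proof. by apply/ffunP => I; rewrite !ffunE mulrN. Qed.

Lemma ext_scale_sumr k T (r : seq T) (P : pred T) (F : T -> ext R m) :
  ext_scale k (\sum_(i <- r | P i) F i) = \sum_(i <- r | P i) ext_scale k (F i).
Proof.
exact: (big_morph (ext_scale k) (ext_scaleDr k) (ext_scale0r k)).
Qed.

Lemma ext_scale_suml a T (r : seq T) (P : pred T) (F : T -> R[i]) :
  ext_scale (\sum_(i <- r | P i) F i) a = \sum_(i <- r | P i) ext_scale (F i) a.
Proof.
exact: (big_morph (fun k => ext_scale k a) (fun k l => ext_scaleDl k l a) (ext_scale0l a)).
Qed.

Lemma ext_decomp a : a = \sum_I ext_scale (a I) (ext_basis I).
Proof.
apply/ffunP => J; rewrite sum_ffunE (bigD1 J) //= big1 => [|I nIJ].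
  by rewrite !ffunE eqxx mulr1 addr0.
by rewrite !ffunE eq_sym (negPf nIJ) mulr0.
Qed.

(** Linearity is phrased with [ext_scale], the scaling used in the definitions of forms, and in one
    equation, so that each instance is a single rewriting. *)
Definition ext_linear (n : nat) (f : ext R m -> ext R n) :=
  forall k a b, f (ext_scale k a + b) = ext_scale k (f a) + f b.

Lemma ext_linear0 n (f : ext R m -> ext R n) : ext_linear f -> f 0 = 0.
Proof.
move=> lf; have := lf 1 0 0.
have -> : ext_scale 1 (0 : ext R m) + 0 = 0 by rewrite ext_scale0r addr0.
set y := f 0 => /ffunP yE; apply/ffunP => I.
have := yE I; rewrite !ffunE mul1r => /esym/eqP.
by rewrite -subr_eq0 addrK => /eqP.
Qed.

Lemma ext_linearE n (f : ext R m -> ext R n) a : ext_linear f ->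
  f a = \sum_I ext_scale (a I) (f (ext_basis I)).
Proof.
move=> lf; rewrite {1}[a]ext_decomp.
elim/big_rec2: _ => [|I x y _ <-]; first exact: ext_linear0.
by rewrite lf.
Qed.

Lemma eq_ext_linear n (f g : ext R m -> ext R n) : ext_linear f -> ext_linear g ->
  (forall I, f (ext_basis I) = g (ext_basis I)) -> f =1 g.
Proof.
move=> lf lg fg a; rewrite (ext_linearE a lf) (ext_linearE a lg).
by apply: eq_bigr => I _; rewrite fg.
Qed.

Lemma ext_linearD n (f : ext R m -> ext R n) a b : ext_linear f -> f (a + b) = f a + f b.
Proof.
by move=> lf; have := lf 1 a b; rewrite ext_scale1 => ->; congr (_ + _); apply/ffunP=> I; rewrite !ffunE mul1r.
Qed.

Lemma ext_linearZ n (f : ext R m -> ext R n) k a : ext_linear f ->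
  f (ext_scale k a) = ext_scale k (f a).
Proof. by move=> lf; rewrite -[ext_scale k a in LHS]addr0 lf (ext_linear0 lf) addr0. Qed.

Lemma ext_linear_sum n (f : ext R m -> ext R n) T (r : seq T) (P : pred T) (F : T -> ext R m) :
  ext_linear f -> f (\sum_(i <- r | P i) F i) = \sum_(i <- r | P i) f (F i).
Proof.
move=> lf; apply: (big_morph f) => [x y|]; [exact: ext_linearD | exact: ext_linear0].
Qed.

(** As a double sum the count is additive in each argument over disjoint unions, which the signs in
    associativity require. *)
Lemma inversionsE I J : inversions I J = (\sum_(i in I) \sum_(j in J) (j < i))%N.
Proof.
rewrite /inversions -sum1_card (eq_bigl (fun ij : 'I_m * 'I_m =>
  (ij.1 \in I) && ((ij.2 \in J) && (ij.2 < ij.1)%N))) => [|ij]; last by rewrite unfold_in /= asboolb.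
rewrite -(pair_big_dep (fun i => i \in I) (fun i j => (j \in J) && (j < i)%N) (fun _ _ => 1%N)) /=.
apply: eq_bigr => i _; rewrite [RHS]big_mkcond [LHS]big_mkcond.
by apply: eq_bigr => j _; case: (j \in J) => //=; case: (j < i)%N.
Qed.

Lemma inversionsUl I1 I2 J : [disjoint I1 & I2] ->
  inversions (I1 :|: I2) J = (inversions I1 J + inversions I2 J)%N.
Proof. by move=> d; rewrite !inversionsE -bigU //; apply: eq_bigl => i; rewrite in_setU. Qed.

Lemma inversionsUr I J1 J2 : [disjoint J1 & J2] ->
  inversions I (J1 :|: J2) = (inversions I J1 + inversions I J2)%N.
Proof.
move=> d; rewrite !inversionsE -big_split; apply: eq_bigr => i _.
by rewrite -bigU //; apply: eq_bigl => j; rewrite in_setU.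
Qed.

Lemma ext_wedge_lin_l c : ext_linear (fun a => a \w c).
Proof.
move=> k a b; apply/ffunP => K; rewrite !ffunE mulr_sumr -big_split.
by apply: eq_bigr => I _; rewrite !ffunE mulrDr mulrDl; congr (_ + _); ring.
Qed.

Lemma ext_wedge_lin_r c : ext_linear (fun a => c \w a).
Proof.
move=> k a b; apply/ffunP => K; rewrite !ffunE mulr_sumr -big_split.
by apply: eq_bigr => I _; rewrite !ffunE mulrDr; congr (_ + _); ring.
Qed.

Lemma ext_wedgeDl a b c : (a + b) \w c = a \w c + b \w c.
Proof. exact: ext_linearD (ext_wedge_lin_l c). Qed.

Lemma ext_wedgeDr a b c : a \w (b + c) = a \w b + a \w c.
Proof. exact: ext_linearD (ext_wedge_lin_r a). Qed.

Lemma ext_wedgeZl k a b : ext_scale k a \w b = ext_scale k (a \w b).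
Proof. exact: ext_linearZ (ext_wedge_lin_l b). Qed.

Lemma ext_wedgeZr k a b : a \w ext_scale k b = ext_scale k (a \w b).
Proof. exact: ext_linearZ (ext_wedge_lin_r a). Qed.

Lemma ext_wedge0l a : 0 \w a = 0.
Proof. exact: ext_linear0 (ext_wedge_lin_l a). Qed.

Lemma ext_wedge0r a : a \w 0 = 0.
Proof. exact: ext_linear0 (ext_wedge_lin_r a). Qed.

Lemma ext_wedgeNl a b : (- a) \w b = - (a \w b).
Proof. by apply/eqP; rewrite -addr_eq0 -ext_wedgeDl addNr ext_wedge0l. Qed.

Lemma ext_wedgeNr a b : a \w (- b) = - (a \w b).
Proof. by apply/eqP; rewrite -addr_eq0 -ext_wedgeDr addNr ext_wedge0r. Qed.

Lemma ext_wedge_suml T (r : seq T) (P : pred T) (F : T -> ext R m) a :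
  (\sum_(i <- r | P i) F i) \w a = \sum_(i <- r | P i) (F i \w a).
Proof. exact: ext_linear_sum (ext_wedge_lin_l a). Qed.

Lemma ext_wedge_sumr T (r : seq T) (P : pred T) (F : T -> ext R m) a :
  a \w (\sum_(i <- r | P i) F i) = \sum_(i <- r | P i) (a \w F i).
Proof. exact: ext_linear_sum (ext_wedge_lin_r a). Qed.

Lemma ext_wedge_basis I J : ext_basis I \w ext_basis J =
  if [disjoint I & J] then ext_scale ((-1) ^+ inversions I J) (ext_basis (I :|: J)) else 0.
Proof.
apply/ffunP => K; rewrite ffunE.
rewrite (eq_bigr (fun I' => if I' == I then if K :\: I == J then (-1) ^+ inversions I J else 0 else 0));
  last first.
  move=> I' sI'K; rewrite !ffunE; case: eqP => [->|_]; last by rewrite mulr0 mul0r.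
  by case: eqP => [->|_]; rewrite ?mulr1 ?mulr0.
(* The coefficient at [K] has at most one nonzero term, the one splitting [K] into [I] and [J]; this
   equivalence says when it occurs. *)
have eqK : (I \subset K) && (K :\: I == J) = [disjoint I & J] && (K == I :|: J).
  apply/andP/andP => [[sIK /eqP <-]|[dIJ /eqP ->]]; split.
  - by rewrite -setI_eq0; apply/eqP/setP => x; rewrite !inE; case: (x \in I).
  - apply/eqP/setP => x; rewrite !inE; have := subsetP sIK x.
    by case: (x \in I) => //= ->.
  - exact: subsetUl.
  - move: dIJ; rewrite -setI_eq0 => /eqP/setP dIJ.
    apply/eqP/setP => x; have := dIJ x; rewrite !inE.
    by case: (x \in I) => //= ->.
rewrite -big_mkcondr /=; case: (boolP (I \subset K)) => sIK.
  rewrite (big_pred1 I) => [|I']; last first.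
    by rewrite /=; case: eqP => [->|_]; rewrite ?andbF // sIK.
  move: eqK; rewrite sIK /=; case: eqP => [_|_] /esym.
    by case/andP => -> /eqP ->; rewrite !ffunE eqxx mulr1.
  by case: ifP => [_ /= e|_ _]; rewrite !ffunE // e mulr0.
rewrite big_pred0 => [|I']; last first.
  by rewrite /=; case: eqP => [->|_]; rewrite ?andbF // (negPf sIK).
move: eqK; rewrite (negPf sIK) /= => /esym.
by case: ifP => [_ /= e|_ _]; rewrite !ffunE // e mulr0.
Qed.

(** Both sides are linear in each argument, so basis elements suffice. There the signs agree because
    both exponents add up the inversions of the pairs (I,J), (I,K) and (J,K). *)
Lemma ext_wedgeA a b c : a \w (b \w c) = a \w b \w c.
Proof.
have l1 b' c' : ext_linear (fun a => a \w (b' \w c')) by exact: ext_wedge_lin_l.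
have l2 b' c' : ext_linear (fun a => a \w b' \w c').
  by move=> k x y; rewrite !(ext_wedgeDl, ext_wedgeDr, ext_wedgeZl, ext_wedgeZr).
have l3 a' c' : ext_linear (fun b => a' \w (b \w c')).
  by move=> k x y; rewrite !(ext_wedgeDl, ext_wedgeDr, ext_wedgeZl, ext_wedgeZr).
have l4 a' c' : ext_linear (fun b => a' \w b \w c').
  by move=> k x y; rewrite !(ext_wedgeDl, ext_wedgeDr, ext_wedgeZl, ext_wedgeZr).
have l5 a' b' : ext_linear (fun c => a' \w (b' \w c)).
  by move=> k x y; rewrite !(ext_wedgeDl, ext_wedgeDr, ext_wedgeZl, ext_wedgeZr).
have l6 a' b' : ext_linear (fun c => a' \w b' \w c) by exact: ext_wedge_lin_r.
move: a; apply: eq_ext_linear => // I; move: b; apply: eq_ext_linear => // J.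
move: c; apply: eq_ext_linear => // K.
rewrite (ext_wedge_basis I J) (ext_wedge_basis J K).
have [dJK|nJK] := boolP [disjoint J & K]; have [dIJ|nIJ] := boolP [disjoint I & J].
- rewrite ext_wedgeZr ext_wedgeZl !ext_wedge_basis.
  rewrite -![in [disjoint I & _]]setI_eq0 -![in [disjoint _ & K]]setI_eq0 setIUr setIUl.
  rewrite !setU_eq0 !setI_eq0 dJK dIJ andbT /=; case: ifP => dIK; last by rewrite !ext_scale0r.
  by rewrite !ext_scaleA -!exprD setUA inversionsUl // inversionsUr // addnC addnA addnAC -addnA addnC.
- rewrite ext_wedge0l ext_wedgeZr ext_wedge_basis ifF ?ext_scale0r //.
  apply/negbTE; apply: contra nIJ => d; apply: disjointWr d; exact: subsetUl.
- rewrite ext_wedge0r ext_wedgeZl ext_wedge_basis ifF ?ext_scale0r //.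
  apply/negbTE; apply: contra nJK => d; apply: disjointWl d; exact: subsetUr.
- by rewrite ext_wedge0l ext_wedge0r.
Qed.

Lemma inversions0l I : inversions set0 I = 0%N.
Proof. by rewrite inversionsE big_set0. Qed.

Lemma inversions0r I : inversions I set0 = 0%N.
Proof. by rewrite inversionsE big1 // => i _; rewrite big_set0. Qed.

Lemma ext_wedge1l a : ext1 R m \w a = a.
Proof.
move: a; apply: (@eq_ext_linear m _ id) => // [|I]; first exact: ext_wedge_lin_r.
by rewrite ext_wedge_basis -setI_eq0 set0I eqxx inversions0l ext_scale1 set0U.
Qed.

Lemma ext_wedge1r a : a \w ext1 R m = a.
Proof.
move: a; apply: (@eq_ext_linear m _ id) => // [|I]; first exact: ext_wedge_lin_l.
by rewrite ext_wedge_basis -setI_eq0 setI0 eqxx inversions0r ext_scale1 setU0.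
Qed.

End ExteriorAlgebra.

(** * Products of generators as words with signs *)

Definition signed {V : zmodType} (s : bool) (x : V) : V := if s then - x else x.

Fixpoint nat_ltb (i j : nat) : bool :=
  match i, j with _, 0 => false | 0, _.+1 => true | i'.+1, j'.+1 => nat_ltb i' j' end.

Lemma nat_ltbE i j : nat_ltb i j = (i < j)%N.
Proof. by elim: i j => [|i IH] [|j] //=; rewrite IH. Qed.

(* The comparisons avoid the boolean equality and order of the library, whose
   structures would have to be unfolded when computing with symbolic coefficients. *)
Fixpoint word_insert (i : nat) (w : seq nat) : option (bool * seq nat) :=
  match w with
  | [::] => Some (false, [:: i])
  | j :: w' =>
      if eqn i j then None else if nat_ltb i j then Some (false, i :: w)
      else if word_insert i w' is Some (s, v) then Some (~~ s, j :: v) else None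
  end.

(** [None] arises from a repeated letter, hence a zero product; the boolean is set when sorting
    costs a minus sign. *)
Fixpoint word_mul (w1 w2 : seq nat) : option (bool * seq nat) :=
  match w1 with
  | [::] => Some (false, w2)
  | i :: w1' =>
      if word_mul w1' w2 is Some (s, v) then
        if word_insert i v is Some (s', v') then Some (s (+) s', v') else None
      else None
  end.

Lemma word_insert_path j i w s v : (j < i)%N -> path ltn j w ->
  word_insert i w = Some (s, v) -> path ltn j v.
Proof.
elim: w j s v => [|k w IH] j s v /= ji; first by move=> _ [_ <-] /=; rewrite ji.
case/andP => jk pw; rewrite eqnE nat_ltbE; case: eqP => // nik; case: ltnP => ik.
  by case=> _ <- /=; rewrite ji ik.
have {}ki : (k < i)%N by rewrite ltn_neqAle ik andbT; apply/eqP => e; apply: nik.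
case E: (word_insert i w) => [[s' v']|] // [_ <-] /=.
by rewrite jk (IH _ _ _ ki pw E).
Qed.

Lemma word_insert_sorted i w s v : sorted ltn w ->
  word_insert i w = Some (s, v) -> sorted ltn v.
Proof.
case: w => [|k w] /=; first by move=> _ [_ <-].
move=> pw; rewrite eqnE nat_ltbE; case: eqP => // nik; case: ltnP => ik.
  by case=> _ <- /=; rewrite ik.
have {}ki : (k < i)%N by rewrite ltn_neqAle ik andbT; apply/eqP => e; apply: nik.
by case E: (word_insert i w) => [[s' v']|] // [_ <-] /=; apply: word_insert_path E.
Qed.

Lemma word_insert_all (p : pred nat) i w s v : p i -> all p w ->
  word_insert i w = Some (s, v) -> all p v.
Proof.
move=> pi; elim: w s v => [|k w IH] s v /=; first by move=> _ [_ <-] /=; rewrite pi.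
case/andP => pk pw; rewrite eqnE nat_ltbE; case: eqP => // _; case: ltnP => _.
  by case=> _ <- /=; rewrite pi pk.
by case E: (word_insert i w) => [[s' v']|] // [_ <-] /=; rewrite pk (IH _ _ pw E).
Qed.

Section Words.
Context {R : realType} {m : nat}.
Implicit Types (a b c : ext R m) (k : R[i]) (I J : {set 'I_m}) (w : seq nat).

Definition wedge_word (u : nat -> ext R m) w : ext R m :=
  foldr (fun i a => u i \w a) (ext1 R m) w.

Definition anticommuting (u : nat -> ext R m) : Prop :=
  (forall i, u i \w u i = 0) /\ forall i j, u i \w u j = - (u j \w u i).

Lemma signed_wedger s a b : a \w signed s b = signed s (a \w b).
Proof. by case: s => //=; rewrite ext_wedgeNr. Qed.

Lemma signed_signed (V : zmodType) s t (x : V) : signed s (signed t x) = signed (s (+) t) x.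
Proof. by case: s; case: t; rewrite /signed //= opprK. Qed.

Lemma wedge_insert u i w : anticommuting u ->
  u i \w wedge_word u w =
  if word_insert i w is Some (s, v) then signed s (wedge_word u v) else 0.
Proof.
case=> u0 uC; elim: w => [|j w IH] //=.
rewrite eqnE nat_ltbE; case: eqP => [<-|_]; first by rewrite ext_wedgeA u0 ext_wedge0l.
case: ltnP => // _; rewrite ext_wedgeA uC ext_wedgeNl -ext_wedgeA IH.
case: (word_insert i w) => [[s v]|]; last by rewrite ext_wedge0r oppr0.
by rewrite signed_wedger; case: s => //=; rewrite opprK.
Qed.

Lemma wedge_word_mul u w1 w2 : anticommuting u ->
  wedge_word u w1 \w wedge_word u w2 =
  if word_mul w1 w2 is Some (s, v) then signed s (wedge_word u v) else 0.
Proof.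
move=> uA; elim: w1 => [|i w1 IH] /=; first by rewrite ext_wedge1l.
rewrite -ext_wedgeA IH; case: (word_mul w1 w2) => [[s v]|]; last by rewrite ext_wedge0r.
rewrite signed_wedger wedge_insert //; case: (word_insert i v) => [[s' v']|].
  by rewrite signed_signed.
by case: s; rewrite //= oppr0.
Qed.

Lemma eq_wedge_word u v w : {in w, u =1 v} -> wedge_word u w = wedge_word v w.
Proof.
elim: w => //= i w IH uv; rewrite uv ?mem_head // IH // => j jw.
by apply: uv; rewrite inE jw orbT.
Qed.

Lemma covectorE (v : 'rV[R[i]]_m) :
  covector v = \sum_(i < m) ext_scale (v 0 i) (ext_basis [set i]).
Proof.
apply/ffunP => I; rewrite sum_ffunE ffunE [LHS]big_mkcond; apply: eq_bigr => i _.
by rewrite !ffunE; case: eqP => _; rewrite ?mulr1 ?mulr0.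
Qed.

Lemma covector_delta i : covector (delta_mx 0 i) = ext_basis [set i] :> ext R m.
Proof.
rewrite covectorE (bigD1 i) //= big1 => [|j nji].
  by rewrite mxE !eqxx ext_scale1 addr0.
by rewrite mxE eqxx (negPf nji) ext_scale0l.
Qed.

Lemma covectorD (v w : 'rV[R[i]]_m) : covector (v + w) = covector v + covector w.
Proof.
by rewrite !covectorE -big_split; apply: eq_bigr => i _; rewrite mxE ext_scaleDl.
Qed.

Lemma covectorZ k (v : 'rV[R[i]]_m) : covector (k *: v) = ext_scale k (covector v).
Proof.
by rewrite !covectorE ext_scale_sumr; apply: eq_bigr => i _; rewrite mxE ext_scaleA.
Qed.

Lemma covector0 : covector (0 : 'rV[R[i]]_m) = 0.
Proof. by rewrite covectorE big1 // => i _; rewrite mxE ext_scale0l. Qed.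

Lemma covector_set1 (v : 'rV[R[i]]_m) i : covector v [set i] = v 0 i.
Proof.
rewrite ffunE (big_pred1 i) // => j; rewrite /=.
by apply/eqP/eqP => [/set1_inj|] ->.
Qed.

Lemma covector_inj : injective (@covector R m).
Proof. by move=> v w vw; apply/rowP => i; rewrite -!covector_set1 vw. Qed.

Lemma inversions1 (i j : 'I_m) : inversions [set i] [set j] = (j < i)%N.
Proof. by rewrite inversionsE !big_set1. Qed.

Lemma ext_basis1C i j : ext_basis [set i] \w ext_basis [set j] =
  - (ext_basis [set j] \w ext_basis [set i]) :> ext R m.
Proof.
rewrite !ext_wedge_basis [[disjoint [set j] & _]]disjoint_sym setUC !inversions1.
have [->|nij] := eqVneq i j.
  by rewrite -setI_eq0 setIid -cards_eq0 cards1 oppr0.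
rewrite -setI_eq0 (_ : _ :&: _ = finset.set0); last first.
  apply/setP => x; rewrite !inE; apply/negP => /andP[/eqP-> /eqP e].
  by rewrite e eqxx in nij.
rewrite eqxx -ext_scaleNl; have [_|_|/val_inj e] := ltngtP i j.
- by rewrite expr0 expr1 opprK.
- by rewrite expr0 expr1.
- by rewrite e eqxx in nij.
Qed.

Lemma covectorC (v w : 'rV[R[i]]_m) :
  covector v \w covector w = - (covector w \w covector v).
Proof.
rewrite !covectorE !ext_wedge_suml -sumrN.
under eq_bigr do rewrite ext_wedge_sumr.
under [RHS]eq_bigr do rewrite ext_wedge_sumr -sumrN.
rewrite exchange_big; apply: eq_bigr => i _; apply: eq_bigr => j _.
by rewrite !ext_wedgeZl !ext_wedgeZr !ext_scaleA mulrC ext_basis1C ext_scaleNr.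
Qed.

Lemma ext_double0 a : a = - a -> a = 0.
Proof.
move/ffunP => aN; apply/ffunP => I; have := aN I; rewrite !ffunE => /eqP.
by rewrite -addr_eq0 -mulr2n mulrn_eq0 /= => /eqP.
Qed.

Lemma covector_sq (v : 'rV[R[i]]_m) : covector v \w covector v = 0.
Proof. by apply: ext_double0; exact: covectorC. Qed.

(** Indexing by all natural numbers, with value 0 out of range, lets words of numbers be multiplied
    without bound proofs; anticommutation survives the default. *)
Definition cov_family (v : 'I_m -> 'rV[R[i]]_m) (n : nat) : ext R m :=
  if insub n is Some i then covector (v i) else 0.

Lemma cov_family_ord v (i : 'I_m) : cov_family v i = covector (v i).
Proof. by rewrite /cov_family valK. Qed.

Lemma cov_family_anticommuting v : anticommuting (cov_family v).
Proof.
split=> [i|i j]; rewrite /cov_family; case: insubP => [i' _ _|_]; rewrite ?ext_wedge0l //.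
- exact: covector_sq.
- by case: insubP => [j' _ _|_]; rewrite ?ext_wedge0l ?ext_wedge0r ?oppr0 // covectorC.
- by rewrite ext_wedge0r oppr0.
Qed.

Definition set_word I : seq nat := map val (enum I).

Lemma wedge_familyE v I : wedge_family v I = wedge_word (cov_family v) (set_word I).
Proof.
rewrite /wedge_family /set_word unlock; elim: (enum I) => //= i s ->.
by rewrite cov_family_ord.
Qed.

Lemma set_word_sorted I : sorted ltn (set_word I).
Proof.
have /subseq_sorted : subseq (set_word I) (map val (enum 'I_m)).
  by rewrite /set_word; apply: map_subseq; rewrite enumT filter_subseq.
by apply; [exact: ltn_trans | rewrite val_enum_ord iota_ltn_sorted].
Qed.

Lemma set_word_lt I : all (fun i => i < m)%N (set_word I).
Proof. by apply/allP => _ /mapP[i _ ->]; exact: ltn_ord. Qed.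

Definition word_set (w : seq nat) : {set 'I_m} := [set i : 'I_m | val i \in w].

Lemma set_wordK : cancel set_word word_set.
Proof.
move=> I; apply/setP => i; rewrite inE mem_map ?mem_enum //; exact: val_inj.
Qed.

Definition ext_gen : nat -> ext R m := cov_family (fun i => delta_mx 0 i).

(** Putting a letter in front of larger ones creates no inversion, so no sign appears. *)
Lemma wedge_word_basis w : sorted ltn w -> all (fun i => i < m)%N w ->
  wedge_word ext_gen w = ext_basis (word_set w).
Proof.
elim: w => [|i w IH] /= sw.
  move=> _; rewrite (_ : word_set [::] = finset.set0) //; by apply/setP => i; rewrite !inE.
case/andP => im aw; rewrite IH ?(path_sorted sw) //.
rewrite -[ i ]/(val (Ordinal im)) /ext_gen cov_family_ord covector_delta; set i' := Ordinal im.
have lt_iw j : j \in w -> (i < j)%N.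
  by apply/allP: j; apply: order_path_min sw; exact: ltn_trans.
rewrite ext_wedge_basis ifT; last first.
  rewrite -setI_eq0; apply/eqP/setP => j; rewrite !inE.
  by apply/negP => /andP[/eqP -> /lt_iw]; rewrite ltnn.
rewrite inversionsE big_set1 big1 ?expr0 ?ext_scale1; last first.
  by move=> j; rewrite inE => /lt_iw ij; rewrite ltnNge ltnW.
by congr ext_basis; apply/setP => j; rewrite !inE.
Qed.

Lemma ext_basis_word I : ext_basis I = wedge_word ext_gen (set_word I).
Proof. by rewrite wedge_word_basis ?set_wordK ?set_word_sorted ?set_word_lt. Qed.

Lemma word_setK w : sorted ltn w -> all (fun i => i < m)%N w -> set_word (word_set w) = w.
Proof.
move=> sw aw; apply: (irr_sorted_eq ltn_trans ltnn) => //; first exact: set_word_sorted.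
move=> i; apply/mapP/idP => [[j]|iw]; first by rewrite mem_enum inE => jw ->.
have im := allP aw _ iw; exists (Ordinal im) => //.
by rewrite mem_enum inE.
Qed.

Lemma ext_map_lin (A : 'M[R[i]]_m) : ext_linear (ext_map A).
Proof.
move=> k a b; rewrite /ext_map ext_scale_sumr -big_split; apply: eq_bigr => I _.
by rewrite !ffunE ext_scaleDl ext_scaleA.
Qed.

Lemma ext_map_basis (A : 'M[R[i]]_m) I :
  ext_map A (ext_basis I) = wedge_word (cov_family (fun i => row i A)) (set_word I).
Proof.
rewrite /ext_map (bigD1 I) //= big1 => [|J nIJ].
  by rewrite ffunE eqxx ext_scale1 addr0 wedge_familyE.
by rewrite ffunE (negPf nIJ) ext_scale0l.
Qed.

Lemma ext_map_sorted (A : 'M[R[i]]_m) w : sorted ltn w -> all (fun i => i < m)%N w ->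
  ext_map A (wedge_word ext_gen w) = wedge_word (cov_family (fun i => row i A)) w.
Proof. by move=> sw aw; rewrite wedge_word_basis // ext_map_basis word_setK. Qed.

Lemma ext_map_signed (A : 'M[R[i]]_m) s a : ext_map A (signed s a) = signed s (ext_map A a).
Proof.
case: s => //=; rewrite -[a in LHS]ext_scale1 -ext_scaleNl.
by rewrite (ext_linearZ _ _ (ext_map_lin A)) ext_scaleNl ext_scale1.
Qed.

Lemma ext_map1 (A : 'M[R[i]]_m) : ext_map A (ext1 R m) = ext1 R m.
Proof. by rewrite -[ext1 R m]/(wedge_word ext_gen [::]) ext_map_sorted. Qed.

Lemma ext_map_gen (A : 'M[R[i]]_m) (i : 'I_m) :
  ext_map A (ext_gen i) = covector (row i A).
Proof.
have := @ext_map_sorted A [:: val i] erefl; rewrite /= ltn_ord => /(_ erefl).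
by rewrite !ext_wedge1r cov_family_ord.
Qed.

(** By linearity the first factor is a basis word, treated letter by letter. Multiplication by one
    letter is [word_insert] on both sides, since the rows of [A] anticommute just as the generators
    do. *)
Lemma ext_map_wedge (A : 'M[R[i]]_m) a b :
  ext_map A (a \w b) = ext_map A a \w ext_map A b.
Proof.
have lA := ext_map_lin A.
(* The split serves as a [suff]: its negative branch is closed by proving the claim for a basis
   element as first factor. *)
move: a b; have [H|] := pselect (forall I b, ext_map A (ext_basis I \w b) =
    ext_map A (ext_basis I) \w ext_map A b).
  move=> a b; move: a; apply: eq_ext_linear => // k x y.
    by rewrite ext_wedgeDl ext_wedgeZl lA.
  by rewrite lA ext_wedgeDl ext_wedgeZl.
case=> I b; rewrite ext_basis_word ext_map_sorted ?set_word_sorted ?set_word_lt //.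
elim: (set_word I) (set_word_lt I) => [_|i w IH] /=; first by rewrite !ext_wedge1l.
case/andP => im {}/IH IH; rewrite -!ext_wedgeA -IH.
set x := _ \w b; move: x; apply: eq_ext_linear => [k x y|k x y|J].
- by rewrite ext_wedgeDr ext_wedgeZr lA.
- by rewrite lA ext_wedgeDr ext_wedgeZr.
have cA := @cov_family_anticommuting.
rewrite (ext_map_basis A J) ext_basis_word !wedge_insert //.
case E: word_insert => [[s v]|]; last exact: ext_linear0.
rewrite ext_map_signed ext_map_sorted //.
  by apply: word_insert_sorted E; exact: set_word_sorted.
  by apply: word_insert_all E => //; exact: set_word_lt.
exact: cA.
Qed.

Lemma ext_map_covector (A : 'M[R[i]]_m) v : ext_map A (covector v) = covector (v *m A).
Proof.
rewrite covectorE (ext_linear_sum _ _ _ (ext_map_lin A)) covectorE.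
have lA := ext_map_lin A.
under eq_bigr => i _.
  rewrite (ext_linearZ _ _ lA) -covector_delta -[delta_mx 0 i]/((fun i => delta_mx 0 i) i).
  rewrite -cov_family_ord ext_map_gen covectorE ext_scale_sumr; over.
rewrite exchange_big; apply: eq_bigr => j _; rewrite mxE ext_scale_suml.
by apply: eq_bigr => i _; rewrite ext_scaleA mxE.
Qed.

Lemma ext_map_comp (A B : 'M[R[i]]_m) a : ext_map B (ext_map A a) = ext_map (A *m B) a.
Proof.
move: a; apply: eq_ext_linear => [k x y|k x y|I]; rewrite ?ext_map_lin //.
rewrite !ext_map_basis; elim: (set_word I) (set_word_lt I) => [_|i w IH] /=; first exact: ext_map1.
case/andP => im /IH IHw; rewrite ext_map_wedge IHw; congr (_ \w _).
by rewrite -[ i ]/(val (Ordinal im)) !cov_family_ord ext_map_covector row_mul.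
Qed.

Lemma ext_map_id a : ext_map 1%:M a = a.
Proof.
move: a; apply: (@eq_ext_linear _ m m _ id) => [|//|I]; first exact: ext_map_lin.
rewrite ext_map_basis ext_basis_word; apply: eq_wedge_word => i _.
by rewrite /ext_gen /cov_family; case: insubP => // j _ _; rewrite row1.
Qed.

Lemma ext_map_unitK (A : 'M[R[i]]_m) : A \in unitmx -> cancel (ext_map (invmx A)) (ext_map A).
Proof. by move=> uA a; rewrite ext_map_comp mulVmx // ext_map_id. Qed.

Lemma ext_map_unitKV (A : 'M[R[i]]_m) : A \in unitmx -> cancel (ext_map A) (ext_map (invmx A)).
Proof. by move=> uA a; rewrite ext_map_comp mulmxV // ext_map_id. Qed.

End Words.
(** The polynomial with coefficients [z] has size at most [n] and the [n] roots 0, ..., n - 1. With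
    its two-variable version this lets type components be compared as coefficients in two
    parameters. *)
Lemma natpow_coef_eq0 (R : realType) n (z : nat -> R[i]) :
  (forall s : R[i], \sum_(p < n) s ^+ p * z p = 0) -> forall p : 'I_n, z p = 0.
Proof.
move=> H p; have e : (\poly_(i < n) z i : {poly R[i]}) = 0.
  apply: (@roots_geq_poly_eq0 _ _ [seq k%:R | k <- iota 0 n]).
  - apply/allP => _ /mapP[k _ ->]; rewrite /root horner_poly -[X in _ == X](H k%:R).
    by apply/eqP/eq_bigr => i _; rewrite mulrC.
  - rewrite map_inj_uniq ?iota_uniq //; exact: mulrIn (oner_neq0 _).
  - by rewrite size_map size_iota size_poly.
by have := coef_poly n z p; rewrite e coef0 ltn_ord.
Qed.

Lemma natpow2_coef_eq0 (R : realType) n (z : nat -> nat -> R[i]) :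
  (forall s t : R[i], \sum_(p < n) \sum_(q < n) s ^+ p * t ^+ q * z p q = 0) ->
  forall p q : 'I_n, z p q = 0.
Proof.
move=> H p q; apply: natpow_coef_eq0 q => t.
apply: (@natpow_coef_eq0 _ _ (fun p => \sum_(q < n) t ^+ q * z p q)) p => s.
rewrite -[RHS](H s t); apply: eq_bigr => p _; rewrite mulr_sumr.
by apply: eq_bigr => q _; rewrite mulrA.
Qed.

(** * Bidegrees with respect to generators of pure type *)

Section Types.
Context {R : realType} {m : nat}.
Implicit Types (a b c : ext R m) (k : R[i]) (I J : {set 'I_m}) (w : seq nat).
Variable P : pred nat.

Definition deg10 I := #|[set i in I | P (val i)]|.
Definition deg01 I := #|[set i in I | ~~ P (val i)]|.

(** The bidegree component when the generators themselves have type (1,0) or (0,1), as selected by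
    [P]; no complex structure enters. *)
Definition std_part (p q : nat) a : ext R m :=
  [ffun I : {set 'I_m} => if (deg10 I == p) && (deg01 I == q) then a I else 0].

Lemma std_part_lin p q : ext_linear (std_part p q).
Proof.
move=> k a b; apply/ffunP => I; rewrite !ffunE.
by case: ifP => //; rewrite mulr0 addr0.
Qed.

Lemma deg10_lt I : (deg10 I < m.+1)%N.
Proof. by rewrite ltnS (leq_trans (max_card _)) ?card_ord. Qed.

Lemma deg01_lt I : (deg01 I < m.+1)%N.
Proof. by rewrite ltnS (leq_trans (max_card _)) ?card_ord. Qed.

Lemma std_part_basis p q I : std_part p q (ext_basis I) =
  if (deg10 I == p) && (deg01 I == q) then ext_basis I else 0.
Proof.
apply/ffunP => J; rewrite !ffunE; have [->|nJI] := eqVneq J I.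
  by case: ifP; rewrite !ffunE ?eqxx.
by case: ifP; case: ifP => _ _ //; rewrite !ffunE ?(negPf nJI).
Qed.

Lemma sum_deg_basis (V : zmodType) I (F : nat -> nat -> V) :
  \sum_(p < m.+1) \sum_(q < m.+1)
     (if (deg10 I == p) && (deg01 I == q) then F p q else 0) = F (deg10 I) (deg01 I).
Proof.
rewrite (bigD1 (Ordinal (deg10_lt I))) //= [X in _ + X]big1 ?addr0.
  rewrite (bigD1 (Ordinal (deg01_lt I))) //= !eqxx /= big1 ?addr0 // => q nq.
  case: eqP => // e; case/eqP: nq; exact: val_inj.
move=> p np; rewrite big1 // => q _; case: eqP => // e.
by case/eqP: np; apply: val_inj.
Qed.

Lemma std_part_sum a : \sum_(p < m.+1) \sum_(q < m.+1) std_part p q a = a.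
Proof.
apply/ffunP => I; rewrite sum_ffunE -[RHS](sum_deg_basis I (fun _ _ => a I)).
by apply: eq_bigr => p _; rewrite sum_ffunE; apply: eq_bigr => q _; rewrite ffunE.
Qed.

Definition pure p q a := forall I, a I != 0 -> deg10 I = p /\ deg01 I = q.

Lemma pure_std_part p q a : pure p q a -> std_part p q a = a.
Proof.
move=> pa; apply/ffunP => I; rewrite ffunE; have [->|/pa[-> ->]] := eqVneq (a I) 0.
  by rewrite if_same.
by rewrite !eqxx.
Qed.

Lemma std_part_pure p q a : pure p q (std_part p q a).
Proof.
by move=> I; rewrite ffunE; case: ifP; [case/andP => /eqP-> /eqP-> | rewrite eqxx].
Qed.

Lemma std_part_pure0 p q p' q' a : pure p q a -> (p, q) != (p', q') -> std_part p' q' a = 0.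
Proof.
move=> pa npq; apply/ffunP => I; rewrite !ffunE.
have [->|/pa[-> ->]] := eqVneq (a I) 0; first by rewrite if_same.
by case: ifP => // /andP[/eqP e1 /eqP e2]; rewrite e1 e2 eqxx in npq.
Qed.

Lemma pureD p q a b : pure p q a -> pure p q b -> pure p q (a + b).
Proof.
move=> pa pb I; rewrite ffunE; have [a0|/pa //] := eqVneq (a I) 0.
by rewrite a0 add0r; exact: pb.
Qed.

Lemma pure0 p q : pure p q 0. Proof. by move=> I; rewrite ffunE eqxx. Qed.

Lemma pureN p q a : pure p q a -> pure p q (- a).
Proof. by move=> pa I; rewrite ffunE oppr_eq0; exact: pa. Qed.

Lemma pureZ p q k a : pure p q a -> pure p q (ext_scale k a).
Proof. by move=> pa I; rewrite ffunE mulf_eq0 negb_or => /andP[_]; exact: pa. Qed.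

Lemma pure_sum p q T (r : seq T) (Q : pred T) (F : T -> ext R m) :
  (forall i, Q i -> pure p q (F i)) -> pure p q (\sum_(i <- r | Q i) F i).
Proof. by move=> pF; elim/big_ind: _ => //; [exact: pure0 | exact: pureD]. Qed.

Lemma deg10U I J : [disjoint I & J] -> deg10 (I :|: J) = (deg10 I + deg10 J)%N.
Proof.
move=> d; rewrite /deg10 -cardsUI.
have -> : [set i in I | P (val i)] :&: [set i in J | P (val i)] = finset.set0.
  apply/setP => i; move: d; rewrite -setI_eq0 => /eqP/setP/(_ i); rewrite !inE.
  by case: (i \in I); case: (i \in J); rewrite ?andbF.
by rewrite cards0 addn0; apply: eq_card => i; rewrite !inE; case: (P i); rewrite ?andbT ?andbF.
Qed.

Lemma deg01U I J : [disjoint I & J] -> deg01 (I :|: J) = (deg01 I + deg01 J)%N.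
Proof.
move=> d; rewrite /deg01 -cardsUI.
have -> : [set i in I | ~~ P (val i)] :&: [set i in J | ~~ P (val i)] = finset.set0.
  apply/setP => i; move: d; rewrite -setI_eq0 => /eqP/setP/(_ i); rewrite !inE.
  by case: (i \in I); case: (i \in J); rewrite ?andbF.
by rewrite cards0 addn0; apply: eq_card => i; rewrite !inE; case: (P i); rewrite ?andbT ?andbF.
Qed.

Lemma ext_wedge_support a b K : (a \w b) K != 0 ->
  exists I J, [/\ [disjoint I & J], K = I :|: J, a I != 0 & b J != 0].
Proof.
rewrite ffunE; apply: contraPP => H; apply/eqP/negPn; rewrite big1 ?eqxx // => I sIK.
have [->|aI] := eqVneq (a I) 0; first by rewrite mulr0 mul0r.
have [->|bJ] := eqVneq (b (K :\: I)) 0; first by rewrite mulr0.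
case: H; exists I, (K :\: I); split=> //.
  by rewrite -setI_eq0; apply/eqP/setP => x; rewrite !inE; case: (x \in I).
by apply/setP => x; rewrite !inE; have := subsetP sIK x; case: (x \in I) => //= ->.
Qed.

Lemma pure_wedge p q p' q' a b : pure p q a -> pure p' q' b ->
  pure (p + p')%N (q + q')%N (a \w b).
Proof.
move=> pa pb K /ext_wedge_support[I [J [d -> /pa[<- <-] /pb[<- <-]]]].
by rewrite deg10U // deg01U.
Qed.

Lemma deg10_set1 (i : 'I_m) : deg10 [set i] = P i.
Proof.
rewrite /deg10; case Pi: (P i); last first.
  by apply/eqP; rewrite cards_eq0; apply/eqP/setP => j; rewrite !inE; case: eqP => // ->.
rewrite -[RHS](cards1 i); apply: eq_card => j; rewrite !inE; case: eqP => // ->.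
by rewrite Pi.
Qed.

Lemma deg01_set1 (i : 'I_m) : deg01 [set i] = ~~ P i.
Proof.
rewrite /deg01; case Pi: (P i).
  by apply/eqP; rewrite cards_eq0; apply/eqP/setP => j; rewrite !inE; case: eqP => // ->; rewrite Pi.
rewrite -[RHS](cards1 i); apply: eq_card => j; rewrite !inE; case: eqP => // ->.
by rewrite Pi.
Qed.

Lemma pure_basis I : pure (deg10 I) (deg01 I) (ext_basis I).
Proof. by move=> J; rewrite ffunE; have [->//|_] := eqVneq J I; rewrite eqxx. Qed.

Lemma pure_gen i : pure (P i) (~~ P i) (ext_gen i).
Proof.
rewrite /ext_gen /cov_family; case: insubP => [j _ <-|_]; last exact: pure0.
by rewrite covector_delta -deg10_set1 -deg01_set1; exact: pure_basis.
Qed.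

Lemma pure_word w : pure (count P w) (count (predC P) w) (wedge_word ext_gen w).
Proof.
elim: w => [|i w IH] /=.
  move=> I; rewrite ffunE; have [->|] := eqVneq I finset.set0; last by rewrite eqxx.
  by rewrite /deg10 /deg01; split; apply/eqP; rewrite cards_eq0; apply/eqP/setP => i; rewrite !inE.
exact: pure_wedge (@pure_gen i) IH.
Qed.

End Types.

(** * Total degree *)

Section Degree.
Context {R : realType} {m : nat}.
Implicit Types (a b c : ext R m) (k l : nat) (I J : {set 'I_m}) (w : seq nat).

Definition homogeneous k a := forall I, a I != 0 -> #|I| = k.

(** Counting every index as holomorphic turns bidegree into total degree, so the lemmas on [pure]
    carry over. *)
Lemma pureT k a : pure predT k 0 a <-> homogeneous k a.
Proof.
have e I : deg10 predT I = #|I| by apply: eq_card => i; rewrite !inE andbT.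
have e0 I : deg01 predT I = 0%N.
  by apply/eqP; rewrite cards_eq0; apply/eqP/setP => i; rewrite !inE andbF.
by split=> H I /H; rewrite ?e ?e0 => // -[].
Qed.

Lemma homogeneous_wedge k l a b : homogeneous k a -> homogeneous l b ->
  homogeneous (k + l)%N (a \w b).
Proof. by move=> /pureT ha /pureT hb; apply/pureT; have := pure_wedge ha hb. Qed.

Lemma homogeneous_covector v : homogeneous 1 (covector v : ext R m).
Proof.
apply/pureT; rewrite covectorE; apply: pure_sum => i _; apply: pureZ.
by rewrite -covector_delta -cov_family_ord; exact: pure_gen.
Qed.

Lemma homogeneous_ext_map (A : 'M[R[i]]_m) k a : homogeneous k a -> homogeneous k (ext_map A a).
Proof.
move=> ha; apply/pureT; apply: pure_sum => I _.
have [aI0|/ha <-] := eqVneq (a I) 0.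
  by rewrite aI0 ext_scale0l; exact: pure0.
apply: pureZ; apply/pureT; rewrite wedge_familyE /set_word cardE.
elim: (enum I) => [J|i s IH] /=; first by rewrite ffunE; have [->|] := eqVneq J finset.set0; rewrite ?cards0 ?eqxx.
rewrite cov_family_ord -add1n; apply: homogeneous_wedge => //; exact: homogeneous_covector.
Qed.

End Degree.

(** * Type components of a complex structure, read in an adapted frame *)

Section TypePart.
Context {R : realType} {m : nat}.
Implicit Types (a b c : ext R m) (I S : {set 'I_m}).

(** The binomial expansion of a product of sums, indexed by the set of factors taken from [u]; the
    powers of [s] and [t] keep the types apart. The induction splits the subsets of [i :: w] by
    membership of [i]. *)
Lemma wedge_family_binomial (u v : 'I_m -> 'rV[R[i]]_m) (s t : R[i]) (w : seq 'I_m) : uniq w ->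
  \big[@ext_wedge R m/ext1 R m]_(i <- w) covector (s *: u i + t *: v i) =
  \sum_(S : {set 'I_m} | S \subset [set i in w])
    ext_scale (s ^+ #|S| * t ^+ #|[set i in w] :\: S|)
      (\big[@ext_wedge R m/ext1 R m]_(i <- w) covector (if i \in S then u i else v i)).
Proof.
elim: w => [_|i w IH] /=.
  rewrite (big_pred1 finset.set0) => [|S].
    rewrite big_nil cards0 (_ : _ :\: _ = finset.set0) ?cards0 ?mul1r ?ext_scale1 ?big_nil //.
    by apply/setP => j; rewrite !inE.
  by rewrite /= -subset0; congr (_ \subset _); apply/setP => j; rewrite !inE.
case/andP => niw uw; rewrite big_cons IH //.
have sub S : (S \subset [set j in i :: w]) && (i \notin S) = (S \subset [set j in w]).
  apply/andP/subsetP => [[/subsetP sS niS] j jS|sS].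
    by have := sS j jS; rewrite !inE => /orP[/eqP ji|//]; rewrite -ji jS in niS.
  split; last by apply/negP => /sS; rewrite inE (negPf niw).
  by apply/subsetP => j /sS; rewrite !inE => ->; rewrite orbT.
rewrite [RHS](bigID (fun S : {set 'I_m} => i \in S)) /=.
rewrite [X in _ = _ + X](eq_bigl _ _ sub).
rewrite [X in _ = X + _](reindex_onto (fun S => i |: S) (fun S => S :\ i)) /=; last first.
  by move=> S /andP[_ iS]; rewrite setD1K.
rewrite [X in _ = X + _](eq_bigl (fun S : {set 'I_m} => S \subset [set j in w])); last first.
  move=> S; rewrite /= -sub setU11 andbT; have [iS|niS] := boolP (i \in S).
    rewrite /= andbF; apply/negbTE; apply/negP => /andP[_ /eqP/setP/(_ i)].
    by rewrite !inE eqxx iS.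
  rewrite setU1K // eqxx !andbT; apply/subsetP/subsetP => sS j.
    by move=> jS; apply: sS; rewrite inE jS orbT.
  by rewrite inE => /orP[/set1P ->|/sS //]; rewrite inE mem_head.
rewrite -big_split ext_wedge_sumr /=; apply: eq_bigr => S sS.
have niS : i \notin S by apply/negP => /(subsetP sS); rewrite inE (negPf niw).
rewrite !big_cons setU11 (negPf niS) cardsU1 niS.
have -> : [set j in i :: w] :\: (i |: S) = [set j in w] :\: S.
  apply/setP => j; rewrite !inE negb_or; have [->|] := eqVneq j i => //=.
  by rewrite (negPf niw) andbF.
have -> : #|[set j in i :: w] :\: S| = #|[set j in w] :\: S|.+1.
  rewrite -add1n (_ : 1%N = (i \notin [set j in w] :\: S)); last by rewrite !inE (negPf niw) andbF.
  rewrite -cardsU1; apply: eq_card => j; rewrite !inE; have [->|] := eqVneq j i => //=.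
  by rewrite niS.
have -> : \big[@ext_wedge R m/ext1 R m]_(j <- w) covector (if j \in i |: S then u j else v j) =
          \big[@ext_wedge R m/ext1 R m]_(j <- w) covector (if j \in S then u j else v j).
  rewrite big_seq [RHS]big_seq; apply: eq_bigr => j jw; rewrite !inE.
  by case: eqP => // ji; rewrite -ji jw in niw.
rewrite ext_wedgeZr covectorD !covectorZ ext_wedgeDl !ext_wedgeZl ext_scaleDr !ext_scaleA.
by rewrite add1n !exprS; congr (ext_scale _ _ + ext_scale _ _); ring.
Qed.

Lemma ext_map_part (J : 'M[R]_m) s t a :
  ext_map (s *: proj10 J + t *: proj01 J) a =
  \sum_(p < m.+1) \sum_(q < m.+1) ext_scale (s ^+ p * t ^+ q) (ext_part J p q a).
Proof.
rewrite /ext_part; under eq_bigr => p _.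
  under eq_bigr do rewrite ext_scale_sumr.
  rewrite exchange_big; over.
rewrite exchange_big; apply: eq_bigr => I _.
rewrite {1}/wedge_family.
have rowE (i : 'I_m) : row i (s *: proj10 J + t *: proj01 J) =
    s *: row i (proj10 J) + t *: row i (proj01 J).
  by apply/rowP => j; rewrite !(mxE _ _ i j, mxE _ _ 0 j).
under [X in ext_scale _ X]eq_bigr do rewrite rowE.
rewrite wedge_family_binomial ?enum_uniq // ext_scale_sumr.
have -> : [set i in enum I] = I by apply/setP => i; rewrite inE mem_enum.
have cl (S : {set 'I_m}) : (#|S| < m.+1)%N by rewrite ltnS (leq_trans (max_card _)) ?card_ord.
pose F S p q := ext_scale (s ^+ p * t ^+ q) (ext_scale (a I)
  (wedge_family (fun i => row i (if i \in S then proj10 J else proj01 J)) I)).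
transitivity (\sum_(p < m.+1) \sum_(q < m.+1) \sum_(S : {set 'I_m} | S \subset I)
   (if (#|S| == p) && (#|I :\: S| == q) then F S p q else 0)); last first.
  apply: eq_bigr => p _; apply: eq_bigr => q _; rewrite ext_scale_sumr.
  rewrite -big_mkcondr; apply: eq_big => // S; by rewrite andbA.
under [RHS]eq_bigr => p _ do rewrite exchange_big.
rewrite [RHS]exchange_big; apply: eq_bigr => S sSI.
rewrite (bigD1 (Ordinal (cl S))) //= [X in _ = _ + X]big1 ?addr0; last first.
  move=> p np; rewrite big1 // => q _; case: eqP => // e.
  by case/eqP: np; apply: val_inj.
rewrite (bigD1 (Ordinal (cl (I :\: S)))) //= !eqxx /= big1 ?addr0; last first.
  move=> q nq; case: eqP => // e; case/eqP: nq; exact: val_inj.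
rewrite /F !ext_scaleA mulrC; congr ext_scale; apply: eq_bigr => i _.
by case: (i \in S).
Qed.

Lemma wedge_word_scale (u : nat -> ext R m) (P : pred nat) s t w :
  wedge_word (fun i => ext_scale (if P i then s else t) (u i)) w =
  ext_scale (s ^+ count P w * t ^+ count (predC P) w) (wedge_word u w).
Proof.
elim: w => [|i w IH] /=; first by rewrite mul1r ext_scale1.
rewrite IH ext_wedgeZl ext_wedgeZr ext_scaleA; congr ext_scale.
by case: (P i); rewrite /= !exprS /= ?expr0; ring.
Qed.

Lemma count_set_word (P : pred nat) (I : {set 'I_m}) : count P (set_word I) = deg10 P I.
Proof.
rewrite /set_word count_map -size_filter /deg10 cardE; congr size.
rewrite /enum_mem -filter_predI; apply: eq_filter => i /=.
by rewrite !inE andbC.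
Qed.

(* The type components are the coefficients of the polynomial
   [ext_map (s P10 + t P01)] in [s] and [t], and [ext_map] is multiplicative in
   its matrix argument. *)
Lemma ext_part_map (P : pred nat) (J : 'M[R]_m) (A : 'M[R[i]]_m) :
  (forall i : 'I_m, row i A *m proj10 J = if P i then row i A else 0) ->
  (forall i : 'I_m, row i A *m proj01 J = if P i then 0 else row i A) ->
  forall p q a, ext_part J p q (ext_map A a) = ext_map A (std_part P p q a).
Proof.
move=> h10 h01 p q a.
have [pm|mp] := ltnP p m.+1; last first.
  rewrite [RHS](_ : _ = 0); last first.
    rewrite (_ : std_part _ _ _ _ = 0) ?(ext_linear0 (ext_map_lin A)) //.
    by apply/ffunP => I; rewrite !ffunE ltn_eqF // (leq_trans (deg10_lt _ I)).
  rewrite /ext_part big1 // => I _; rewrite big_pred0 // => S.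
  by rewrite [#|S| == p]ltn_eqF ?andbF // (leq_trans _ mp) // ltnS (leq_trans (max_card _)) ?card_ord.
have [qm|mq] := ltnP q m.+1; last first.
  rewrite [RHS](_ : _ = 0); last first.
    rewrite (_ : std_part _ _ _ _ = 0) ?(ext_linear0 (ext_map_lin A)) //.
    by apply/ffunP => I; rewrite !ffunE [deg01 _ _ == q]ltn_eqF ?andbF // (leq_trans (deg01_lt _ I)).
  rewrite /ext_part big1 // => I _; rewrite big_pred0 // => S.
  by rewrite [#|I :\: S| == q]ltn_eqF ?andbF // (leq_trans _ mq) // ltnS (leq_trans (max_card _)) ?card_ord.
apply/ffunP => K; apply/eqP; rewrite -subr_eq0; apply/eqP.
apply: (natpow2_coef_eq0 (n := m.+1)
  (z := fun p q => ext_part J p q (ext_map A a) K - ext_map A (std_part P p q a) K) _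
  (Ordinal pm) (Ordinal qm)) => s t.
under eq_bigr => i _ do under eq_bigr do rewrite mulrBr.
under eq_bigr => i _ do rewrite sumrB.
rewrite sumrB; apply/eqP; rewrite subr_eq0; apply/eqP.
transitivity (ext_map (s *: proj10 J + t *: proj01 J) (ext_map A a) K).
  rewrite ext_map_part sum_ffunE; apply: eq_bigr => i _; rewrite sum_ffunE.
  by apply: eq_bigr => j _; rewrite ffunE.
transitivity ((\sum_(i < m.+1) \sum_(j < m.+1)
   ext_scale (s ^+ i * t ^+ j) (ext_map A (std_part P i j a))) K); last first.
  rewrite sum_ffunE; apply: eq_bigr => i _; rewrite sum_ffunE.
  by apply: eq_bigr => j _; rewrite ffunE.
congr (fun_of_fin _ K); rewrite ext_map_comp.
move: a; apply: eq_ext_linear => [||I]; first exact: ext_map_lin.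
  move=> k x y; rewrite ext_scale_sumr -big_split; apply: eq_bigr => i _.
  rewrite ext_scale_sumr -big_split; apply: eq_bigr => j _.
  by rewrite std_part_lin ext_map_lin ext_scaleDr !ext_scaleA mulrC.
under eq_bigr => i _.
  under eq_bigr => j _ do rewrite std_part_basis (fun_if (ext_map A)) (fun_if (ext_scale _))
     (ext_linear0 (ext_map_lin A)) ext_scale0r.
  over.
rewrite (sum_deg_basis _ _ (fun i j => ext_scale (s ^+ i * t ^+ j) (ext_map A (ext_basis I)))).
rewrite !ext_map_basis.
transitivity (wedge_word (fun i => ext_scale (if P i then s else t)
  (cov_family (fun i => row i A) i)) (set_word I)).
  apply: eq_wedge_word => i _; rewrite /cov_family; case: insubP => [j _ <-|_].
    rewrite row_mul mulmxDr -[X in X + _]scalemxAr -[X in _ + X]scalemxAr.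
    rewrite h10 h01.
    by case: (P _); rewrite ?scaler0 ?addr0 ?add0r covectorZ.
  by rewrite ext_scale0r.
by rewrite wedge_word_scale !count_set_word.
Qed.

End TypePart.
(** * Divergences on a compact quotient of a nilpotent group *)

Section Averages.
Context {R : realType} {m : nat} (G : lieGroup R m).
Local Notation "x ** y" := (gmul G x y) (at level 40, left associativity).
Local Notation T := 'rV[R]_m.

Lemma gmulVr (x : T) : x ** ginv G x = gone G.
Proof.
rewrite -[LHS](gmul1 G) -{1}(gmulV G (ginv G x)) -(gmulA G) (gmulA G (ginv G x)).
by rewrite gmulV gmul1 gmulV.
Qed.

Lemma gmul1r (x : T) : x ** gone G = x.
Proof. by rewrite -(gmulV G x) gmulA gmulVr gmul1. Qed.

Lemma gmulKV (x y : T) : x ** ginv G y ** y = x.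
Proof. by rewrite -gmulA gmulV gmul1r. Qed.

Lemma gmulK (x y : T) : x ** y ** ginv G y = x.
Proof. by rewrite -gmulA gmulVr gmul1r. Qed.

Lemma ginv_uniq (x y : T) : x ** y = gone G -> x = ginv G y.
Proof. by move=> xy; rewrite -[x]gmul1r -(gmulVr y) gmulA xy gmul1. Qed.

Lemma ginvM (x y : T) : ginv G (x ** y) = ginv G y ** ginv G x.
Proof. by apply/esym/ginv_uniq; rewrite gmulA gmulKV gmulV. Qed.

Lemma ginvK (x : T) : ginv G (ginv G x) = x.
Proof. by apply/esym/ginv_uniq; exact: gmulVr. Qed.

(** A commutator with a conjugate is a conjugate of a commutator, so every term of the upper central
    series is normal. The averaging argument conjugates commutators by powers of [h]. *)
Lemma upper_central_conj k (u z : T) :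
  upper_central G k z -> upper_central G k (u ** z ** ginv G u).
Proof.
elim: k u z => [|k IH] u z /=; first by move=> ->; rewrite gmul1r gmulVr.
move=> zk y.
have -> : gcomm G (u ** z ** ginv G u) y =
    u ** gcomm G z (ginv G u ** y ** u) ** ginv G u.
  rewrite /gcomm !ginvM !ginvK !gmulA.
  by rewrite gmulK.
exact: IH.
Qed.

Definition gpow (x : T) (n : nat) : T := iter n (gmul G x) (gone G).

Lemma gpowSr x n : gpow x n.+1 = gpow x n ** x.
Proof.
elim: n => [|n IH]; first by rewrite /= gmul1 gmul1r.
by rewrite -[LHS]/(x ** gpow x n.+1) {1}IH gmulA.
Qed.

Definition has_bounded_values (f : T -> R) := exists M : R, forall x, `|f x| <= M.

(* A discrete form of amenability: averaging over suitable right translates makes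
   all the given differences [f (x h) - f x] small. *)
Definition averageable (H : set T) := forall (I : finType) (r : seq I) (h : I -> T) (f : I -> T -> R),
  (forall i, H (h i)) -> (forall i, has_bounded_values (f i)) -> forall e : R, 0 < e ->
  exists s : seq T, (0 < size s)%N /\ forall x,
    `|\sum_(g <- s) \sum_(i <- r) (f i (x ** g ** h i) - f i (x ** g))| <= e * (size s)%:R.

Lemma sum_allpairs (s t : seq T) (F : T -> R) :
  \sum_(g <- [seq c ** a | c <- s, a <- t]) F g = \sum_(c <- s) \sum_(a <- t) F (c ** a).
Proof. by rewrite big_allpairs_dep. Qed.

Lemma ler_norm_sum_const (I : Type) (s : seq I) (F : I -> R) (e : R) :
  (forall i, `|F i| <= e) -> `|\sum_(i <- s) F i| <= e * (size s)%:R.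
Proof.
move=> Fe; apply: le_trans (ler_norm_sum _ _ _) _.
apply: (@le_trans _ _ (\sum_(i <- s) e)); first by apply: ler_sum.
by rewrite big_const_seq count_predT iter_addr_0 mulr_natr.
Qed.

(* Double induction.  For a new [h] in the next centre, the commutators [z] of [h]
   with the translates [g] already chosen turn the average of [f (x h) - f x] into a
   telescoping sum over the powers of [h] plus differences [F (x z) - F x], where
   [z] lies in the previous centre. *)
Lemma upper_central_averageable k : averageable (upper_central G k).
Proof.
elim: k => [|k IHk] I r h f hk fb.
  move=> e e0; exists [:: gone G]; split=> // x.
  rewrite big1_seq ?normr0 ?mulr_ge0 ?ltW // => g _; rewrite big1 // => i _.
  by rewrite (hk i) gmul1r subrr.
elim: r => [|i r IHr] e e0.
  exists [:: gone G]; split=> // x.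
  by rewrite big1_seq ?normr0 ?mulr_ge0 ?ltW // => g _; rewrite big_nil.
have e3 : 0 < e / 3%:R by rewrite divr_gt0.
have [A [A0 HA]] := IHr _ e3.
have [M fM] := fb i.
have M0 : 0 <= M by apply: le_trans (fM (gone G)); rewrite normr_ge0.
(* [N] makes the telescoped boundary, of size at most 2 M, small against the [N] powers averaged
   over. *)
have [N N0 HN] : exists2 N, (0 < N)%N & 2%:R * M <= e / 3%:R * N%:R.
  exists (Num.truncn (6%:R * M / e)).+1 => //.
  have : 6%:R * M / e < (Num.truncn (6%:R * M / e)).+1%:R by exact: truncnS_gt.
  rewrite ltr_pdivrMr // => /ltW; lra.
(* Since [h, a] a h = h a, translating by h^j [h, a] h^-j turns f (x h^j a h) into f (x h^j h a). *)
have [C [C0 HC]] := IHk ('I_N * 'I_(size A))%type (index_enum _)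
  (fun p => gpow (h i) p.1 ** gcomm G (h i) (nth (gone G) A p.2) ** ginv G (gpow (h i) p.1))
  (fun p x => f i (x ** gpow (h i) p.1 ** nth (gone G) A p.2 ** h i))
  (fun p => upper_central_conj _ (hk i _)) (fun p => ex_intro _ M (fun x => fM _)) _ e3.
exists [seq c ** a | c <- [seq c ** b | c <- C, b <- [seq gpow (h i) j | j <- iota 0 N]], a <- A].
have Nsize : size [seq c ** b | c <- C, b <- [seq gpow (h i) j | j <- iota 0 N]] = (size C * N)%N.
  by rewrite size_allpairs size_map size_iota.
split=> [|x]; first by rewrite size_allpairs Nsize !muln_gt0 C0 A0 N0.
under eq_bigr do rewrite big_cons.
rewrite big_split /= size_allpairs Nsize addrC.
set S1 := \sum_(g <- _) \sum_(j <- r) _.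
set S2 := \sum_(g <- _) (_ - _).
have le1 : `|S1| <= e / 3%:R * (size C * N * size A)%:R.
  rewrite /S1 sum_allpairs.
  apply: le_trans (ler_norm_sum_const (e := e / 3%:R * (size A)%:R) _ _) _ => [c|].
    by under eq_bigr do rewrite gmulA; exact: HA.
  by rewrite Nsize [(_ * size A)%N]mulnC !natrM; lra.
have le2 : `|S2| <= (2%:R * M) * (size C * size A)%:R + e / 3%:R * (size C)%:R.
  rewrite /S2 sum_allpairs sum_allpairs.
  pose F c (b : T) a := f i (x ** c ** b ** a ** h i) - f i (x ** c ** b ** h i ** a).
  pose D c (b : T) a := f i (x ** c ** b ** h i ** a) - f i (x ** c ** b ** a).
  under eq_bigr => c _.
    under eq_bigr => b _.
      under eq_bigr => a _.
        rewrite !gmulA (_ : _ - _ = F c b a + D c b a); last by rewrite addrA subrK.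
        over.
      rewrite big_split /=; over.
    rewrite big_split /=; over.
  rewrite big_split /= addrC; apply: le_trans (ler_normD _ _) _; apply: lerD.
    rewrite (_ : _ * _ = 2%:R * M * (size A)%:R * (size C)%:R); last by rewrite natrM; ring.
    apply: ler_norm_sum_const => c; rewrite big_map.
    rewrite exchange_big; apply: ler_norm_sum_const => a /=.
    have tele n : \sum_(j <- iota 0 n) D c (gpow (h i) j) a =
        f i (x ** c ** gpow (h i) n ** a) - f i (x ** c ** a).
      elim: n => [|n IHn]; first by rewrite big_nil /= gmul1r subrr.
      rewrite -addn1 iotaD big_cat IHn /= big_seq1 add0n addn1.
      by rewrite /D -[x ** c ** gpow _ _ ** h i]gmulA -gpowSr addrC addrA subrK.
    rewrite tele; apply: le_trans (ler_normB _ _) _.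
    by apply: le_trans (lerD (fM _) (fM _)) _; lra.
  have := HC x; apply: le_trans; rewrite -normrN le_eqVlt; apply/orP; left; apply/eqP.
  congr `|_|; rewrite -sumrN; apply: eq_bigr => c _.
  rewrite big_map -sumrN -[X in iota 0 X]subn0 -/(index_iota 0 N) big_mkord.
  under [LHS]eq_bigr => j _ do rewrite (big_nth (gone G)) big_mkord -sumrN.
  rewrite pair_bigA; apply: eq_bigr => -[j l] _ /=.
  rewrite /F opprB; congr (f i _ - _).
  by rewrite !gmulA !gmulKV.
apply: le_trans (ler_normD _ _) _.
apply: le_trans (lerD le1 le2) _.
have sA : 1 <= (size A)%:R :> R by rewrite ler1n.
have sC : 1 <= (size C)%:R :> R by rewrite ler1n.
have sN : 1 <= N%:R :> R by rewrite ler1n.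
rewrite !natrM.
set a := (size A)%:R in sA *; set c := (size C)%:R in sC *; set n := N%:R in HN sN *.
have h1 : 2%:R * M * (c * a) <= e / 3%:R * n * (c * a).
  by apply: ler_wpM2r => //; rewrite mulr_ge0 // (le_trans ler01).
have h2 : e / 3%:R * c * 1 <= e / 3%:R * c * (n * a).
  apply: ler_wpM2l; first by rewrite mulr_ge0 ?ltW // (lt_le_trans ltr01).
  by rewrite -[1]mulr1; apply: ler_pM.
rewrite mulr1 in h2; lra.
Qed.

End Averages.

(** * Calculus of smooth real functions *)

Section Smooth.
Context {R : realType} {V : normedModType R}.
Implicit Types f g : V -> R.

Lemma CkW k f : Ck k.+1 f -> Ck k f.
Proof.
elim: k f => [|k IH] f [df Df] /=.
  by move=> x; apply: differentiable_continuous; exact: df.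
by split=> // v; exact: IH.
Qed.

Lemma Ck_cst k (c : R) : Ck k (fun _ : V => c).
Proof.
elim: k c => [|k IH] c /=; first by move=> x; exact: cvg_cst.
split=> [x|v]; first exact: differentiable_cst.
rewrite (_ : 'D_v _ = fun=> 0) //; apply/funext => x; exact: derive_cst.
Qed.

Lemma CkD k f g : Ck k f -> Ck k g -> Ck k (fun x => f x + g x).
Proof.
elim: k f g => [|k IH] f g /=; first by move=> cf cg x; apply: cvgD; [exact: cf | exact: cg].
move=> [df Df] [dg Dg]; split=> [x|v]; first exact: differentiableD.
rewrite (_ : 'D_v _ = fun x => 'D_v f x + 'D_v g x); first exact: IH.
by apply/funext => x; apply: deriveD; apply: diff_derivable.
Qed.

Lemma CkM k f g : Ck k f -> Ck k g -> Ck k (fun x => f x * g x).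
Proof.
elim: k f g => [|k IH] f g; first by move=> cf cg x; apply: cvgM; [exact: cf | exact: cg].
move=> cf cg; have [df Df] := cf; have [dg Dg] := cg.
split=> [x|v]; first exact: differentiableM.
rewrite (_ : 'D_v _ = fun x => f x * 'D_v g x + g x * 'D_v f x).
  by apply: CkD; apply: IH; do ?[exact: CkW | exact: Df | exact: Dg].
by apply/funext => x; apply: deriveM; apply: diff_derivable.
Qed.

Lemma Ck_sum k (I : Type) (r : seq I) (f : I -> V -> R) : (forall i, Ck k (f i)) ->
  Ck k (fun x => \sum_(i <- r) f i x).
Proof.
move=> cf; elim: r => [|i r IH].
  by rewrite (_ : (fun x => _) = fun=> 0); [exact: Ck_cst | apply/funext => x; rewrite big_nil].
rewrite (_ : (fun x => _) = fun x => f i x + \sum_(j <- r) f j x); first exact: CkD.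
by apply/funext => x; rewrite big_cons.
Qed.

Lemma smooth_cst (c : R) : smooth (fun _ : V => c).
Proof. by move=> k; exact: Ck_cst. Qed.

Lemma smoothD f g : smooth f -> smooth g -> smooth (fun x => f x + g x).
Proof. by move=> sf sg k; apply: CkD. Qed.

Lemma smoothM f g : smooth f -> smooth g -> smooth (fun x => f x * g x).
Proof. by move=> sf sg k; apply: CkM. Qed.

Lemma smoothN f : smooth f -> smooth (fun x => - f x).
Proof.
move=> sf; rewrite (_ : (fun x => _) = fun x => (-1) * f x).
  by apply: smoothM => //; exact: smooth_cst.
by apply/funext => x; rewrite mulN1r.
Qed.

Lemma smooth_differentiable f x : smooth f -> differentiable f x.
Proof. by move=> sf; have [+ _] := sf 1%N; apply. Qed.

Lemma smooth_derivable f x v : smooth f -> derivable f x v.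
Proof. by move=> sf; apply: diff_derivable; exact: smooth_differentiable. Qed.

Lemma smooth_continuous f : smooth f -> continuous f.
Proof. by move=> sf; exact: (sf 0%N). Qed.

Lemma smooth_derive f v : smooth f -> smooth ('D_v f).
Proof. by move=> sf k; have [_ D] := sf k.+1; exact: D. Qed.

End Smooth.

(** Along the line through [x] both difference quotients are the same function of [h]. *)
Lemma derive_comp_affine (R : realType) (U V : normedModType R) (f : V -> R)
    (p q : U -> V) (x v : U) :
  (forall h : R, p (h *: v + x) = h *: q v + p x) ->
  'D_v (f \o p) x = 'D_(q v) f (p x).
Proof.
move=> pE; rewrite /derive.
rewrite (_ : (fun h => h^-1 *: ((f \o shift (p x)) (h *: q v) - f (p x))) =
  fun h : R => h^-1 *: ((f \o p \o shift x) (h *: v) - (f \o p) x)) //.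
by apply/funext => h /=; rewrite pE.
Qed.

Lemma derivable_comp_affine (R : realType) (U V : normedModType R) (f : V -> R)
    (p q : U -> V) (x v : U) :
  (forall h : R, p (h *: v + x) = h *: q v + p x) ->
  derivable f (p x) (q v) -> derivable (f \o p) x v.
Proof.
move=> pE; rewrite /derivable.
rewrite (_ : (fun h => h^-1 *: ((f \o shift (p x)) (h *: q v) - f (p x))) =
  fun h : R => h^-1 *: ((f \o p \o shift x) (h *: v) - (f \o p) x)) //.
by apply/funext => h /=; rewrite pE.
Qed.

Section VectorComp.
Context {R : realType} {V : normedModType R} {m : nat}.

Lemma differentiable_rV (F : V -> 'rV[R]_m) p :
  (forall j, differentiable (fun q => F q 0 j) p) -> differentiable F p.
Proof.
move=> dF; rewrite (_ : F = \sum_(j < m) (fun q => F q 0 j *: 'e_j)).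
  by apply: differentiable_sum => j; apply: differentiableZl.
by apply/funext => q; rewrite fct_sumE -row_sum_delta.
Qed.

Lemma derive_rV (F : V -> 'rV[R]_m) p w j :
  (forall j, differentiable (fun q => F q 0 j) p) ->
  ('D_w F p) 0 j = 'D_w (fun q => F q 0 j) p.
Proof.
move=> dF; rewrite derive_mx ?mxE //; apply: diff_derivable; exact: differentiable_rV.
Qed.

Lemma derive_comp_rV (F : V -> 'rV[R]_m) (f : 'rV[R]_m -> R) p w :
  (forall j, differentiable (fun q => F q 0 j) p) -> differentiable f (F p) ->
  'D_w (f \o F) p = \sum_(j < m) 'D_w (fun q => F q 0 j) p * 'D_('e_j) f (F p).
Proof.
move=> dF df; have dF' := differentiable_rV dF.
rewrite deriveE; last exact: differentiable_comp.
rewrite diff_comp //= (_ : 'd F p w = 'D_w F p); last by rewrite deriveE.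
rewrite [in LHS](row_sum_delta ('D_w F p)) linear_sum.
by apply: eq_bigr => j _; rewrite linearZ /= -deriveE // derive_rV.
Qed.

End VectorComp.

(** * Left-invariant derivatives and the divergence obstruction *)

Section Divergence.
Local Open Scope classical_set_scope.
Local Open Scope ring_scope.
Context {R : realType} {m : nat} (G : lieGroup R m).
Local Notation "x ** y" := (gmul G x y) (at level 40, left associativity).
Local Notation T := 'rV[R]_m.
Local Notation gm := (fun p : T * T => p.1 ** p.2).

Lemma gmul_differentiable (p : T * T) j : differentiable (fun q => (q.1 ** q.2) 0 j) p.
Proof. by apply: smooth_differentiable; exact: gmul_smooth. Qed.

(* The derivative at [x] along the left-invariant vector field with value [v] at the unit. *)
Definition left_derive (f : T -> R) (v x : T) : R := 'D_v (fun y => f (x ** y)) (gone G).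

(** A derivative in the second factor becomes a directional derivative, on the product, of [f]
    composed with multiplication; there smoothness of the group law gives joint continuity in the
    base point and the increment. *)
Lemma derive_gmulr (f : T -> R) (v x y : T) :
  'D_v (fun y => f (x ** y)) y = 'D_(0, v) (f \o gm) (x, y).
Proof.
rewrite -(@derive_comp_affine _ _ _ (f \o gm) (fun y => (x, y)) (fun v => (0, v)) y v) //.
by move=> h; congr pair; rewrite /= scaler0 add0r.
Qed.

Lemma continuous_derive_gmul (f : T -> R) (w : T * T) : smooth f ->
  continuous ('D_w (f \o gm)).
Proof.
move=> sf.
rewrite (_ : 'D_w _ = fun p => \sum_(j < m)
   'D_w (fun q : T * T => (q.1 ** q.2) 0 j) p * 'D_('e_j) f (gm p)); last first.
  apply/funext => p; apply: (derive_comp_rV (F := gm)) => [j|]; first exact: gmul_differentiable.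
  exact: smooth_differentiable.
have cgm : continuous gm.
  move=> p; apply: differentiable_continuous; apply: differentiable_rV => j.
  exact: gmul_differentiable.
apply: (@Ck_sum _ _ 0) => j; apply: (@CkM _ _ 0).
  by apply: smooth_derive; exact: gmul_smooth.
move=> p; apply: (@continuous_comp _ _ _ gm ('D_('e_j) f)); first exact: cgm.
by apply: smooth_continuous; exact: smooth_derive.
Qed.

(** A first-order approximation uniform near [x0], from the mean value theorem on s |-> f (x (1 + s
    v)). This path is straight in the coordinates and replaces a one-parameter subgroup. *)
Lemma left_derive_approx (f : T -> R) (v x0 : T) (e : R) : smooth f -> 0 < e ->
  \forall x \near x0 & t \near (0 : R)^'+,
    `|f (x ** (gone G + t *: v)) - f x - t * left_derive f v x| <= e * t.
Proof.
move=> sf e0; set F := 'D_(0, v) (f \o gm).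
have e2 : 0 < e / 2 by rewrite divr_gt0.
have /cvgrPdist_lt/(_ _ e2)/nbhs_ballP[d /= d0 Hd] :=
  @continuous_derive_gmul f (0, v) sf (x0, gone G).
have v0 : 0 < `|v| + 1 by rewrite ltr_wpDl.
near=> x t.
have t0 : 0 < t by near: t; exact: nbhs_right_gt.
have tv s : 0 <= s <= t -> `|s *: v| < d.
  move=> /andP[s0 st]; rewrite normrZ ger0_norm //.
  have : t < d / (`|v| + 1) by near: t; apply: nbhs_right_lt; rewrite divr_gt0.
  rewrite ltr_pdivlMr //; apply: le_lt_trans; apply: ler_pM => //.
  by rewrite lerDl.
have xb : ball x0 d x by near: x; exact: nbhsx_ballx.
have Fb s : 0 <= s <= t -> `|F (x0, gone G) - F (x, gone G + s *: v)| < e / 2.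
  move=> st; apply: Hd; split => //=.
  by rewrite -ball_normE /= opprD addrA subrr sub0r normrN tv.
pose phi s := f (x ** (gone G + s *: v)).
have dphi (s : R) : is_derive s (1 : R) phi (F (x, gone G + s *: v)).
  have pE (h : R) : gone G + (h *: (1 : R) + s) *: v = h *: v + (gone G + s *: v).
    by rewrite -[h *: 1]/(h * 1) mulr1 scalerDl addrCA.
  have pE' (h : R) : (x, h *: v + (gone G + s *: v)) =
      h *: (0, v) + (x, gone G + s *: v) :> T * T.
    by congr pair; rewrite /= scaler0 add0r.
  rewrite /F -derive_gmulr.
  rewrite -(@derive_comp_affine _ _ _ (fun y => f (x ** y))
    (fun s : R => gone G + s *: v) (fun=> v) s 1 pE).
  apply: derivableP.
  apply: (@derivable_comp_affine _ _ _ (fun y => f (x ** y))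
    (fun s : R => gone G + s *: v) (fun=> v) s 1 pE).
  apply: (@derivable_comp_affine _ _ _ (f \o gm) (fun y => (x, y)) (fun v => (0, v))).
    by move=> h; congr pair; rewrite /= scaler0 add0r.
  apply: diff_derivable; apply: differentiable_comp; last exact: smooth_differentiable.
  by apply: differentiable_rV => j; exact: gmul_differentiable.
(* The derivatives at the intermediate point and at 0 are both within e / 2 of the value at (x0, 1),
   hence within e of each other. *)
have [|c /andP[]] := MVT t0 (fun s _ => dphi s).
  by apply: derivable_within_continuous => s _; case: (dphi s).
rewrite /= !bnd_simp => c0 ct; rewrite /phi scale0r addr0 gmul1r subr0 => ->.
rewrite /left_derive derive_gmulr -/F mulrC -mulrBr normrM gtr0_norm // mulrC.
apply: ler_wpM2r; first exact: ltW.
have h1 : 0 <= c <= t by rewrite !ltW.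
have h2 : (0 : R) <= 0 <= t by rewrite lexx ltW.
have := Fb _ h1; have := Fb _ h2; rewrite scale0r addr0.
set a := F (x0, _); set b := F (x, _); set b' := F (x, _) => ab ab'.
rewrite (_ : b' - b = (a - b) - (a - b')); last by ring.
apply: le_trans (ler_normB _ _) _; lra.
Unshelve. all: by end_near.
Qed.

(* A constant divergence would make a sum of differences [f (x h) - f x] bounded
   below by a positive constant, against upper_central_averageable. *)
Lemma no_constant_divergence (Gam : set T) (f : 'I_m -> T -> R) :
  nilpotent_group G -> is_lattice G Gam -> (forall k, smooth (f k)) ->
  (forall k g x, Gam g -> f k (g ** x) = f k x) ->
  ~ (forall x, \sum_(k < m) left_derive (f k) 'e_k x = 1).
Proof.
move=> [K0 HK0] [_ _ _ _ [K cK GK]] sf fG Hdiv.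
have bf k : has_bounded_values (f k).
  have /compact_bounded [M [_ /(_ (M + 1)) HM]] : compact (f k @` K)%classic.
    by apply: continuous_compact => //; apply: continuous_subspaceT; exact: smooth_continuous.
  exists (M + 1) => x; have [g Gg [y Ky ->]] := GK x; rewrite fG //.
  by apply: HM; [rewrite ltrDl | exists y].
(* With this tolerance the [m] errors add up to at most t / 2; [m.+1] instead of [m] keeps the
   constant positive for m = 0. *)
have e0 : 0 < (2 * m.+1%:R)^-1 :> R by rewrite invr_gt0 mulr_gt0 // ltr0n.
pose P (t : R) x := forall k, `|f k (x ** (gone G + t *: 'e_k)) - f k x
    - t * left_derive (f k) 'e_k x| <= (2 * m.+1%:R)^-1 * t.
(* Compactness of [K] yields one [t] valid on all of [K]; lattice invariance then carries the
   estimate to the whole group. *)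
have nK : \forall t \near (0 : R)^'+, K `<=` P t.
  apply: ((compact_near_coveringP K).1 cK R _ P) => x Kx.
  have H k := @left_derive_approx (f k) 'e_k x _ (sf k) e0.
  exact: filter_forall H.
near (0 : R)^'+ => t.
have t0 : 0 < t by near: t; exact: nbhs_right_gt.
have HK : K `<=` P t by near: t.
have lK g x v k : Gam g -> left_derive (f k) v (g ** x) = left_derive (f k) v x.
  by move=> Gg; rewrite /left_derive; congr ('D_v _ _); apply/funext => y; rewrite -gmulA fG.
have HG x k : `|f k (x ** (gone G + t *: 'e_k)) - f k x - t * left_derive (f k) 'e_k x| <=
    (2 * m.+1%:R)^-1 * t.
  have [g Gg [y Ky ->]] := GK x; rewrite lK // -gmulA !(fun x => fG k g x Gg).
  exact: (HK _ Ky k).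
have low x : t / 2 <= \sum_(k < m) (f k (x ** (gone G + t *: 'e_k)) - f k x).
  have -> : \sum_(k < m) (f k (x ** (gone G + t *: 'e_k)) - f k x) = t +
      \sum_(k < m) (f k (x ** (gone G + t *: 'e_k)) - f k x - t * left_derive (f k) 'e_k x).
    by rewrite [in RHS]sumrB -mulr_sumr Hdiv mulr1 addrC subrK.
  have : `|\sum_(k < m) (f k (x ** (gone G + t *: 'e_k)) - f k x - t * left_derive (f k) 'e_k x)|
      <= (2 * m.+1%:R)^-1 * t * (size (index_enum 'I_m))%:R.
    by apply: ler_norm_sum_const => k; exact: HG.
  have -> : size (index_enum 'I_m) = m by rewrite [index_enum _]unlock -enumT size_enum_ord.
  have : (2 * m.+1%:R)^-1 * t * m%:R <= t / 2.
    have u0 : m.+1%:R != 0 :> R by rewrite pnatr_eq0.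
    rewrite (_ : _ * _ * _ = t / 2 * (m%:R / m.+1%:R)); last by field.
    apply: ler_piMr; first by rewrite divr_ge0 // ltW.
    by rewrite ler_pdivrMr ?ltr0n // mul1r ler_nat.
  move=> h1 h2; have := le_trans h2 h1; rewrite ler_norml => /andP[+ _]; lra.
(* Averaging with tolerance t / 4 contradicts the lower bound t / 2 valid at every point. *)
have t4 : 0 < t / 4 by rewrite divr_gt0.
have [s [s0 Hs]] := @upper_central_averageable _ _ G K0 _ (index_enum 'I_m)
  (fun k => gone G + t *: 'e_k) f (fun k => eq_rect _ (fun A : set T => A _) I _ (esym HK0)) bf _ t4.
have := Hs (gone G).
suff : t / 2 * (size s)%:R <= \sum_(g <- s) \sum_(k < m)
    (f k (gone G ** g ** (gone G + t *: 'e_k)) - f k (gone G ** g)).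
  move=> h1 h2; have := le_trans h1 (le_trans (ler_norm _) h2).
  rewrite ler_pM2r ?ltr0n //; lra.
apply: (@le_trans _ _ (\sum_(g <- s) t / 2)); last by apply: ler_sum => g _; exact: low.
by rewrite big_const_seq count_predT iter_addr_0 mulr_natr.
Unshelve. all: by end_near.
Qed.

End Divergence.
(** * Forms in a moving frame *)

Section ComplexSmooth.
Context {R : realType} {V : normedModType R}.
Implicit Types f g : V -> R[i].

Lemma cReD (x y : R[i]) : complex.Re (x + y) = complex.Re x + complex.Re y.
Proof. by case: x; case: y. Qed.

Lemma cImD (x y : R[i]) : complex.Im (x + y) = complex.Im x + complex.Im y.
Proof. by case: x; case: y. Qed.

Lemma cReM (x y : R[i]) :
  complex.Re (x * y) = complex.Re x * complex.Re y - complex.Im x * complex.Im y.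
Proof. by case: x; case: y. Qed.

Lemma cImM (x y : R[i]) :
  complex.Im (x * y) = complex.Re x * complex.Im y + complex.Im x * complex.Re y.
Proof. by case: x; case: y. Qed.

Lemma complex_ext (x y : R[i]) :
  complex.Re x = complex.Re y -> complex.Im x = complex.Im y -> x = y.
Proof. by case: x; case: y => /= ? ? ? ? -> ->. Qed.

Lemma csmooth_cst (c : R[i]) : csmooth (fun _ : V => c).
Proof. by split; exact: smooth_cst. Qed.

Lemma csmoothD f g : csmooth f -> csmooth g -> csmooth (fun x => f x + g x).
Proof.
move=> [fr fi] [gr gi]; split.
  rewrite (_ : (fun x => _) = fun x => complex.Re (f x) + complex.Re (g x)); first exact: smoothD.
  by apply/funext => x; rewrite cReD.
rewrite (_ : (fun x => _) = fun x => complex.Im (f x) + complex.Im (g x)); first exact: smoothD.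
by apply/funext => x; rewrite cImD.
Qed.

Lemma csmoothM f g : csmooth f -> csmooth g -> csmooth (fun x => f x * g x).
Proof.
move=> [fr fi] [gr gi]; split.
  rewrite (_ : (fun x => _) = fun x => complex.Re (f x) * complex.Re (g x) +
    - (complex.Im (f x) * complex.Im (g x))); last by apply/funext => x; rewrite cReM.
  by apply: smoothD; [|apply: smoothN]; apply: smoothM.
rewrite (_ : (fun x => _) = fun x => complex.Re (f x) * complex.Im (g x) +
    complex.Im (f x) * complex.Re (g x)); last by apply/funext => x; rewrite cImM.
by apply: smoothD; apply: smoothM.
Qed.

Lemma csmooth_sum (I : Type) (r : seq I) (P : pred I) (f : I -> V -> R[i]) :
  (forall i, csmooth (f i)) -> csmooth (fun x => \sum_(i <- r | P i) f i x).
Proof.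
move=> sf; elim: r => [|i r IH].
  rewrite (_ : (fun x => _) = fun=> 0); first exact: csmooth_cst.
  by apply/funext => x; rewrite big_nil.
rewrite (_ : (fun x => _) = if P i then fun x => f i x + \sum_(j <- r | P j) f j x
   else fun x => \sum_(j <- r | P j) f j x).
  by case: (P i) => //; exact: csmoothD.
by apply/funext => x; rewrite big_cons; case: (P i).
Qed.

Lemma csmooth_conj f : csmooth f -> csmooth (fun x => (f x)^*%C).
Proof.
move=> [fr fi]; split.
  rewrite (_ : (fun x => _) = fun x => complex.Re (f x)) //.
  by apply/funext => x; case: (f x).
rewrite (_ : (fun x => _) = fun x => - complex.Im (f x)); first exact: smoothN.
by apply/funext => x; case: (f x).
Qed.

Lemma cderive_cst (c : R[i]) v x : cderive (fun _ : V => c) v x = 0.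
Proof. by rewrite /cderive !derive_cst. Qed.

Lemma cderiveD f g v x : csmooth f -> csmooth g ->
  cderive (fun x => f x + g x) v x = cderive f v x + cderive g v x.
Proof.
move=> [fr fi] [gr gi]; apply: complex_ext; rewrite (cReD, cImD) /=.
  rewrite (_ : (fun x => _) = fun x => complex.Re (f x) + complex.Re (g x)).
    by apply: deriveD; exact: smooth_derivable.
  by apply/funext => y; rewrite cReD.
rewrite (_ : (fun x => _) = fun x => complex.Im (f x) + complex.Im (g x)).
  by apply: deriveD; exact: smooth_derivable.
by apply/funext => y; rewrite cImD.
Qed.

Lemma cderiveM f g v x : csmooth f -> csmooth g ->
  cderive (fun x => f x * g x) v x = cderive f v x * g x + f x * cderive g v x.
Proof.
move=> [fr fi] [gr gi].
have dM (a b : V -> R) : smooth a -> smooth b ->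
    'D_v (fun y => a y * b y) x = 'D_v a x * b x + a x * 'D_v b x.
  move=> sa sb; rewrite (@deriveM _ _ a b); [|exact: smooth_derivable..].
  by rewrite addrC mulrC.
apply: complex_ext; rewrite (cReD, cImD) !(cReM, cImM) /=.
  rewrite (_ : (fun x => _) = fun x => complex.Re (f x) * complex.Re (g x) +
    - (complex.Im (f x) * complex.Im (g x))); last by apply/funext => y; rewrite cReM.
  rewrite (@deriveD _ _ _ (fun x => complex.Re (f x) * complex.Re (g x))); last 2 first.
  - by apply: smooth_derivable; exact: smoothM.
  - by apply: smooth_derivable; apply: smoothN; exact: smoothM.
  rewrite (@deriveN _ _ _ (fun x => complex.Im (f x) * complex.Im (g x))); last first.
    by apply: smooth_derivable; exact: smoothM.
  by rewrite !dM //; ring.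
rewrite (_ : (fun x => _) = fun x => complex.Re (f x) * complex.Im (g x) +
    complex.Im (f x) * complex.Re (g x)); last by apply/funext => y; rewrite cImM.
rewrite (@deriveD _ _ _ (fun x => complex.Re (f x) * complex.Im (g x))); last 2 first.
- by apply: smooth_derivable; exact: smoothM.
- by apply: smooth_derivable; exact: smoothM.
by rewrite !dM //; ring.
Qed.

Lemma cderiveZ (c : R[i]) f v x : csmooth f ->
  cderive (fun x => c * f x) v x = c * cderive f v x.
Proof.
by move=> sf; rewrite cderiveM ?cderive_cst ?mul0r ?add0r //; exact: csmooth_cst.
Qed.

Lemma cderive_sum (I : Type) (r : seq I) (P : pred I) (f : I -> V -> R[i]) v x :
  (forall i, csmooth (f i)) ->
  cderive (fun x => \sum_(i <- r | P i) f i x) v x = \sum_(i <- r | P i) cderive (f i) v x.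
Proof.
move=> sf; elim: r => [|i r IH].
  rewrite (_ : (fun x => _) = fun=> 0) ?big_nil ?cderive_cst //.
  by apply/funext => y; rewrite big_nil.
rewrite big_cons -IH.
rewrite (_ : (fun x => _) = if P i then fun x => f i x + \sum_(j <- r | P j) f j x
   else fun x => \sum_(j <- r | P j) f j x).
  by case: (P i) => //; rewrite cderiveD //; exact: csmooth_sum.
by apply/funext => y; rewrite big_cons; case: (P i).
Qed.

Lemma cderive_conj f v x : csmooth f ->
  cderive (fun x => (f x)^*%C) v x = (cderive f v x)^*%C.
Proof.
move=> [fr fi]; apply: complex_ext; rewrite /=.
  by congr ('D_v _ _); apply/funext => y; case: (f y).
rewrite (_ : (fun x => _) = fun x => - complex.Im (f x)).
  by apply: deriveN; exact: smooth_derivable.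
by apply/funext => y; case: (f y).
Qed.

End ComplexSmooth.

Section Forms.
Context {R : realType} {m : nat}.
Implicit Types (al be : cform R m) (x : 'rV[R]_m).

Definition partial (i : 'I_m) al x : ext R m :=
  [ffun I : {set 'I_m} => cderive (fun y => al y I) 'e_i x].

Lemma dformE al x : dform al x = \sum_(i < m) ext_basis [set i] \w partial i al x.
Proof. by apply: eq_bigr => i _; rewrite covector_delta. Qed.

Lemma smooth_form_wedge al be : smooth_form al -> smooth_form be -> smooth_form (fwedge al be).
Proof.
move=> sa sb K; rewrite (_ : (fun x => _) = fun x => \sum_(I : {set 'I_m} | I \subset K)
     (-1) ^+ inversions I (K :\: I) * al x I * be x (K :\: I)).
  by apply: csmooth_sum => I; do 2 apply: csmoothM => //; exact: csmooth_cst.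
by apply/funext => x; rewrite ffunE.
Qed.

Lemma smooth_form_cst (a : ext R m) : smooth_form (fun=> a).
Proof. by move=> K; exact: csmooth_cst. Qed.

Lemma smooth_form_scale (f : 'rV[R]_m -> R[i]) al : csmooth f -> smooth_form al ->
  smooth_form (fun x => ext_scale (f x) (al x)).
Proof.
move=> sf sa K; rewrite (_ : (fun x => _) = fun x => f x * al x K); first exact: csmoothM.
by apply/funext => x; rewrite ffunE.
Qed.

Lemma smooth_form_sum (I : Type) (r : seq I) (al : I -> cform R m) :
  (forall i, smooth_form (al i)) -> smooth_form (fun x => \sum_(i <- r) al i x).
Proof.
move=> sa K; rewrite (_ : (fun x => _) = fun x => \sum_(i <- r) al i x K).
  by apply: csmooth_sum => i; exact: sa.
by apply/funext => x; rewrite sum_ffunE.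
Qed.

Lemma partial_sum (I : Type) (r : seq I) (al : I -> cform R m) i x :
  (forall i, smooth_form (al i)) ->
  partial i (fun x => \sum_(j <- r) al j x) x = \sum_(j <- r) partial i (al j) x.
Proof.
move=> sa; apply/ffunP => K; rewrite sum_ffunE ffunE.
rewrite (_ : (fun x => _) = fun x => \sum_(j <- r) al j x K); last first.
  by apply/funext => y; rewrite sum_ffunE.
rewrite cderive_sum; last by move=> j; exact: sa.
by apply: eq_bigr => j _; rewrite ffunE.
Qed.

Lemma partial_wedge al be i x : smooth_form al -> smooth_form be ->
  partial i (fwedge al be) x = partial i al x \w be x + al x \w partial i be x.
Proof.
move=> sa sb; apply/ffunP => K; rewrite !ffunE.
rewrite (_ : (fun x => _) = fun x => \sum_(I : {set 'I_m} | I \subset K)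
     (-1) ^+ inversions I (K :\: I) * (al x I * be x (K :\: I))); last first.
  by apply/funext => y; rewrite ffunE; apply: eq_bigr => I _; rewrite mulrA.
rewrite cderive_sum => [|I]; last first.
  by apply: csmoothM; [exact: csmooth_cst | apply: csmoothM].
rewrite -big_split; apply: eq_bigr => I _; rewrite cderiveZ; last exact: csmoothM.
by rewrite cderiveM // !ffunE mulrDr !mulrA.
Qed.

Lemma partial_scale (f : 'rV[R]_m -> R[i]) al i x : csmooth f -> smooth_form al ->
  partial i (fun x => ext_scale (f x) (al x)) x =
  ext_scale (cderive f 'e_i x) (al x) + ext_scale (f x) (partial i al x).
Proof.
move=> sf sa; apply/ffunP => K; rewrite !ffunE.
rewrite (_ : (fun x => _) = fun x => f x * al x K); last by apply/funext => y; rewrite ffunE.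
by rewrite cderiveM.
Qed.

Lemma partial_cst (a : ext R m) i x : partial i (fun=> a) x = 0.
Proof. by apply/ffunP => K; rewrite !ffunE cderive_cst. Qed.

Lemma dform_cst (a : ext R m) x : dform (fun=> a) x = 0.
Proof. by rewrite dformE big1 // => i _; rewrite partial_cst ext_wedge0r. Qed.

Lemma dform_sum (I : Type) (r : seq I) (al : I -> cform R m) x :
  (forall i, smooth_form (al i)) ->
  dform (fun x => \sum_(j <- r) al j x) x = \sum_(j <- r) dform (al j) x.
Proof.
move=> sa; rewrite dformE; under eq_bigr do rewrite partial_sum // ext_wedge_sumr.
by rewrite exchange_big; apply: eq_bigr => j _; rewrite dformE.
Qed.

Lemma dform_scale (f : 'rV[R]_m -> R[i]) al x : csmooth f -> smooth_form al ->
  dform (fun x => ext_scale (f x) (al x)) x =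
  covector (\row_i cderive f 'e_i x) \w al x + ext_scale (f x) (dform al x).
Proof.
move=> sf sa; rewrite dformE.
under eq_bigr do rewrite partial_scale // ext_wedgeDr !ext_wedgeZr.
rewrite big_split /= covectorE ext_wedge_suml; congr (_ + _).
  by apply: eq_bigr => i _; rewrite mxE ext_wedgeZl.
by rewrite dformE ext_scale_sumr.
Qed.

Lemma dform_wedge1 (r : 'rV[R]_m -> 'rV[R[i]]_m) be x :
  smooth_form (fun x => covector (r x)) -> smooth_form be ->
  dform (fwedge (fun x => covector (r x)) be) x =
  dform (fun x => covector (r x)) x \w be x - covector (r x) \w dform be x.
Proof.
move=> sr sb; rewrite !dformE.
under eq_bigr do rewrite partial_wedge // ext_wedgeDr.
rewrite big_split ext_wedge_suml ext_wedge_sumr -sumrN; congr (_ + _).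
  by apply: eq_bigr => i _; rewrite ext_wedgeA.
by apply: eq_bigr => i _; rewrite !ext_wedgeA -covector_delta covectorC ext_wedgeNl.
Qed.

Lemma ext_conj_wedge (a b : ext R m) : ext_conj (a \w b) = ext_conj a \w ext_conj b.
Proof.
apply/ffunP => K; rewrite !ffunE rmorph_sum; apply: eq_bigr => I _.
by rewrite !ffunE !rmorphM rmorphXn rmorphN rmorph1.
Qed.

Lemma ext_conjD (a b : ext R m) : ext_conj (a + b) = ext_conj a + ext_conj b.
Proof. by apply/ffunP => K; rewrite !ffunE rmorphD. Qed.

Lemma ext_conjZ c (a : ext R m) : ext_conj (ext_scale c a) = ext_scale c^*%C (ext_conj a).
Proof. by apply/ffunP => K; rewrite !ffunE rmorphM. Qed.

Lemma ext_conjK (a : ext R m) : ext_conj (ext_conj a) = a.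
Proof. by apply/ffunP => K; rewrite !ffunE conjcK. Qed.

Lemma ext_conj0 : ext_conj (0 : ext R m) = 0.
Proof. by apply/ffunP => K; rewrite !ffunE rmorph0. Qed.

Lemma ext_conj_basis I : ext_conj (ext_basis I : ext R m) = ext_basis I.
Proof. by apply/ffunP => K; rewrite !ffunE rmorph_nat. Qed.

Lemma ext_conj_covector (v : 'rV[R[i]]_m) :
  ext_conj (covector v) = covector (map_mx (fun z => z^*%C) v).
Proof.
by apply/ffunP => K; rewrite !ffunE rmorph_sum; apply: eq_bigr => i _; rewrite mxE.
Qed.

Lemma dform_conj al x : smooth_form al -> dform (fconj al) x = ext_conj (dform al x).
Proof.
move=> sa; rewrite !dformE.
rewrite (big_morph _ ext_conjD ext_conj0); apply: eq_bigr => i _.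
rewrite ext_conj_wedge ext_conj_basis; congr (_ \w _); apply/ffunP => K; rewrite !ffunE.
rewrite -cderive_conj //; congr (cderive _ _ _).
by apply/funext => y; rewrite ffunE.
Qed.

End Forms.

(** * Antiderivations of the exterior algebra *)

Section Derivation.
Context {R : realType} {m : nat}.
Implicit Types (a b : ext R m) (D : nat -> ext R m) (w : seq nat).

Fixpoint der_word D w : ext R m :=
  if w is i :: w' then D i \w wedge_word ext_gen w' - ext_gen i \w der_word D w' else 0.

(* The antiderivation sending dx_i to [D i]. *)
Definition der D a : ext R m := \sum_(I : {set 'I_m}) ext_scale (a I) (der_word D (set_word I)).

Lemma der_lin D : ext_linear (der D).
Proof.
move=> k a b; rewrite /der ext_scale_sumr -big_split; apply: eq_bigr => I _.
by rewrite !ffunE ext_scaleDl ext_scaleA.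
Qed.

Lemma der_basis D I : der D (ext_basis I) = der_word D (set_word I).
Proof.
rewrite /der (bigD1 I) //= big1 => [|J nIJ].
  by rewrite ffunE eqxx ext_scale1 addr0.
by rewrite ffunE (negPf nIJ) ext_scale0l.
Qed.

Lemma der_sorted D w : sorted ltn w -> all (fun i => i < m)%N w ->
  der D (wedge_word ext_gen w) = der_word D w.
Proof. by move=> sw aw; rewrite wedge_word_basis // der_basis word_setK. Qed.

Lemma der_wordD D1 D2 w : der_word (fun i => D1 i + D2 i) w = der_word D1 w + der_word D2 w.
Proof.
elim: w => [|i w IH] /=; first by rewrite addr0.
by rewrite IH ext_wedgeDl ext_wedgeDr opprD addrACA.
Qed.

Lemma derD D1 D2 a : der (fun i => D1 i + D2 i) a = der D1 a + der D2 a.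
Proof.
rewrite /der -big_split; apply: eq_bigr => I _.
by rewrite der_wordD ext_scaleDr.
Qed.

Lemma pure_der_word (P : pred nat) r s D w :
  (forall i, pure P (P i + r)%N (~~ P i + s)%N (D i)) ->
  pure P (count P w + r)%N (count (predC P) w + s)%N (der_word D w).
Proof.
move=> pD; elim: w => [|i w IH] /=; first exact: pure0.
apply: pureD.
  have := pure_wedge (pD i) (@pure_word R m P w).
  by rewrite addnAC [X in pure _ _ X]addnAC.
apply: pureN; have := pure_wedge (@pure_gen R m P i) IH.
by rewrite !addnA.
Qed.

Lemma pure_der (P : pred nat) r s D p q a :
  (forall i, pure P (P i + r)%N (~~ P i + s)%N (D i)) ->
  pure P p q a -> pure P (p + r)%N (q + s)%N (der D a).
Proof.
move=> pD pa; apply: pure_sum => I _; have [->|/pa[<- <-]] := eqVneq (a I) 0.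
  by rewrite ext_scale0l; exact: pure0.
apply: pureZ; have := pure_der_word (w := set_word I) pD.
by rewrite !count_set_word.
Qed.

Lemma ext_map_genn (A : 'M[R[i]]_m) (i : nat) :
  ext_map A (ext_gen i) = cov_family (fun i => row i A) i.
Proof.
rewrite /ext_gen /cov_family; case: insubP => [j _ _|_].
  by rewrite ext_map_covector rowE.
exact: ext_linear0 (ext_map_lin A).
Qed.

Lemma ext_map_word (A : 'M[R[i]]_m) w :
  ext_map A (wedge_word ext_gen w) = wedge_word (cov_family (fun i => row i A)) w.
Proof.
by elim: w => [|i w IH] /=; rewrite ?ext_map1 // ext_map_wedge IH ext_map_genn.
Qed.

End Derivation.

(** * The operators d, del and delbar in an adapted frame *)

Section Frame.
Context {R : realType} {m : nat} (J : acs R m) (P : pred nat)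
  (A : 'rV[R]_m -> 'M[R[i]]_m).
Implicit Types (h : cform R m) (x : 'rV[R]_m).

(* The i-th row of [A x] holds the coordinates at [x] of the i-th form of a
   coframe; [P] selects the forms of type (1,0), the others having type (0,1). *)
Record frame : Prop := Frame {
  frame_unit : forall x, A x \in unitmx;
  frame_smooth : forall i j, csmooth (fun x => A x i j);
  frame_inv_smooth : forall i j, csmooth (fun x => invmx (A x) i j);
  frame10 : forall x (i : 'I_m), row i (A x) *m proj10 (J x) = if P i then row i (A x) else 0;
  frame01 : forall x (i : 'I_m), row i (A x) *m proj01 (J x) = if P i then 0 else row i (A x) }.

Definition frame_form h : cform R m := fun x => ext_map (A x) (h x).

Definition frame_coef (al : cform R m) : cform R m := fun x => ext_map (invmx (A x)) (al x).

(* The derivative of [f] along the i-th vector field of the dual frame. *)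
Definition frame_derive (i : 'I_m) (f : 'rV[R]_m -> R[i]) x : R[i] :=
  \sum_(j < m) invmx (A x) j i * cderive f 'e_j x.

Definition frame_partial (i : 'I_m) h : cform R m :=
  fun x => [ffun I : {set 'I_m} => frame_derive i (fun y => h y I) x].

Hypothesis fA : frame.

Lemma frame_coefK al : frame_form (frame_coef al) = al.
Proof. by apply/funext => x; rewrite /frame_form /frame_coef ext_map_unitK // frame_unit. Qed.

Lemma frame_formK h : frame_coef (frame_form h) = h.
Proof. by apply/funext => x; rewrite /frame_form /frame_coef ext_map_unitKV // frame_unit. Qed.

Lemma smooth_ext_map (B : 'rV[R]_m -> 'M[R[i]]_m) al :
  (forall i j, csmooth (fun x => B x i j)) -> smooth_form al ->
  smooth_form (fun x => ext_map (B x) (al x)).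
Proof.
move=> sB sal; apply: smooth_form_sum => I; apply: smooth_form_scale; first exact: sal.
under eq_fun do rewrite wedge_familyE.
elim: (set_word I) => [|i w IH] /=; first exact: smooth_form_cst.
suff H : smooth_form (fun x => cov_family (fun i => row i (B x)) i) by exact: smooth_form_wedge H IH.
rewrite /cov_family; case: insubP => [j _ _|_]; last exact: smooth_form_cst.
move=> K; rewrite (_ : (fun x => _) = fun x => \sum_(k < m | K == [set k]) B x j k).
  by apply: csmooth_sum => k; exact: sB.
by apply/funext => x; rewrite ffunE; apply: eq_bigr => k _; rewrite mxE.
Qed.

Lemma smooth_frame_form h : smooth_form h -> smooth_form (frame_form h).
Proof. by apply: smooth_ext_map; exact: frame_smooth. Qed.

Lemma smooth_frame_coef al : smooth_form al -> smooth_form (frame_coef al).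
Proof. by apply: smooth_ext_map; exact: frame_inv_smooth. Qed.

Lemma type_part_frame p q h :
  type_part J p q (frame_form h) = frame_form (fun x => std_part P p q (h x)).
Proof.
apply/funext => x; rewrite /type_part /frame_form (ext_part_map (P := P)) //.
  exact: frame10.
exact: frame01.
Qed.

Section Structure.
Variable D : nat -> ext R m.
Hypothesis structure_eqs : forall (i : 'I_m) x,
  dform (fun x => covector (row i (A x))) x = ext_map (A x) (D i).

Lemma smooth_row (i : 'I_m) : smooth_form (fun x => covector (row i (A x))).
Proof.
have := @smooth_frame_form (fun=> ext_gen i) (smooth_form_cst _).
rewrite /smooth_form /frame_form => H K.
by have := H K; under eq_fun do rewrite ext_map_gen.
Qed.

Lemma dform_word w x : all (fun i => i < m)%N w ->
  dform (frame_form (fun=> wedge_word ext_gen w)) x = ext_map (A x) (der_word D w).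
Proof.
elim: w => [|i w IH] /=.
  move=> _; rewrite (ext_linear0 (ext_map_lin _)).
  rewrite (_ : frame_form _ = fun=> ext1 R m) ?dform_cst //.
  by apply/funext => y; rewrite /frame_form ext_map1.
case/andP => im /IH {}IH; set i' := Ordinal im.
rewrite (_ : frame_form _ = fwedge (fun x => covector (row i' (A x)))
   (frame_form (fun=> wedge_word ext_gen w))); last first.
  apply/funext => y; rewrite /frame_form /fwedge ext_map_wedge.
  by rewrite -(@ext_map_gen _ _ _ i').
rewrite dform_wedge1; last 2 first.
- exact: smooth_row.
- by apply: smooth_frame_form; exact: smooth_form_cst.
rewrite structure_eqs IH (ext_linearD _ _ (ext_map_lin _)) ext_map_wedge.
congr (_ + _); rewrite -[X in _ = ext_map _ X]ext_scale1 ext_scaleNr -ext_scaleNl.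
rewrite (ext_linearZ _ _ (ext_map_lin _)) ext_scaleNl ext_scale1 ext_map_wedge.
by rewrite -(@ext_map_gen _ _ _ i').
Qed.

Lemma frame_gradient (f : 'rV[R]_m -> R[i]) x :
  covector (\row_j cderive f 'e_j x) =
  ext_map (A x) (\sum_(i < m) ext_scale (frame_derive i f x) (ext_gen i)).
Proof.
set r := \row_j _.
have -> : \sum_(i < m) ext_scale (frame_derive i f x) (ext_gen i) = covector (r *m invmx (A x)).
  rewrite covectorE; apply: eq_bigr => i _.
  rewrite /ext_gen cov_family_ord covector_delta mxE; congr ext_scale.
  by apply: eq_bigr => j _; rewrite !mxE mulrC.
by rewrite ext_map_covector mulmxKV // frame_unit.
Qed.

(** Leibniz on coefficients times frame monomials: gradients are expanded in the coframe, and d of a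
    monomial is the antiderivation given by the structure equations. *)
Lemma dform_frame h x : smooth_form h ->
  dform (frame_form h) x =
  ext_map (A x) (\sum_(i < m) (ext_gen i \w frame_partial i h x) + der D (h x)).
Proof.
move=> sh.
have lA := ext_map_lin (A x).
have sI I : smooth_form (fun x => ext_map (A x) (ext_basis I)).
  exact: smooth_frame_form (smooth_form_cst _).
rewrite (_ : frame_form h = fun x => \sum_I ext_scale (h x I) (ext_map (A x) (ext_basis I)));
  last by apply/funext => y; rewrite /frame_form (ext_linearE _ (ext_map_lin _)).
rewrite dform_sum => [|I]; last by apply: smooth_form_scale => //; exact: sh.
under eq_bigr => I _.
  rewrite (dform_scale _ (sh I) (sI I)).
  rewrite frame_gradient -ext_map_wedge ext_basis_word dform_word ?set_word_lt //.
  rewrite -(ext_linearZ _ _ lA) -(ext_linearD _ _ lA); over.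
rewrite -(ext_linear_sum _ _ _ lA) big_split /=; congr (ext_map _ (_ + _)).
under eq_bigr do rewrite -ext_basis_word ext_wedge_suml.
rewrite exchange_big; apply: eq_bigr => i _.
rewrite [frame_partial i h x]ext_decomp ext_wedge_sumr; apply: eq_bigr => I _.
by rewrite ext_wedgeZl ext_wedgeZr ffunE.
Qed.

End Structure.

Lemma frame_partial_part i p q h x :
  frame_partial i (fun x => std_part P p q (h x)) x = std_part P p q (frame_partial i h x).
Proof.
apply/ffunP => I; rewrite !ffunE; case: ifP => c; rewrite /frame_derive.
  have -> : (fun y => std_part P p q (h y) I) = (fun y => h y I) by apply/funext => y; rewrite ffunE c.
  by [].
rewrite big1 // => j _; rewrite (_ : (fun y => _) = fun=> 0) ?cderive_cst ?mulr0 //.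
by apply/funext => y; rewrite ffunE c.
Qed.

Lemma smooth_std_part p q h : smooth_form h -> smooth_form (fun x => std_part P p q (h x)).
Proof.
move=> sh I; case c : ((deg10 P I == p) && (deg01 P I == q)).
  by under eq_fun do rewrite ffunE c; exact: sh.
by under eq_fun do rewrite ffunE c; exact: csmooth_cst.
Qed.

Section Del.
Variables D1 D2 : nat -> ext R m.
Hypothesis pure1 : forall i, pure P (P i + 1)%N (~~ P i + 0)%N (D1 i).
Hypothesis pure2 : forall i, pure P (P i + 0)%N (~~ P i + 1)%N (D2 i).
Hypothesis structure_eqs : forall (i : 'I_m) x,
  dform (fun x => covector (row i (A x))) x = ext_map (A x) (D1 i + D2 i).

Let der1_part p q a : pure P p q a -> std_part P p.+1 q (der D1 a) = der D1 a.
Proof.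
move=> pa; apply: pure_std_part; have := pure_der pure1 pa.
by rewrite addn1 addn0.
Qed.

Let der2_part p q a : pure P p q a -> std_part P p q.+1 (der D2 a) = der D2 a.
Proof.
move=> pa; apply: pure_std_part; have := pure_der pure2 pa.
by rewrite addn1 addn0.
Qed.

Let der1_part0 p q a : pure P p q a -> std_part P p q.+1 (der D1 a) = 0.
Proof.
move=> pa; have := pure_der pure1 pa; rewrite addn1 addn0 => /std_part_pure0; apply.
by rewrite xpair_eqE gtn_eqF.
Qed.

Let der2_part0 p q a : pure P p q a -> std_part P p.+1 q (der D2 a) = 0.
Proof.
move=> pa; have := pure_der pure2 pa; rewrite addn1 addn0 => /std_part_pure0; apply.
by rewrite xpair_eqE ltn_eqF.
Qed.

Let gen_part p q (i : 'I_m) (a : ext R m) : pure P p q a ->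
  std_part P p.+1 q (ext_gen i \w a) = (if P i then ext_gen i \w a else 0) /\
  std_part P p q.+1 (ext_gen i \w a) = (if P i then 0 else ext_gen i \w a).
Proof.
move=> pa; have := pure_wedge (@pure_gen R m P i) pa.
case: (P i); rewrite ?add1n ?add0n => pw; rewrite (pure_std_part pw); split=> //.
  by apply: (std_part_pure0 pw); rewrite xpair_eqE gtn_eqF.
by apply: (std_part_pure0 pw); rewrite xpair_eqE ltn_eqF.
Qed.

Let part_sum_lin (f : ext R m -> ext R m) a : ext_linear f ->
  \sum_(p < m.+1) \sum_(q < m.+1) f (std_part P p q a) = f a.
Proof.
move=> lf; rewrite -{2}(std_part_sum P a) (ext_linear_sum _ _ _ lf).
by apply: eq_bigr => p _; rewrite (ext_linear_sum _ _ _ lf).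
Qed.

(** Among the terms of [dform_frame], those raising the first degree are the derivatives along the
    (1,0) fields and [der D1]. Both are linear and shift all types alike, so the double sum over
    types reassembles. *)
Lemma del_frame h : smooth_form h ->
  del J (frame_form h) = frame_form (fun x =>
    \sum_(i < m | P i) (ext_gen i \w frame_partial i h x) + der D1 (h x)).
Proof.
move=> sh; apply/funext => x; rewrite /del fct_sumE.
have lg (i : 'I_m) : ext_linear (fun a : ext R m => ext_gen i \w a) by exact: ext_wedge_lin_r.
transitivity (\sum_(p < m.+1) \sum_(q < m.+1) ext_map (A x)
   (\sum_(i < m | P i) (ext_gen i \w std_part P p q (frame_partial i h x)) +
    der D1 (std_part P p q (h x)))); last first.
  rewrite [RHS]/frame_form -[in RHS](part_sum_lin _ (der_lin D1)).
  under eq_bigr do rewrite -(ext_linear_sum _ _ _ (ext_map_lin (A x))).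
  rewrite -(ext_linear_sum _ _ _ (ext_map_lin (A x))); congr ext_map.
  under eq_bigr do rewrite big_split.
  rewrite big_split; congr (_ + _); rewrite exchange_big /=.
  under eq_bigr do rewrite exchange_big.
  rewrite exchange_big; apply: eq_bigr => i _.
  by rewrite exchange_big (part_sum_lin _ (lg i)).
apply: eq_bigr => p _; rewrite fct_sumE; apply: eq_bigr => q _.
rewrite type_part_frame.
have -> : dform (frame_form (fun x => std_part P p q (h x))) = frame_form (fun x =>
   \sum_(i < m) (ext_gen i \w std_part P p q (frame_partial i h x)) +
    (der D1 (std_part P p q (h x)) + der D2 (std_part P p q (h x)))).
  apply/funext => y; rewrite (@dform_frame (fun i => D1 i + D2 i) structure_eqs) //; last exact: smooth_std_part.
  rewrite /frame_form derD; congr (ext_map _ (_ + _)).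
  by apply: eq_bigr => i _; rewrite frame_partial_part.
rewrite type_part_frame /frame_form; congr (ext_map _ _).
have lS := @std_part_lin R m P p.+1 q.
rewrite !(ext_linearD _ _ lS) (ext_linear_sum _ _ _ lS).
have pp a := @std_part_pure R m P p q a.
rewrite der1_part // der2_part0 // addr0; congr (_ + _).
rewrite [RHS]big_mkcond; apply: eq_bigr => i _.
by have [-> _] := gen_part i (pp (frame_partial i h x)).
Qed.

Lemma delbar_frame h : smooth_form h ->
  delbar J (frame_form h) = frame_form (fun x =>
    \sum_(i < m | ~~ P i) (ext_gen i \w frame_partial i h x) + der D2 (h x)).
Proof.
move=> sh; apply/funext => x; rewrite /delbar fct_sumE.
have lg (i : 'I_m) : ext_linear (fun a : ext R m => ext_gen i \w a) by exact: ext_wedge_lin_r.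
transitivity (\sum_(p < m.+1) \sum_(q < m.+1) ext_map (A x)
   (\sum_(i < m | ~~ P i) (ext_gen i \w std_part P p q (frame_partial i h x)) +
    der D2 (std_part P p q (h x)))); last first.
  rewrite [RHS]/frame_form -[in RHS](part_sum_lin _ (der_lin D2)).
  under eq_bigr do rewrite -(ext_linear_sum _ _ _ (ext_map_lin (A x))).
  rewrite -(ext_linear_sum _ _ _ (ext_map_lin (A x))); congr ext_map.
  under eq_bigr do rewrite big_split.
  rewrite big_split; congr (_ + _); rewrite exchange_big /=.
  under eq_bigr do rewrite exchange_big.
  rewrite exchange_big; apply: eq_bigr => i _.
  by rewrite exchange_big (part_sum_lin _ (lg i)).
apply: eq_bigr => p _; rewrite fct_sumE; apply: eq_bigr => q _.
rewrite type_part_frame.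
have -> : dform (frame_form (fun x => std_part P p q (h x))) = frame_form (fun x =>
   \sum_(i < m) (ext_gen i \w std_part P p q (frame_partial i h x)) +
    (der D1 (std_part P p q (h x)) + der D2 (std_part P p q (h x)))).
  apply/funext => y; rewrite (@dform_frame (fun i => D1 i + D2 i) structure_eqs) //; last exact: smooth_std_part.
  rewrite /frame_form derD; congr (ext_map _ (_ + _)).
  by apply: eq_bigr => i _; rewrite frame_partial_part.
rewrite type_part_frame /frame_form; congr (ext_map _ _).
have lS := @std_part_lin R m P p q.+1.
rewrite !(ext_linearD _ _ lS) (ext_linear_sum _ _ _ lS).
have pp a := @std_part_pure R m P p q a.
rewrite der1_part0 // der2_part // add0r; congr (_ + _).
rewrite [RHS]big_mkcond; apply: eq_bigr => i _.
by have [_ ->] := gen_part i (pp (frame_partial i h x)); rewrite if_neg.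
Qed.

Lemma frame_partial_cst i a x : frame_partial i (fun=> a) x = 0.
Proof.
by apply/ffunP => I; rewrite !ffunE /frame_derive big1 // => j _; rewrite cderive_cst mulr0.
Qed.

Lemma del_frame_cst a : del J (frame_form (fun=> a)) = frame_form (fun=> der D1 a).
Proof.
rewrite del_frame; last exact: smooth_form_cst.
apply/funext => x; rewrite /frame_form big1 ?add0r // => i _.
by rewrite frame_partial_cst ext_wedge0r.
Qed.

Lemma delbar_frame_cst a : delbar J (frame_form (fun=> a)) = frame_form (fun=> der D2 a).
Proof.
rewrite delbar_frame; last exact: smooth_form_cst.
apply/funext => x; rewrite /frame_form big1 ?add0r // => i _.
by rewrite frame_partial_cst ext_wedge0r.
Qed.

Lemma dform_frame_cst a :
  dform (frame_form (fun=> a)) = frame_form (fun=> der D1 a + der D2 a).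
Proof.
apply/funext => x; rewrite (@dform_frame (fun i => D1 i + D2 i) structure_eqs); last exact: smooth_form_cst.
rewrite /frame_form derD big1 ?add0r // => i _.
by rewrite frame_partial_cst ext_wedge0r.
Qed.

End Del.
End Frame.
(** The induction closes because a derivative of [f \o p] is again a composite with [p]. *)
Lemma smooth_comp_affine (R : realType) (U V : normedModType R) (p q : U -> V) (f : V -> R) :
  (forall x v (h : R), p (h *: v + x) = h *: q v + p x) -> (forall x, differentiable p x) ->
  smooth f -> smooth (f \o p).
Proof.
move=> pE dp sf k; have {sf} := sf k; elim: k f => [|k IH] f /=.
  move=> cf x; apply: continuous_comp; last exact: cf.
  exact: differentiable_continuous.
move=> [df Df]; split=> [x|v]; first exact: differentiable_comp.
rewrite (_ : 'D_v _ = 'D_(q v) f \o p); first exact: IH.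
by apply/funext => x; rewrite (@derive_comp_affine _ _ _ f p q x v).
Qed.

(** * The invariant frame of a complex nilmanifold *)

Section Jacobian.
Context {R : realType} {m : nat} (G : lieGroup R m).
Local Notation "x ** y" := (gmul G x y) (at level 40, left associativity).
Local Notation T := 'rV[R]_m.

Lemma gmulr_differentiable (x y : T) j : differentiable (fun z => (x ** z) 0 j) y.
Proof.
apply: (@differentiable_comp _ _ _ _ (fun z => (x, z)) (fun p : T * T => (p.1 ** p.2) 0 j)).
  apply: differentiable_pair; [exact: differentiable_cst | exact: ex_diff].
exact: gmul_differentiable.
Qed.

Lemma jacobian_gmul (x y : T) i j : ('J (gmul G x) y) i j = 'D_('e_i) (fun z => (x ** z) 0 j) y.
Proof.
rewrite /jacobian mxE -deriveE; last first.
  by apply: differentiable_rV => k; exact: gmulr_differentiable.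
by rewrite derive_rV // => k; exact: gmulr_differentiable.
Qed.

Lemma smooth_jacobian_gone i j : smooth (fun x => ('J (gmul G x) (gone G)) i j).
Proof.
under eq_fun do rewrite jacobian_gmul.
rewrite (_ : (fun x => _) =
  'D_(0, 'e_i) (fun p : T * T => (p.1 ** p.2) 0 j) \o (fun x => (x, gone G))); last first.
  apply/funext => x /=.
  rewrite -(@derive_comp_affine _ _ _ (fun p : T * T => (p.1 ** p.2) 0 j)
    (fun y => (x, y)) (fun v => (0, v)) (gone G) 'e_i) //.
  by move=> h; congr pair; rewrite /= scaler0 add0r.
apply: (@smooth_comp_affine _ _ _ _ (fun v => (v, 0))).
- by move=> x v h; congr pair; rewrite /= scaler0 add0r.
- by move=> x; apply: differentiable_pair; [exact: ex_diff | exact: differentiable_cst].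
- by apply: smooth_derive; exact: gmul_smooth.
Qed.

Lemma left_deriveE (f : T -> R) v x : smooth f ->
  left_derive G f v x = \sum_(j < m) 'D_v (fun y => (x ** y) 0 j) (gone G) * 'D_('e_j) f x.
Proof.
move=> sf; rewrite /left_derive (derive_comp_rV (F := gmul G x)) ?gmul1r //.
  by move=> j; exact: gmulr_differentiable.
exact: smooth_differentiable.
Qed.

End Jacobian.

(** * Values of 2-forms on pairs of vectors *)

Section Evaluation.
Context {R : realType} {m : nat}.
Implicit Types (u : 'rV[R[i]]_m) (v w : 'rV[R]_m).

Definition covector_eval u v : R[i] := \sum_(i < m) u 0 i * (v 0 i)%:C%C.

Lemma covector_wedge2 u u' (i j : 'I_m) : (i < j)%N ->
  (covector u \w covector u') [set i; j] = u 0 i * u' 0 j - u 0 j * u' 0 i.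
Proof.
move=> ij; have nij : i != j by rewrite -val_eqE ltn_eqF.
rewrite !covectorE ext_wedge_suml sum_ffunE.
under eq_bigr => k _ do rewrite ext_wedge_sumr sum_ffunE.
have E k l : (ext_scale (u 0 k) (ext_basis [set k]) \w
     ext_scale (u' 0 l) (ext_basis [set l]) : ext R m) [set i; j] =
   (if (k == i) && (l == j) then u 0 i * u' 0 j else 0) +
   (if (k == j) && (l == i) then - (u 0 j * u' 0 i) else 0).
  rewrite ext_wedgeZl ext_wedgeZr ext_wedge_basis.
  have [<-|nkl] := eqVneq k l.
    rewrite -setI_eq0 setIid -cards_eq0 cards1 /= !ext_scale0r ffunE.
    case: (eqVneq k i) => [->|_]; first by rewrite (negPf nij) /= addr0.
    by case: (eqVneq k j) => _; rewrite /= addr0.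
  rewrite ifT; last by rewrite disjoints1 inE.
  rewrite inversions1 !ffunE.
  have -> : ([set i; j] == [set k] :|: [set l]) = ((k == i) && (l == j)) || ((k == j) && (l == i)).
    apply/eqP/orP => [/setP e|[/andP[/eqP-> /eqP->]|/andP[/eqP-> /eqP->]]] //; last first.
      by rewrite setUC.
    have := e k; have := e l; rewrite !inE !eqxx ?orbT /=.
    case/orP => /eqP li; case/orP => /eqP ki; rewrite li ki ?eqxx in nkl *; by [|left|right].
  case: (eqVneq k i) => [->|nki] /=.
    rewrite (negPf nij) /= orbF addr0; case: (eqVneq l j) => [->|_] /=; last by rewrite !mulr0.
    by rewrite ltnNge (ltnW ij) expr0 !mulr1.
  case: (eqVneq k j) => [->|_] /=; last by rewrite !mulr0 addr0.
  case: (eqVneq l i) => [->|_] /=; last by rewrite !mulr0 addr0.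
  by rewrite ij expr1 mulr1 mulrN1 mulrN add0r.
under eq_bigr => k _ do under eq_bigr => l _ do rewrite E.
under eq_bigr => k _ do rewrite big_split /=.
rewrite big_split /=; congr (_ + _).
  rewrite (bigD1 i) //= (bigD1 j) //= !eqxx /= !big1 ?addr0 //.
    by move=> k /negPf ->; rewrite big1.
  by move=> l /negPf ->.
rewrite (bigD1 j) //= (bigD1 i) //= !eqxx /= !big1 ?addr0 //.
  by move=> k /negPf ->; rewrite big1.
by move=> l /negPf ->.
Qed.

Lemma ext_eval2_covector u u' v w : ext_eval2 (covector u \w covector u') v w =
  covector_eval u v * covector_eval u' w - covector_eval u w * covector_eval u' v.
Proof.
pose S i j := u 0 i * u' 0 j * ((v 0 i)%:C%C * (w 0 j)%:C%C - (v 0 j)%:C%C * (w 0 i)%:C%C) : R[i].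
transitivity (\sum_(i < m) \sum_(j < m) S i j); last first.
  rewrite /covector_eval !mulr_suml -sumrB; apply: eq_bigr => i _.
  by rewrite !mulr_sumr -sumrB; apply: eq_bigr => j _; rewrite /S; ring.
rewrite /ext_eval2.
transitivity (\sum_(i < m) \sum_(j < m | (i < j)%N) (S i j + S j i)).
  apply: eq_bigr => i _; apply: eq_bigr => j ij; rewrite covector_wedge2 //.
  by rewrite rmorphB !rmorphM /S; ring.
under eq_bigr do rewrite big_split /=.
rewrite big_split /=.
have -> : \sum_(i < m) \sum_(j < m | (i < j)%N) S j i = \sum_(i < m) \sum_(j < m | (j < i)%N) S i j.
  under eq_bigr do rewrite big_mkcond.
  rewrite exchange_big; apply: eq_bigr => i _; rewrite [RHS]big_mkcond; exact: eq_bigr.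
rewrite -big_split; apply: eq_bigr => i _ /=.
rewrite [RHS](bigID (fun j : 'I_m => (i < j)%N)) /=; congr (_ + _).
rewrite [RHS](bigD1 i) ?ltnn //= [S i i](_ : _ = 0) ?add0r; last by rewrite /S; ring.
by apply: eq_bigl => j; rewrite -leqNgt ltn_neqAle andbC.
Qed.

Lemma ext_eval2_lin (k : R[i]) a b v w :
  ext_eval2 (ext_scale k a + b) v w = k * ext_eval2 a v w + ext_eval2 b v w.
Proof.
rewrite /ext_eval2 mulr_sumr -big_split; apply: eq_bigr => i _ /=.
rewrite mulr_sumr -big_split; apply: eq_bigr => j _ /=.
by rewrite !ffunE mulrDl mulrA.
Qed.

End Evaluation.

Lemma ext_part10 (R : realType) (m : nat) (J : 'M[R]_m) (a : ext R m) :
  ext_part J 1 0 a = covector ((\row_i a [set i]) *m proj10 J).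
Proof.
rewrite /ext_part -ext_map_covector /ext_map.
apply: eq_bigr => I _.
rewrite (eq_bigl (fun S : {set 'I_m} => (#|I| == 1%N) && (S == I))) => [|S]; last first.
  rewrite cards_eq0 setD_eq0; apply/and3P/andP => [[sSI cS sIS]|[cI /eqP ->]]; last by [].
  have e : S = I by apply/eqP; rewrite eqEsubset sSI.
  by rewrite -e.
case: (eqVneq #|I| 1%N) => [/eqP/cards1P[i ->]|nI] /=; last first.
  rewrite big_pred0 // ffunE big_pred0 ?ext_scale0l // => i.
  by apply/negP => /eqP e; rewrite e cards1 in nI.
rewrite (big_pred1 [set i]) // covector_set1 mxE /wedge_family enum_set1 !big_cons !big_nil !ext_wedge1r.
by rewrite set11.
Qed.

Section InvariantFrame.
Context {R : realType} {n : nat} (X : complexNilmanifold R n) (w : n.-tuple (cform R (2 * n))).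
Local Notation G := (cn_group X).
Local Notation J := (cn_J X).
Local Notation T := 'rV[R]_(2 * n).
Hypothesis hw : coframe10 X w.

Definition coframe_row (k : nat) (x : T) : 'rV[R[i]]_(2 * n) :=
  if insub k is Some k' then \row_j (tnth w k' x) [set j] else 0.

Definition frame_row (k : nat) (x : T) : 'rV[R[i]]_(2 * n) :=
  if (k < n)%N then coframe_row k x else map_mx (fun z => z^*%C) (coframe_row (k - n) x).

Definition frame_mx (x : T) : 'M[R[i]]_(2 * n) := \matrix_(i < 2 * n) frame_row i x.

Lemma frame_mx_row (i : 'I_(2 * n)) x : row i (frame_mx x) = frame_row i x.
Proof. by rewrite rowK. Qed.

Lemma coframe_row10 k x : coframe_row k x *m proj10 (J x) = coframe_row k x.
Proof.
rewrite /coframe_row; case: insubP => [k' _ _|_]; last by rewrite mul0mx.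
have [_ _ /(_ k') tw _] := hw.
apply: covector_inj; rewrite -ext_part10 -[ext_part _ _ _ _]/(type_part J 1 0 (tnth w k') x) tw.
have := tw; rewrite /has_type /type_part => /(congr1 (fun f => f x)); rewrite ext_part10 => <-.
by congr covector; apply/rowP => j; rewrite [RHS]mxE covector_set1.
Qed.

(** Forms have mixed degree a priori; the (1,0) condition is what reduces a member of the coframe to
    a covector. *)
Lemma coframe_rowE (k : 'I_n) x : tnth w k x = covector (coframe_row k x).
Proof.
have [_ _ /(_ k) tw _] := hw.
have e : coframe_row k x = \row_j (tnth w k x) [set j] by rewrite /coframe_row valK.
rewrite -(coframe_row10 k x) e -ext_part10.
exact: esym (congr1 (fun f => f x) tw).
Qed.

Lemma proj_sum x : proj10 (J x) + proj01 (J x) = 1%:M.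
Proof.
rewrite /proj10 /proj01 -scalerDr addrACA addNr addr0 -scalemx1 -scalerDl scalerA.
by rewrite mulVf ?scale1r ?scalemx1 // -natrD pnatr_eq0.
Qed.

Lemma conj_proj10 x : map_mx (fun z => z^*%C) (proj10 (J x)) = proj01 (J x).
Proof.
apply/matrixP => i j; rewrite !mxE; set z := 2^-1.
have zc : z^*%C = z by rewrite conjc_inv conjc_nat.
rewrite rmorphM [X in X * _]zc; congr (z * _).
by case: (i == j); apply: complex_ext; rewrite /=; ring.
Qed.

Lemma mul_proj10_01 k x : coframe_row k x *m proj01 (J x) = 0.
Proof.
have := mulmxDr (coframe_row k x) (proj10 (J x)) (proj01 (J x)).
rewrite proj_sum mulmx1 coframe_row10 => /eqP.
by rewrite -subr_eq0 opprD addrA subrr sub0r oppr_eq0 => /eqP.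
Qed.

Lemma frame_row10 k x :
  frame_row k x *m proj10 (J x) = if (k < n)%N then frame_row k x else 0.
Proof.
rewrite /frame_row; case: ifP => _; first exact: coframe_row10.
pose cj : 'rV[R[i]]_(2 * n) -> 'rV[R[i]]_(2 * n) := map_mx (fun z => z^*%C).
have cjK : cancel cj cj by move=> M; apply/matrixP => i j; rewrite !mxE conjcK.
apply: (can_inj cjK); rewrite /cj.
rewrite map_mxM conj_proj10 -[LHS](_ : coframe_row (k - n) x *m proj01 (J x) = _).
  by rewrite mul_proj10_01; apply/matrixP => i j; rewrite !mxE; apply: complex_ext; rewrite /= ?oppr0.
by congr (_ *m _); apply/matrixP => i j; rewrite !mxE /= conjcK.
Qed.

Lemma frame_row01 k x :
  frame_row k x *m proj01 (J x) = if (k < n)%N then 0 else frame_row k x.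
Proof.
have := mulmxDr (frame_row k x) (proj10 (J x)) (proj01 (J x)).
rewrite proj_sum mulmx1 frame_row10; case: ifP => _; last by rewrite add0r => <-.
by move=> /eqP; rewrite -subr_eq0 opprD addrA subrr sub0r oppr_eq0 => /eqP.
Qed.

Lemma coframe_row_free (c : 'I_n -> R[i]) x :
  \sum_(k < n) c k *: coframe_row k x = 0 -> forall k, c k = 0.
Proof.
move=> c0; have [_ _ _ /(_ x)] := hw; apply.
under eq_bigr do rewrite coframe_rowE -covectorZ.
rewrite -(big_morph _ (@covectorD R (2 * n)) (@covector0 R (2 * n))) c0.
exact: covector0.
Qed.

(** The projections separate a vanishing combination of rows into its (1,0) and (0,1) halves. The
    first vanishes by freeness of the coframe, the second by the same argument after conjugation. *)
Lemma frame_mx_unit x : frame_mx x \in unitmx.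
Proof.
rewrite -row_free_unit; apply: inj_row_free => v vA.
pose c (k : nat) := if insub k is Some i then v 0 i else 0 : R[i].
have sumE (B : 'M[R[i]]_(2 * n)) : v *m frame_mx x *m B =
    \sum_(0 <= k < n) c k *: (frame_row k x *m B) +
    \sum_(0 <= k < n) c (k + n)%N *: (frame_row (k + n) x *m B).
  rewrite [v *m _]mulmx_sum_row mulmx_suml.
  transitivity (\sum_(0 <= k < 2 * n) c k *: (frame_row k x *m B)).
    rewrite big_mkord; apply: eq_bigr => i _.
    by rewrite frame_mx_row scalemxAl /c valK.
  rewrite (@big_cat_nat _ _ _ n) //=; last by rewrite leq_pmull.
  congr (_ + _); rewrite -[X in \big[_/_]_(X <= _ < _) _]add0n big_addn.
  by rewrite (_ : index_iota 0 (2 * n - n) = index_iota 0 n) // mul2n -addnn addnK.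
have c0 k : (k < n)%N -> c k = 0.
  move=> kn; have := sumE (proj10 (J x)); rewrite vA mul0mx.
  rewrite [X in _ + X]big1 ?addr0 => [|j _]; last first.
    by rewrite frame_row10 ltnNge leq_addl scaler0.
  rewrite big_mkord => /esym; under eq_bigr => i _ do
    rewrite frame_row10 ltn_ord /frame_row ltn_ord.
  by move/coframe_row_free => /(_ (Ordinal kn)).
have c1 k : (k < n)%N -> c (k + n)%N = 0.
  move=> kn; have := sumE (proj01 (J x)); rewrite vA mul0mx.
  rewrite big_nat_cond big1 ?add0r => [|j]; last first.
    by rewrite andbT => /andP[_ jn]; rewrite frame_row01 jn scaler0.
  rewrite big_mkord; under eq_bigr => i _ do
    rewrite frame_row01 /frame_row ltnNge leq_addl addnK.
  move=> /esym/(congr1 (map_mx (fun z => z^*%C))).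
  rewrite map_mx0 raddf_sum /=.
  under eq_bigr => i _.
    rewrite (_ : map_mx _ _ = (c (i + n)%N)^*%C *: coframe_row i x); last first.
      by apply/matrixP => a b; rewrite !mxE rmorphM /= conjcK.
    over.
  move/(coframe_row_free (c := fun i : 'I_n => (c (i + n)%N)^*%C)) => /(_ (Ordinal kn)) /= e.
  by rewrite -[c _]conjcK e conjc0.
apply/rowP => i; rewrite mxE; have -> : v 0 i = c i by rewrite /c valK.
have [|ni] := ltnP i n; first exact: c0.
rewrite -(subnK ni); apply: c1; rewrite ltn_subLR // addnn -mul2n; exact: ltn_ord.
Qed.

Definition left_jacobian (x y : T) : 'M[R[i]]_(2 * n) :=
  map_mx (real_complex R) ('J (gmul G x) y)^T.

Lemma coframe_row_inv k g x :
  coframe_row k (gmul G g x) *m left_jacobian g x = coframe_row k x.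
Proof.
have [kn|nk] := ltnP k n; last first.
  by rewrite /coframe_row insubF ?mul0mx // ltnNge nk.
rewrite -[k]/(val (Ordinal kn)); apply: covector_inj.
rewrite -ext_map_covector -!coframe_rowE.
have [_ /(_ (Ordinal kn) g) + _ _] := hw.
by move/(congr1 (fun f => f x)).
Qed.

Lemma frame_mx_inv g x : frame_mx (gmul G g x) *m left_jacobian g x = frame_mx x.
Proof.
apply/row_matrixP => i; rewrite row_mul !frame_mx_row /frame_row; case: ifP => _.
  exact: coframe_row_inv.
rewrite -(coframe_row_inv _ g x) map_mxM; congr (_ *m _).
by apply/matrixP => a b; rewrite !mxE /= oppr0.
Qed.

(** Invariance compares the frame at [x] with that at the unit. The inverse is thus a Jacobian times
    a constant matrix, which shows its smoothness and relates the dual fields to left-invariant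
    derivatives. *)
Lemma frame_mx_invE x :
  invmx (frame_mx x) = left_jacobian x (gone G) *m invmx (frame_mx (gone G)).
Proof.
have := frame_mx_inv x (gone G); rewrite gmul1r => e.
apply: (can_inj (mulKmx (frame_mx_unit x))); rewrite mulmxV ?frame_mx_unit //.
by rewrite mulmxA e mulmxV ?frame_mx_unit.
Qed.

Lemma invariant_frame : frame J (fun i => i < n)%N frame_mx.
Proof.
split.
- exact: frame_mx_unit.
- move=> i j; under eq_fun do rewrite mxE /frame_row.
  have s (k : nat) : csmooth (fun x => coframe_row k x 0 j).
    rewrite /coframe_row; case: insubP => [k' _ _|_].
      by under eq_fun do rewrite mxE; have [+ _ _ _] := hw; apply.
    by under eq_fun do rewrite mxE; exact: csmooth_cst.
  case: (i < n)%N; first exact: s.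
  by under eq_fun do rewrite mxE; apply: csmooth_conj; exact: s.
- move=> i j; under eq_fun do rewrite frame_mx_invE mxE.
  apply: csmooth_sum => k; apply: csmoothM; last exact: csmooth_cst.
  under eq_fun do rewrite mxE mxE; split; last exact: smooth_cst.
  exact: smooth_jacobian_gone.
- by move=> x i; rewrite frame_mx_row frame_row10.
- by move=> x i; rewrite frame_mx_row frame_row01.
Qed.

Lemma cov_family_coframe (k : 'I_n) x :
  cov_family (fun i => row i (frame_mx x)) k = tnth w k x.
Proof.
have kn : (k < 2 * n)%N by rewrite (leq_trans (ltn_ord k)) ?leq_pmull.
rewrite -[val k]/(val (Ordinal kn)) cov_family_ord frame_mx_row /frame_row /= ltn_ord.
by rewrite -coframe_rowE.
Qed.

Lemma cov_family_conj (k : 'I_n) x :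
  cov_family (fun i => row i (frame_mx x)) (n + k) = ext_conj (tnth w k x).
Proof.
have kn : (n + k < 2 * n)%N by rewrite mul2n -addnn ltn_add2l.
rewrite -[(n + k)%N]/(val (Ordinal kn)) cov_family_ord frame_mx_row /frame_row /=.
by rewrite ltnNge leq_addr /= addKn coframe_rowE ext_conj_covector.
Qed.

Lemma form_on_cst a : form_on X (frame_form frame_mx (fun=> a)).
Proof.
split; first by apply: (smooth_frame_form invariant_frame); exact: smooth_form_cst.
move=> g _; apply/funext => x.
by rewrite /pullback /frame_form ext_map_comp -/(left_jacobian g x) frame_mx_inv.
Qed.

Lemma frame_coef_inv al g x : form_on X al -> cn_lattice X g ->
  frame_coef frame_mx al (gmul G g x) = frame_coef frame_mx al x.
Proof.
move=> [_ al_inv] gG; have /(congr1 (fun f => f x)) := al_inv g gG.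
rewrite /pullback -/(left_jacobian g x) /frame_coef => <-.
rewrite ext_map_comp; congr (ext_map _ _).
apply: (can_inj (mulKmx (frame_mx_unit (gmul G g x)))).
by rewrite mulmxA frame_mx_inv !mulmxV ?frame_mx_unit.
Qed.

(* Along the dual frame a divergence of invariant functions is, up to the constant
   matrix [invmx (frame_mx (gone G))], a divergence in the sense of
   no_constant_divergence. *)
Lemma no_constant_frame_divergence (F : 'I_(2 * n) -> T -> R[i]) (c : R[i]) :
  (forall i, csmooth (F i)) ->
  (forall i g x, cn_lattice X g -> F i (gmul G g x) = F i x) ->
  (forall x, \sum_(i < 2 * n) frame_derive frame_mx i (F i) x = c) -> c = 0.
Proof.
move=> sF FG Fc; apply/eqP/negPn/negP => c0.
pose C := invmx (frame_mx (gone G)).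
(* Dividing by [c] normalises the divergence to 1, whose real part is the constant that
   [no_constant_divergence] forbids. *)
pose H k x := \sum_(i < 2 * n) c^-1 * C k i * F i x.
have sH k : csmooth (H k).
  by apply: csmooth_sum => i; apply: csmoothM => //; exact: csmooth_cst.
apply: (@no_constant_divergence _ _ G _ (fun k x => complex.Re (H k x)) (cn_nilpotent X)
  (cn_latticeP X)) => [k|k g x Gg|x]; first by case: (sH k).
  by congr complex.Re; apply: eq_bigr => i _; rewrite FG.
have -> : 1 = complex.Re (c^-1 * c) by rewrite mulVf.
rewrite -{2}(Fc x) mulr_sumr.
have ReS (r : seq 'I_(2 * n)) (f : 'I_(2 * n) -> R[i]) :
    complex.Re (\sum_(i <- r) f i) = \sum_(i <- r) complex.Re (f i).
  by elim/big_rec2: _ => // i a b _ <-; rewrite cReD.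
transitivity (complex.Re (\sum_(k < 2 * n) \sum_(j < 2 * n)
    left_jacobian x (gone G) j k * cderive (H k) 'e_j x)).
  rewrite ReS; apply: eq_bigr => k _; rewrite left_deriveE; last by case: (sH k).
  rewrite ReS; apply: eq_bigr => j _.
  by rewrite cReM mxE mxE /= mul0r subr0 jacobian_gmul.
congr complex.Re; rewrite /frame_derive.
under [RHS]eq_bigr => i _ do rewrite mulr_sumr.
under [LHS]eq_bigr => k _.
  under eq_bigr => j _.
    rewrite /H cderive_sum; last by move=> i; apply: csmoothM => //; exact: csmooth_cst.
    under eq_bigr => i _ do rewrite cderiveZ //.
    rewrite mulr_sumr; over.
  rewrite exchange_big; over.
rewrite [LHS]exchange_big; apply: eq_bigr => i _.
rewrite [LHS]exchange_big; apply: eq_bigr => j _.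
rewrite frame_mx_invE mxE mulr_suml mulr_sumr; apply: eq_bigr => k _.
by rewrite -/C; ring.
Qed.

End InvariantFrame.
(** * Symbolic computation with combinations of words *)

Fixpoint word_eqb (v w : seq nat) : bool :=
  match v, w with
  | [::], [::] => true
  | i :: v', j :: w' => if eqn i j then word_eqb v' w' else false
  | _, _ => false
  end.

Lemma word_eqbE v w : word_eqb v w = (v == w).
Proof. by elim: v w => [|i v IH] [|j w] //=; rewrite eqnE IH eqseq_cons; case: (i == j). Qed.

Section Combinations.
Context {K : comNzRingType}.
Implicit Types (l : seq (K * seq nat)) (w : seq nat).

Fixpoint comb_add (t : K * seq nat) l : seq (K * seq nat) :=
  if l is t' :: l' then
    if word_eqb t.2 t'.2 then (t.1 + t'.1, t.2) :: l' else t' :: comb_add t l'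
  else [:: t].

Definition comb_collect l := foldr comb_add [::] l.

Definition comb_scale (c : K) l := [seq (c * t.1, t.2) | t <- l].

Definition comb_mul1 (t t' : K * seq nat) : seq (K * seq nat) :=
  if word_mul t.2 t'.2 is Some (s, v) then [:: (signed s (t.1 * t'.1), v)] else [::].

Definition comb_mul l l' :=
  comb_collect (flatten [seq flatten [seq comb_mul1 t t' | t' <- l'] | t <- l]).

Definition comb_pow l n := iter n (comb_mul l) [:: (1, [::])].

Fixpoint comb_der_word (D : nat -> seq (K * seq nat)) w :=
  if w is i :: w' then
    comb_mul (D i) [:: (1, w')] ++ comb_mul [:: (- 1, [:: i])] (comb_der_word D w')
  else [::].

Definition comb_der D l :=
  comb_collect (flatten [seq comb_scale t.1 (comb_der_word D t.2) | t <- l]).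

Definition comb_sorted (m : nat) l :=
  all (fun t : K * seq nat => sorted ltn t.2 && all (fun i => i < m)%N t.2) l.

Definition comb_coef l w : K := foldr (fun t c => if word_eqb t.2 w then t.1 + c else c) 0 l.

Definition comb_pairing (L l : seq (K * seq nat)) : K :=
  foldr (fun t c => comb_coef L t.2 * t.1 + c) 0 l.

(** A conjunction of equations after merging equal words: the coefficients are polynomials in free
    parameters, so each equation is left to [ring]. *)
Definition comb_zero l : Prop := foldr (fun t Q => t.1 = 0 /\ Q) True (comb_collect l).

End Combinations.

Section Evaluation.
Context {R : realType} {m : nat}.
Implicit Types (l : seq (R[i] * seq nat)) (w : seq nat).

Definition comb_eval l : ext R m :=
  \sum_(t <- l) ext_scale t.1 (wedge_word ext_gen t.2).

Lemma ext_gen_anticommuting : anticommuting (@ext_gen R m).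
Proof. exact: cov_family_anticommuting. Qed.

Lemma comb_eval_cat l l' : comb_eval (l ++ l') = comb_eval l + comb_eval l'.
Proof. by rewrite /comb_eval big_cat. Qed.

Lemma comb_eval_flatten (ls : seq (seq (R[i] * seq nat))) :
  comb_eval (flatten ls) = \sum_(l <- ls) comb_eval l.
Proof.
elim: ls => [|l ls IH]; first by rewrite /comb_eval !big_nil.
by rewrite /= comb_eval_cat IH big_cons.
Qed.

Lemma comb_eval_add t l :
  comb_eval (comb_add t l) = ext_scale t.1 (wedge_word ext_gen t.2) + comb_eval l.
Proof.
elim: l => [|t' l IH] /=; first by rewrite /comb_eval big_seq1 big_nil addr0.
rewrite word_eqbE; case: eqP => [e|_]; rewrite /comb_eval !big_cons /=.
  by rewrite -e ext_scaleDl addrA.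
by rewrite -!/(comb_eval _) IH addrCA.
Qed.

Lemma comb_eval_collect l : comb_eval (comb_collect l) = comb_eval l.
Proof.
elim: l => [//|t l IH] /=; rewrite comb_eval_add IH.
by rewrite [in RHS]/comb_eval big_cons.
Qed.

Lemma comb_eval_scale c l : comb_eval (comb_scale c l) = ext_scale c (comb_eval l).
Proof.
rewrite /comb_eval big_map ext_scale_sumr; apply: eq_bigr => t _.
by rewrite ext_scaleA.
Qed.

Lemma comb_eval_mul l l' : comb_eval (comb_mul l l') = comb_eval l \w comb_eval l'.
Proof.
rewrite /comb_mul comb_eval_collect comb_eval_flatten big_map.
rewrite [comb_eval l]/comb_eval ext_wedge_suml; apply: eq_bigr => t _.
rewrite comb_eval_flatten big_map [comb_eval l']/comb_eval ext_wedge_sumr.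
apply: eq_bigr => t' _.
rewrite ext_wedgeZl ext_wedgeZr ext_scaleA wedge_word_mul; last exact: ext_gen_anticommuting.
rewrite /comb_mul1; case: word_mul => [[s v]|]; last by rewrite /comb_eval big_nil ext_scale0r.
by rewrite /comb_eval big_seq1; case: s => //=; rewrite ext_scaleNl ext_scaleNr.
Qed.

Lemma comb_eval1 w : comb_eval [:: (1, w)] = wedge_word ext_gen w.
Proof. by rewrite /comb_eval big_seq1 ext_scale1. Qed.

Lemma comb_eval_der_word D w :
  comb_eval (comb_der_word D w) = der_word (fun i => comb_eval (D i)) w.
Proof.
elim: w => [|i w IH] /=; first by rewrite /comb_eval big_nil.
rewrite comb_eval_cat !comb_eval_mul comb_eval1 IH; congr (_ + _).
by rewrite /comb_eval big_seq1 /= ext_scaleNl ext_scale1 ext_wedge1r ext_wedgeNl.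
Qed.

Lemma comb_eval_der D l : comb_sorted m l ->
  comb_eval (comb_der D l) = der (fun i => comb_eval (D i)) (comb_eval l).
Proof.
move=> sl; have lD := @der_lin R m (fun i => comb_eval (D i)).
rewrite /comb_der comb_eval_collect comb_eval_flatten big_map.
rewrite [comb_eval l]/comb_eval (ext_linear_sum _ _ _ lD).
rewrite big_seq [RHS]big_seq; apply: eq_bigr => t /(allP sl) /andP[st bt].
by rewrite comb_eval_scale (ext_linearZ _ _ lD) comb_eval_der_word der_sorted.
Qed.

Lemma comb_eval_pow l n : comb_eval (comb_pow l n) = iter n (ext_wedge (comb_eval l)) (ext1 R m).
Proof.
elim: n => [|n IH]; first by rewrite comb_eval1.
by rewrite -[comb_pow l n.+1]/(comb_mul l (comb_pow l n)) comb_eval_mul IH.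
Qed.

Lemma comb_eval_zero l : comb_zero l -> comb_eval l = 0.
Proof.
rewrite -comb_eval_collect /comb_zero; elim: (comb_collect l) => [|t l' IH] /=.
  by rewrite /comb_eval big_nil.
case=> t0 /IH e; move: e; rewrite /comb_eval big_cons t0 => ->.
by rewrite ext_scale0l add0r.
Qed.

Lemma comb_eval_eq l l' : comb_zero (l ++ comb_scale (- 1) l') -> comb_eval l = comb_eval l'.
Proof.
move/comb_eval_zero; rewrite comb_eval_cat comb_eval_scale ext_scaleNl ext_scale1.
by move/eqP; rewrite subr_eq0 => /eqP.
Qed.

Definition comb_functional (L : seq (R[i] * seq nat)) (a : ext R m) : R[i] :=
  \sum_(t <- L) t.1 * a (word_set t.2).

Lemma comb_functionalZ L c a b :
  comb_functional L (ext_scale c a + b) = c * comb_functional L a + comb_functional L b.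
Proof.
rewrite /comb_functional mulr_sumr -big_split; apply: eq_bigr => t _ /=.
by rewrite !ffunE mulrDr mulrCA.
Qed.

(** Sortedness makes a word recoverable from its set of letters, so reading a coefficient at a set
    amounts to comparing words. *)
Lemma comb_functionalE L l : comb_sorted m L -> comb_sorted m l ->
  comb_functional L (comb_eval l) = comb_pairing L l.
Proof.
move=> sL; elim: l => [_|t l IH] /=.
  by rewrite /comb_functional big1 // => t _; rewrite /comb_eval big_nil ffunE mulr0.
case/andP => /andP[st bt] /IH {}IH.
rewrite /comb_eval big_cons comb_functionalZ -/(comb_eval l) IH mulrC; congr (_ * _ + _).
rewrite wedge_word_basis // /comb_functional.
elim: L sL {IH} => [|t' L IHL] /=; first by rewrite big_nil.
case/andP => /andP[st' bt'] /IHL {}IHL; rewrite big_cons IHL ffunE word_eqbE.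
rewrite (can_in_eq (f := @word_set m) (g := set_word)
  (D := [pred w | sorted ltn w && all (fun i => i < m)%N w])) ?inE ?st ?bt ?st' ?bt' //.
  by case: eqP => _; rewrite ?mulr1 ?mulr0 ?add0r.
by move=> w /andP[sw bw]; rewrite word_setK.
Qed.

Lemma ext_map_comb (A : 'M[R[i]]_m) l : ext_map A (comb_eval l) =
  \sum_(t <- l) ext_scale t.1 (wedge_word (cov_family (fun i => row i A)) t.2).
Proof.
rewrite /comb_eval (ext_linear_sum _ _ _ (ext_map_lin A)); apply: eq_bigr => t _.
by rewrite (ext_linearZ _ _ (ext_map_lin A)) ext_map_word.
Qed.

Lemma pure_comb (P : pred nat) p q l :
  all (fun t : R[i] * seq nat => (count P t.2 == p) && (count (predC P) t.2 == q)) l ->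
  pure P p q (comb_eval l).
Proof.
elim: l => [_|t l IH] /=; first by rewrite /comb_eval big_nil; exact: pure0.
case/andP => /andP[/eqP e1 /eqP e2] al; rewrite /comb_eval big_cons.
by apply: pureD; [apply: pureZ; rewrite -e1 -e2; exact: pure_word | exact: IH al].
Qed.

End Evaluation.

(** * The structure equations and the polynomial identities behind the claims *)

Section StructureConstants.
Context {K : comNzRingType}.
Variables (a c a' c' b : K).

(* The letters 0..4 and 5..9 stand for w1..w5 and their conjugates, [a'] and [c'] for
   the conjugates of [a] and [c]; [comb_D1] and [comb_D2] are del and delbar. *)
Definition comb_D1 (i : nat) : seq (K * seq nat) :=
  match i with
  | 4 => [:: (a, [:: 0; 1]%N); (c, [:: 2; 3]%N)]
  | 9 => [:: (- 1, [:: 0; 5]%N); (- 1, [:: 1; 6]%N); (- 1, [:: 2; 7]%N); (- b, [:: 3; 8]%N)]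
  | _ => [::]
  end.

Definition comb_D2 (i : nat) : seq (K * seq nat) :=
  match i with
  | 4 => [:: (1, [:: 0; 5]%N); (1, [:: 1; 6]%N); (1, [:: 2; 7]%N); (b, [:: 3; 8]%N)]
  | 9 => [:: (a', [:: 5; 6]%N); (c', [:: 7; 8]%N)]
  | _ => [::]
  end.

Definition comb_D (i : nat) := comb_D1 i ++ comb_D2 i.

(** The fundamental form without its factor i, so that the coefficients make sense in any
    commutative ring. *)
Definition comb_diag (e : K) : seq (K * seq nat) :=
  [:: (1, [:: 0; 5]%N); (1, [:: 1; 6]%N); (1, [:: 2; 7]%N); (e, [:: 3; 8]%N); (1, [:: 4; 9]%N)].

(* Leading term w1bar w3bar w5bar, up to the factor [a' * c'] clearing denominators;
   the other terms solve the zigzag equations of the spectral sequence down to type (3,1). *)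
Definition comb_alpha : seq (K * seq nat) :=
  [:: (a' * c', [:: 5; 7; 9]%N); (- c', [:: 1; 7; 9]%N); (b * a', [:: 3; 5; 9]%N);
      (c', [:: 1; 4; 7]%N); (- (b * a'), [:: 3; 4; 5]%N)].

Definition comb_d_alpha : seq (K * seq nat) :=
  [:: (- (c * c'), [:: 1; 2; 3; 7]%N); (a * a' * b, [:: 0; 1; 3; 5]%N)].

(* A linear form on the 4-forms of types (1,3), (2,2) and (3,1) vanishing on [D] of
   the invariant 3-forms of filtration >= 1; found by solving this linear system. *)
Definition comb_L : seq (K * seq nat) :=
  [:: (a' * c', [:: 0; 1; 3; 5]%N); (a' * c', [:: 1; 2; 3; 7]%N);
      (c', [:: 1; 3; 5; 6]%N); (- a', [:: 1; 3; 7; 8]%N);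
      (c * a' * c' + b * a', [:: 0; 1; 5; 7]%N); (- (a * a' * c') - c', [:: 2; 3; 5; 7]%N);
      (- (c * c'), [:: 1; 5; 6; 7]%N); (- (a * a'), [:: 3; 5; 7; 8]%N)].

Ltac comb_compute := cbv [comb_zero comb_collect comb_add comb_scale comb_mul comb_mul1
  comb_pow comb_der comb_der_word comb_coef comb_pairing comb_D comb_D1 comb_D2 comb_diag
  comb_alpha comb_d_alpha comb_L word_insert word_mul word_eqb eqn nat_ltb signed
  foldr map flatten cat iter addb negb fst snd].

(** Let B be the sum of the first four terms of F, which is closed, and let theta and Omega be the
    (2,0) and (1,1) parts of d w^5. Then del delbar F^3 = - 3 B^2 (Omega^2 + theta thetabar). In
    units of the product of the four w^{k kbar}, k <= 4, the product B^2 Omega^2 is 12 (b + 1), four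
    times the second elementary symmetric function of (1, 1, 1, b), and B^2 theta thetabar is - 2 (a
    a' + c c'). *)
Lemma astheno_identity : a * a' + c * c' = 6%:R * (b + 1) ->
  comb_zero (comb_der comb_D1 (comb_der comb_D2 (comb_pow (comb_diag 1) 3))).
Proof.
move=> h; have {}h : a * a' = 6%:R * (b + 1) - c * c' by rewrite -h addrK.
comb_compute; repeat split; ring: h.
Qed.

(** With B and Omega as above, del F^4 comes from 4 B^3 Omega, and B^3 Omega is 6 (3 + b) in the
    same units; hence 24 (3 + b). In delbar of the witness only the a' term of delbar w^{5bar}
    survives, since the letters of the other terms already occur. *)
Lemma gauduchon_identity (t : K) : t * a' = - (24%:R * (3%:R + b)) ->
  comb_zero (comb_der comb_D1 (comb_pow (comb_diag 1) 4) ++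
    comb_scale (- 1) (comb_der comb_D2 [:: (t, [:: 0; 1; 2; 3; 4; 7; 8; 9]%N)])).
Proof.
move=> h; comb_compute; repeat split; ring: h.
Qed.

(** With weight [e] on w^{4 4bar} the product B^3 Omega becomes 6 (3 e + b): three of the four
    triple products in B^3 contain the weighted term, and the remaining one meets the coefficient
    b. *)
Lemma balanced_identity (e : K) : 3%:R * e + b = 0 ->
  comb_zero (comb_der comb_D1 (comb_pow (comb_diag e) 4)) /\
  comb_zero (comb_der comb_D2 (comb_pow (comb_diag e) 4)).
Proof.
move=> h; have {}h : b = - (3%:R * e) by apply/eqP; rewrite -addr_eq0 addrC h.
split; comb_compute; repeat split; ring: h.
Qed.

Lemma d_alpha_identity :
  comb_zero (comb_der comb_D comb_alpha ++ comb_scale (- 1) comb_d_alpha).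
Proof. comb_compute; repeat split; ring. Qed.

(** D w^{245} = w^{124 1bar} - w^{234 3bar}, so [comb_L] must weigh the two terms of [comb_d_alpha]
    equally. Their coefficients therefore add up, to b |a|^2 - |c|^2 once a' and c' are the
    conjugates. *)
Lemma L_d_alpha : comb_pairing comb_L comb_d_alpha = a' * c' * (a * a' * b - c * c').
Proof. comb_compute; ring. Qed.

(** The basis words of the invariant 3-forms of filtration at least 1: some letter is a (1,0)
    generator. *)
Definition increasing_triples : seq (seq nat) :=
  [seq w <- flatten [seq flatten [seq [seq [:: i; j; k] | k <- iota 0 10] | j <- iota 0 10]
   | i <- iota 0 10] | sorted ltn w && has (fun i => i < 5)%N w].

Lemma L_closed_all : foldr (fun w Q => comb_pairing comb_L (comb_der_word comb_D w) = 0 /\ Q)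
  True increasing_triples.
Proof.
(* The list is evaluated beforehand, since its filter uses library functions that [comb_compute]
   does not unfold. *)
have -> : increasing_triples = ltac:(let x := eval vm_compute in increasing_triples in exact x)
  by vm_compute.
by comb_compute; repeat split; ring.
Qed.

Lemma L_closed_sorted :
  all (fun w => comb_sorted 10 (comb_der_word comb_D w)) increasing_triples.
Proof. by vm_compute. Qed.

Lemma sorted_pow3 : comb_sorted 10 (comb_pow (comb_diag 1) 3).
Proof. by vm_compute. Qed.

Lemma sorted_D2_pow3 : comb_sorted 10 (comb_der comb_D2 (comb_pow (comb_diag 1) 3)).
Proof. by vm_compute. Qed.

Lemma sorted_pow4 e : comb_sorted 10 (comb_pow (comb_diag e) 4).
Proof. by vm_compute. Qed.

End StructureConstants.

(** * Invariant forms, the filtration and positivity in the invariant frame *)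

Section FrameFunctional.
Context {R : realType} {n : nat} (X : complexNilmanifold R n) (w : n.-tuple (cform R (2 * n))).
Hypothesis hw : coframe10 X w.
Local Notation m := (2 * n)%N.
Local Notation A := (frame_mx w).
Local Notation P := (fun i => i < n)%N.
Local Notation Phi a := (frame_form A (fun=> a)).
Variables D1 D2 : nat -> ext R m.
Hypothesis pure1 : forall i, pure P (P i + 1)%N (~~ P i + 0)%N (D1 i).
Hypothesis pure2 : forall i, pure P (P i + 0)%N (~~ P i + 1)%N (D2 i).
Hypothesis structure_eqs : forall (i : 'I_m) x,
  dform (fun x => covector (row i (A x))) x = ext_map (A x) (D1 i + D2 i).
Local Notation D := (fun i => D1 i + D2 i).
Let fA := invariant_frame hw.

Lemma Dtot_frame h : smooth_form h -> Dtot X (frame_form A h) = frame_form A (fun x =>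
  \sum_(i < m) (ext_gen i \w frame_partial A i h x) + der D (h x)).
Proof.
move=> sh; apply/funext => x; rewrite /Dtot.
rewrite (del_frame fA pure1 pure2 structure_eqs) //.
rewrite (delbar_frame fA pure1 pure2 structure_eqs) //.
rewrite -[LHS](ext_linearD _ _ (ext_map_lin (A x))) /frame_form derD; congr (ext_map _ _).
by rewrite [in RHS](bigID (fun i : 'I_m => P i)) /= addrACA.
Qed.

Lemma Dtot_frame_cst a : Dtot X (Phi a) = Phi (der D a).
Proof.
rewrite Dtot_frame; last exact: smooth_form_cst.
apply/funext => x; rewrite /frame_form big1 ?add0r // => i _.
by rewrite frame_partial_cst ext_wedge0r.
Qed.

Lemma has_type_frame p q a : pure P p q a -> has_type (cn_J X) p q (Phi a).
Proof.
move=> pa; rewrite /has_type (type_part_frame fA).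
by apply/funext => x; rewrite /frame_form pure_std_part.
Qed.

Lemma type_part_frame0 p q p' q' a : pure P p q a -> (p, q) != (p', q') ->
  type_part (cn_J X) p' q' (Phi a) = 0.
Proof.
move=> pa npq; rewrite (type_part_frame fA); apply/funext => x.
by rewrite /frame_form (std_part_pure0 pa npq) (ext_linear0 (ext_map_lin _)).
Qed.

Lemma frame_form0 : Phi 0 = 0.
Proof. by apply/funext => x; rewrite /frame_form (ext_linear0 (ext_map_lin _)). Qed.

Lemma Atot_frame (k : nat) a : homogeneous k a -> Atot X k%:Z (Phi a).
Proof.
move=> ha; split; first exact: form_on_cst.
by move=> x I /(homogeneous_ext_map ha) ->.
Qed.

Lemma Atot_coef (k : nat) al x : Atot X k%:Z al -> homogeneous k (frame_coef A al x).
Proof. by move=> [_ ha]; apply: homogeneous_ext_map => I /ha []. Qed.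

Lemma Fil_coef (p k : nat) al x I : Fil X p%:Z k%:Z al -> (deg10 P I < p)%N ->
  frame_coef A al x I = 0.
Proof.
move=> [_ tal] Ip; have := tal (deg10 P I) (deg01 P I); rewrite ltz_nat => /(_ Ip).
rewrite -{1}[al](frame_coefK fA) (type_part_frame fA) => /(congr1 (fun f => frame_coef A f x)).
rewrite (frame_formK fA) [RHS](ext_linear0 (ext_map_lin _)) => /(congr1 (fun a : ext R m => a I)).
by rewrite [LHS]ffunE !eqxx [RHS]ffunE.
Qed.

(* If [D alpha = be + D gam], pairing the coefficients of both sides with a linear
   form killing [be] and all [der D b], [b] in the given degrees, leaves a
   divergence of invariant functions. *)
Lemma frame_functional_eq0 (L : ext R m -> R[i]) (a : ext R m) (be gam : cform R m) :
  (forall k x y, L (ext_scale k x + y) = k * L x + L y) ->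
  (forall x, L (frame_coef A be x) = 0) ->
  (forall x, L (der D (frame_coef A gam x)) = 0) ->
  form_on X gam -> Phi a = be + Dtot X gam -> L a = 0.
Proof.
move=> lL Lbe Lgam fgam e.
have L0 : L 0 = 0.
  have := lL 1 0 0; rewrite ext_scale0r addr0 mul1r => /esym/eqP.
  by rewrite -subr_eq0 addrK => /eqP.
have LD x y : L (x + y) = L x + L y by have := lL 1 x y; rewrite ext_scale1 mul1r.
have Lsum (I : Type) (r : seq I) (F : I -> ext R m) : L (\sum_(i <- r) F i) = \sum_(i <- r) L (F i).
  by apply: (big_morph L LD L0).
have LZ k x : L (ext_scale k x) = k * L x by have := lL k x 0; rewrite L0 !addr0.
set g := frame_coef A gam.
have sg : smooth_form g by apply: (smooth_frame_coef fA); case: fgam.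
(* [L] and the wedge with a generator have constant coefficients, so [L] of the i-th derivative term
   is the i-th frame derivative of this function. *)
pose F (i : 'I_m) x := \sum_I g x I * L (ext_gen i \w ext_basis I).
have FE i (b : ext R m) : L (ext_gen i \w b) = \sum_I b I * L (ext_gen i \w ext_basis I).
  rewrite {1}[b]ext_decomp ext_wedge_sumr Lsum; apply: eq_bigr => I _.
  by rewrite ext_wedgeZr LZ.
apply: (no_constant_frame_divergence hw (F := F)).
- by move=> i; apply: csmooth_sum => I; apply: csmoothM; [exact: sg | exact: csmooth_cst].
- move=> i h x Gh; apply: eq_bigr => I _; congr (_ * _).
  by rewrite /g (frame_coef_inv hw).
move=> x; have /(congr1 (fun f => frame_coef A f x)) := e.
rewrite (frame_formK fA) => ->.
rewrite -[gam](frame_coefK fA) -/g Dtot_frame // /frame_coef.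
rewrite (ext_linearD _ _ (ext_map_lin _)) LD -/(frame_coef A be x) Lbe add0r.
rewrite -[ext_map _ (frame_form _ _ _)]/(frame_coef A (frame_form A _) x) (frame_formK fA).
rewrite LD Lgam addr0 Lsum; apply: eq_bigr => i _.
rewrite FE /frame_derive.
under eq_bigr => j _.
  rewrite /F cderive_sum; last first.
    by move=> I; apply: csmoothM; [exact: sg | exact: csmooth_cst].
  rewrite mulr_sumr; over.
rewrite exchange_big; apply: eq_bigr => I _; rewrite ffunE /frame_derive mulr_suml.
apply: eq_bigr => j _; rewrite -mulrA; congr (_ * _).
by rewrite cderiveM ?cderive_cst ?mulr0 ?addr0 //; exact: csmooth_cst.
Qed.

Lemma fpow_frame a k : fpow (Phi a) k = Phi (iter k (ext_wedge a) (ext1 R m)).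
Proof.
elim: k => [|k IH]; first by apply/funext => x; rewrite /frame_form ext_map1.
rewrite -[fpow _ _]/(fwedge (Phi a) (fpow (Phi a) k)) IH; apply/funext => x.
by rewrite /fwedge /frame_form /= ext_map_wedge.
Qed.

Lemma iter_wedge_scale (z : R[i]) (a : ext R m) k :
  iter k (ext_wedge (ext_scale z a)) (ext1 R m) =
  ext_scale (z ^+ k) (iter k (ext_wedge a) (ext1 R m)).
Proof.
elim: k => [|k IH] /=; first by rewrite ext_scale1.
by rewrite IH ext_wedgeZl ext_wedgeZr ext_scaleA exprS.
Qed.

Lemma covector_evalE (u : 'rV[R[i]]_m) (v : 'rV[R]_m) :
  covector_eval u v = (u *m (map_mx (real_complex R) v)^T) 0 0.
Proof. by rewrite /covector_eval mxE; apply: eq_bigr => i _; rewrite !mxE. Qed.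

(** A row r fixed by (1 - i J^T) / 2 satisfies r J^T = i r: (1,0)-forms are complex linear for
    [J]. *)
Lemma covector_eval_J (k : 'I_n) x v :
  covector_eval (coframe_row w k x) (v *m cn_J X x) = 'i%C * covector_eval (coframe_row w k x) v.
Proof.
rewrite !covector_evalE map_mxM trmx_mul mulmxA; set r := coframe_row w k x.
suff -> : r *m (map_mx (real_complex R) (cn_J X x))^T = 'i%C *: r by rewrite -scalemxAl mxE.
have := coframe_row10 hw k x; rewrite -/r /proj10 -scalemxAr mulmxBr mulmx1 -scalemxAr -map_trmx.
set q := r *m _ => /(congr1 (fun M => 2 *: M)).
rewrite scalerA divff ?scale1r ?pnatr_eq0 // => e.
have {}e : r = - ('i%C *: q).
  by apply: (addrI r); rewrite e -mulr2n -scaler_nat.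
rewrite e scalerN scalerA -expr2 sqr_i scaleN1r opprK //.
Qed.

Lemma covector_eval_conj u (v : 'rV[R]_m) :
  covector_eval (map_mx (fun z => z^*%C) u) v = (covector_eval u v)^*%C.
Proof.
rewrite /covector_eval rmorph_sum; apply: eq_bigr => i _.
by rewrite mxE rmorphM; congr (_ * _); apply: complex_ext; rewrite /= ?oppr0.
Qed.

(** A real vector killed by the coframe is killed by the conjugate forms too, hence by an invertible
    matrix. *)
Lemma coframe_eval_neq0 x v : v != 0 ->
  exists k : 'I_n, covector_eval (coframe_row w k x) v != 0.
Proof.
move=> v0; apply/existsP; apply: contraNT v0 => /existsPn v0.
have {}v0 (k : nat) : covector_eval (coframe_row w k x) v = 0.
  have [kn|nk] := ltnP k n; first by have := v0 (Ordinal kn); rewrite negbK => /eqP.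
  rewrite /coframe_row insubF ?ltnNge ?nk // /covector_eval big1 // => i _.
  by rewrite mxE mul0r.
have Av : A x *m (map_mx (real_complex R) v)^T = 0.
  apply/row_matrixP => i; rewrite row_mul frame_mx_row row0.
  apply/matrixP => l j; rewrite !ord1 [RHS]mxE -[LHS]covector_evalE.
  by rewrite /frame_row; case: ifP => _; rewrite ?covector_eval_conj v0 // conjc0.
have : (map_mx (real_complex R) v)^T = 0.
  by rewrite -[LHS](mulKmx (frame_mx_unit hw x)) Av mulmx0.
move/(congr1 (fun M => M^T)); rewrite trmxK trmx0 => e.
by apply/eqP/rowP => i; have /rowP/(_ i) := e; rewrite !mxE => -[].
Qed.

End FrameFunctional.
Lemma conjciM (R : realType) (y : R[i]) : ('i%C * y)^*%C = - ('i%C * y^*%C).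
Proof. by case: y => yr yi; apply: complex_ext; rewrite /=; ring. Qed.

Lemma mem_increasing_triples (v : seq nat) : size v = 3 -> all (fun i => i < 10)%N v ->
  sorted ltn v -> has (fun i => i < 5)%N v -> v \in increasing_triples.
Proof.
move=> sv bv ov hv; rewrite mem_filter ov hv; move: sv bv {ov hv}.
case: v => [|i [|j [|k []]]] // _ /and4P[i10 j10 k10 _].
apply/flatten_mapP; exists i; first by rewrite mem_iota.
apply/flatten_mapP; exists j; first by rewrite mem_iota.
by apply/mapP; exists k; rewrite ?mem_iota.
Qed.

(** * The nilmanifold of the theorem *)

Section MainTheorem.
Context {R : realType} (X : complexNilmanifold R 5).
Variables (w1 w2 w3 w4 w5 : cform R (2 * 5)) (A12 A34 : R[i]) (b : R).
Local Notation w := [tuple w1; w2; w3; w4; w5].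
Hypothesis hw : coframe10 X w.
Hypothesis dw1 : dform w1 = 0.
Hypothesis dw2 : dform w2 = 0.
Hypothesis dw3 : dform w3 = 0.
Hypothesis dw4 : dform w4 = 0.
Hypothesis dw5 : dform w5 = fscale A12 (fwedge w1 w2) + fscale A34 (fwedge w3 w4)
                      + fwedge w1 (fconj w1) + fwedge w2 (fconj w2)
                      + fwedge w3 (fconj w3) + fscale b%:C%C (fwedge w4 (fconj w4)).
Local Notation A := (frame_mx w).
Local Notation P := (fun i => i < 5)%N.
Local Notation m := (2 * 5)%N.
Local Notation a' := (A12^*%C).
Local Notation c' := (A34^*%C).
Local Notation D1 := (fun i => comb_eval (comb_D1 A12 A34 b%:C%C i) : ext R m).
Local Notation D2 := (fun i => comb_eval (comb_D2 a' c' b%:C%C i) : ext R m).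
Local Notation Phi a := (frame_form A (fun=> a)).
Local Notation u x := (cov_family (fun i => row i (A x))).

Let u0 x : u x 0 = w1 x. Proof. exact: (cov_family_coframe hw (@Ordinal 5 0 isT)). Qed.
Let u1 x : u x 1 = w2 x. Proof. exact: (cov_family_coframe hw (@Ordinal 5 1 isT)). Qed.
Let u2 x : u x 2 = w3 x. Proof. exact: (cov_family_coframe hw (@Ordinal 5 2 isT)). Qed.
Let u3 x : u x 3 = w4 x. Proof. exact: (cov_family_coframe hw (@Ordinal 5 3 isT)). Qed.
Let u4 x : u x 4 = w5 x. Proof. exact: (cov_family_coframe hw (@Ordinal 5 4 isT)). Qed.
Let u5 x : u x 5 = ext_conj (w1 x). Proof. exact: (cov_family_conj hw (@Ordinal 5 0 isT)). Qed.
Let u6 x : u x 6 = ext_conj (w2 x). Proof. exact: (cov_family_conj hw (@Ordinal 5 1 isT)). Qed.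
Let u7 x : u x 7 = ext_conj (w3 x). Proof. exact: (cov_family_conj hw (@Ordinal 5 2 isT)). Qed.
Let u8 x : u x 8 = ext_conj (w4 x). Proof. exact: (cov_family_conj hw (@Ordinal 5 3 isT)). Qed.
Let u9 x : u x 9 = ext_conj (w5 x). Proof. exact: (cov_family_conj hw (@Ordinal 5 4 isT)). Qed.
Let uE := (u0, u1, u2, u3, u4, (u5, u6, u7, u8, u9)).

Let uC x i j : u x i \w u x j = - (u x j \w u x i).
Proof. by have [_] := @cov_family_anticommuting R m (fun i => row i (A x)); apply. Qed.

Let smooth_w (k : 'I_5) : smooth_form (tnth w k). Proof. by have [+ _ _ _] := hw; apply. Qed.

Lemma structure_equations (i : 'I_m) x :
  dform (fun x => covector (row i (A x))) x = ext_map (A x) (D1 i + D2 i).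
Proof.
have rowE (j : 'I_m) (f : cform R m) : (forall x, u x j = f x) ->
    (fun x => covector (row j (A x))) = f.
  by move=> e; apply/funext => y; rewrite -e cov_family_ord.
rewrite (ext_linearD _ _ (ext_map_lin _)) !ext_map_comb.
case: i => -[|[|[|[|[|[|[|[|[|[|k]]]]]]]]]] ki //.
- by rewrite (rowE (Ordinal ki) _ u0) dw1 !big_nil addr0.
- by rewrite (rowE (Ordinal ki) _ u1) dw2 !big_nil addr0.
- by rewrite (rowE (Ordinal ki) _ u2) dw3 !big_nil addr0.
- by rewrite (rowE (Ordinal ki) _ u3) dw4 !big_nil addr0.
- rewrite (rowE (Ordinal ki) _ u4) dw5 !big_cons !big_nil /= !ext_wedge1r !uE !ext_scale1 !addr0.
  by rewrite !addrA.
- rewrite (rowE (Ordinal ki) (fconj w1) u5) dform_conj; last exact: (smooth_w (@Ordinal 5 0 isT)).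
  by rewrite dw1 ext_conj0 !big_nil addr0.
- rewrite (rowE (Ordinal ki) (fconj w2) u6) dform_conj; last exact: (smooth_w (@Ordinal 5 1 isT)).
  by rewrite dw2 ext_conj0 !big_nil addr0.
- rewrite (rowE (Ordinal ki) (fconj w3) u7) dform_conj; last exact: (smooth_w (@Ordinal 5 2 isT)).
  by rewrite dw3 ext_conj0 !big_nil addr0.
- rewrite (rowE (Ordinal ki) (fconj w4) u8) dform_conj; last exact: (smooth_w (@Ordinal 5 3 isT)).
  by rewrite dw4 ext_conj0 !big_nil addr0.
rewrite (rowE (Ordinal ki) (fconj w5) u9) dform_conj; last exact: (smooth_w (@Ordinal 5 4 isT)).
rewrite dw5 !big_cons !big_nil /= !ext_wedge1r !ext_scaleNl !ext_scale1 !addr0.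
rewrite !ext_conjD !ext_conjZ !ext_conj_wedge !ext_conjK conjc_real.
rewrite -(u5 x) -(u6 x) -(u7 x) -(u8 x) -(u0 x) -(u1 x) -(u2 x) -(u3 x).
(* Conjugation swaps the factors of w^k wbar^k, whence the signs of [comb_D1] at the letter 9. *)
rewrite (uC x 5 0) (uC x 6 1) (uC x 7 2) (uC x 8 3) ext_scaleNr.
by rewrite [RHS]addrC !addrA.
Qed.

Lemma pure_D1 i : pure P (P i + 1)%N (~~ P i + 0)%N (D1 i).
Proof.
by case: i => [|[|[|[|[|[|[|[|[|[|i]]]]]]]]]]; apply: pure_comb.
Qed.

Lemma pure_D2 i : pure P (P i + 0)%N (~~ P i + 1)%N (D2 i).
Proof.
by case: i => [|[|[|[|[|[|[|[|[|[|i]]]]]]]]]]; apply: pure_comb.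
Qed.

Let fA := invariant_frame hw.
Let delE := del_frame_cst fA pure_D1 pure_D2 structure_equations.
Let delbarE := delbar_frame_cst fA pure_D1 pure_D2 structure_equations.
Let dE := dform_frame_cst fA structure_equations.

Definition diag_metric (e : R) : cform R m :=
  Phi (ext_scale 'i%C (comb_eval (comb_diag e%:C%C))).

Lemma diag_metricE e x : diag_metric e x = ext_scale 'i%C
  (w1 x \w ext_conj (w1 x) + (w2 x \w ext_conj (w2 x) + (w3 x \w ext_conj (w3 x) +
  (ext_scale e%:C%C (w4 x \w ext_conj (w4 x)) + w5 x \w ext_conj (w5 x))))).
Proof.
rewrite /diag_metric /frame_form (ext_linearZ _ _ (ext_map_lin _)) ext_map_comb.
by rewrite !big_cons !big_nil /= !ext_wedge1r !uE !ext_scale1 addr0.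
Qed.

Lemma diag_metric_hermitian e : 0 < e -> hermitian_metric X (diag_metric e).
Proof.
move=> e0; split.
- split; first exact: form_on_cst.
  by apply: has_type_frame => //; apply: pureZ; apply: pure_comb.
- apply/funext => x; rewrite /fconj diag_metricE ext_conjZ !ext_conjD ext_conjZ.
  rewrite !ext_conj_wedge !ext_conjK conjc_real.
  rewrite -(u5 x) -(u6 x) -(u7 x) -(u8 x) -(u9 x) -(u0 x) -(u1 x) -(u2 x) -(u3 x) -(u4 x).
  rewrite (uC x 5 0) (uC x 6 1) (uC x 7 2) (uC x 8 3) (uC x 9 4) !ext_scaleNr -!opprD.
  rewrite ext_scaleNr -ext_scaleNl; congr ext_scale.
  by apply: complex_ext; rewrite /= ?oppr0 ?opprK.
move=> x v v0.
pose z (k : 'I_5) := covector_eval (coframe_row w k x) v.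
pose d (k : 'I_5) : R := if k == 3 :> nat then e else 1.
(* [J] multiplies z by i, and z (i z)^* - (i z) z^* = - 2 i |z|^2; the outer factor i of the metric
   makes this positive. *)
have wE (k : 'I_5) : ext_eval2 (tnth w k x \w ext_conj (tnth w k x)) v (v *m cn_J X x) =
    - (2 * 'i%C * `|z k| ^+ 2).
  rewrite (coframe_rowE hw) ext_conj_covector ext_eval2_covector !covector_eval_conj.
  rewrite (covector_eval_J hw) -/(z k) sqr_normc conjciM; ring.
have -> : ext_eval2 (diag_metric e x) v (v *m cn_J X x) =
    \sum_(k < 5) 2 * (d k)%:C%C * `|z k| ^+ 2.
  have ev0 : ext_eval2 0 v (v *m cn_J X x) = 0.
    by rewrite /ext_eval2 big1 // => i _; rewrite big1 // => j _; rewrite ffunE mul0r.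
  have evZ k y : ext_eval2 (ext_scale k y) v (v *m cn_J X x) =
      k * ext_eval2 y v (v *m cn_J X x).
    by rewrite -[ext_scale k y]addr0 ext_eval2_lin ev0 addr0.
  have evD y y' : ext_eval2 (y + y') v (v *m cn_J X x) =
      ext_eval2 y v (v *m cn_J X x) + ext_eval2 y' v (v *m cn_J X x).
    by rewrite -[y in LHS]ext_scale1 ext_eval2_lin mul1r.
  have ii : 'i%C * 'i%C = -1 :> R[i] by rewrite -expr2 sqr_i.
  rewrite diag_metricE evZ !evD evZ.
  have := wE (@Ordinal 5 0 isT); have := wE (@Ordinal 5 1 isT); have := wE (@Ordinal 5 2 isT).
  have := wE (@Ordinal 5 3 isT); have := wE (@Ordinal 5 4 isT).
  move=> -> -> -> -> ->; rewrite !big_ord_recl big_ord0.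
  pose N j := `|covector_eval (coframe_row w j x) v| ^+ 2.
  have zN k : `|z k| ^+ 2 = N k by [].
  rewrite !zN /d /= (rmorph1 (real_complex R)); ring: ii.
have [k zk] := coframe_eval_neq0 hw x v0.
have dk l : 0 < 2 * (d l)%:C%C :> R[i].
  by rewrite mulr_gt0 ?ltr0n // ltcR /d; case: ifP.
rewrite (bigD1 k) //= ltr_pwDl //.
  by rewrite mulr_gt0 ?dk // exprn_gt0 // normr_gt0.
by apply: sumr_ge0 => l _; rewrite mulr_ge0 ?exprn_ge0 ?normr_ge0 // ltW.
Qed.

Lemma diag_metric_pow e k :
  fpow (diag_metric e) k = Phi (ext_scale ('i%C ^+ k) (comb_eval (comb_pow (comb_diag e%:C%C) k))).
Proof. by rewrite /diag_metric fpow_frame iter_wedge_scale comb_eval_pow. Qed.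

Lemma diag_metric_astheno : `|A12| ^+ 2 + `|A34| ^+ 2 = (6 * (b + 1))%:C%C ->
  astheno_Kahler X (diag_metric 1).
Proof.
move=> hA; rewrite /astheno_Kahler diag_metric_pow delbarE delE.
rewrite !(ext_linearZ _ _ (der_lin _)).
rewrite -(comb_eval_der _ sorted_pow3) -(comb_eval_der _ (sorted_D2_pow3 _ _ _)).
rewrite (comb_eval_zero (astheno_identity _)) ?ext_scale0r ?frame_form0 //.
rewrite -!sqr_normc hA; apply: complex_ext; rewrite /=; ring.
Qed.

Lemma diag_metric_strongly_Gauduchon : A12 != 0 -> strongly_Gauduchon X (diag_metric 1).
Proof.
move=> a0; have a'0 : a' != 0 by rewrite conjc_eq0.
set t := - (24%:R * (3%:R + b%:C%C)) / a'.
have tE : t * a' = - (24%:R * (3%:R + b%:C%C)) by rewrite divfK.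
exists (Phi (ext_scale ('i%C ^+ 4) (comb_eval [:: (t, [:: 0; 1; 2; 3; 4; 7; 8; 9]%N)]))).
  split; first exact: form_on_cst.
  by apply: has_type_frame => //; apply: pureZ; apply: pure_comb.
rewrite diag_metric_pow delbarE delE !(ext_linearZ _ _ (der_lin _)).
rewrite -(comb_eval_der _ (sorted_pow4 _)) -comb_eval_der //.
by rewrite (comb_eval_eq (@gauduchon_identity _ A12 A34 a' c' b%:C%C t tE)).
Qed.

Lemma diag_metric_balanced e : 3 * e + b = 0 -> balanced X (diag_metric e).
Proof.
move=> eb; have eb' : 3%:R * e%:C%C + b%:C%C = 0 :> R[i].
  by have := congr1 (real_complex R) eb; rewrite rmorphD rmorphM rmorph_nat rmorph0.
rewrite /balanced diag_metric_pow dE !(ext_linearZ _ _ (der_lin _)).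
rewrite -!(comb_eval_der _ (sorted_pow4 _)).
have [e1 e2] := balanced_identity A12 A34 a' c' eb'.
by rewrite (comb_eval_zero e1) (comb_eval_zero e2) ext_scale0r addr0 frame_form0.
Qed.

Local Notation DD := (fun i => D1 i + D2 i).
Local Notation alpha := (comb_eval (comb_alpha a' c' b%:C%C) : ext R m).
Local Notation dalpha := (comb_eval (comb_d_alpha A12 A34 a' c' b%:C%C) : ext R m).
Local Notation L := (@comb_functional R m (comb_L A12 A34 a' c' b%:C%C)).

Let DtotE := Dtot_frame_cst hw pure_D1 pure_D2 structure_equations.

Let derDD a : der DD a = der (fun i => comb_eval (comb_D A12 A34 a' c' b%:C%C i)) a.
Proof. by congr der; apply/funext => i; rewrite comb_eval_cat. Qed.

Lemma Dtot_alpha : Dtot X (Phi alpha) = Phi dalpha.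
Proof.
rewrite DtotE derDD -comb_eval_der //.
by rewrite (comb_eval_eq (d_alpha_identity _ _ _ _ _)).
Qed.

Let homogeneous_comb k l : all (fun t : R[i] * seq nat => size t.2 == k) l ->
  homogeneous k (comb_eval l : ext R m).
Proof.
move=> /allP sl; apply/pureT; apply: pure_comb; apply/allP => t /sl /eqP <-.
by rewrite count_predT eqxx /= (eq_count (a2 := pred0)) ?count_pred0.
Qed.

Let Fil0 p k : Fil X p k 0.
Proof.
split; first split.
- by rewrite -(frame_form0 w); exact: form_on_cst.
- by move=> x I; rewrite ffunE eqxx.
- move=> p' q' _; rewrite -(frame_form0 w) (type_part_frame fA).
  apply/funext => x; rewrite /frame_form (_ : std_part _ _ _ _ = 0) //.
  by apply/ffunP => I; rewrite !ffunE if_same.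
Qed.

Let Dtot0 : Dtot X 0 = 0.
Proof. by rewrite -{1}(frame_form0 w) DtotE (ext_linear0 (der_lin _)) frame_form0. Qed.

Let Br0 r p q : Br X r p q 0.
Proof.
have Z0 r' p' q' : Zr X r' p' q' 0 by split; rewrite ?Dtot0; exact: Fil0.
by exists 0; [exact: Z0 | exists 0; [exact: Z0 | rewrite Dtot0 addr0]].
Qed.

(** Passes from the checked basis words to all forms: a nonzero coefficient sits at a word of three
    letters, at least one of type (1,0). *)
Lemma L_closed (a : ext R m) : homogeneous 3 a ->
  (forall I, deg10 P I = 0%N -> a I = 0) -> L (der DD a) = 0.
Proof.
move=> ha a0; rewrite derDD /der.
have L0 : L 0 = 0 by rewrite /comb_functional big1 // => t _; rewrite ffunE mulr0.
rewrite -[X in L X]addr0; elim/big_rec: _ => [|I y _]; first by rewrite addr0.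
rewrite !addr0 comb_functionalZ => ->; rewrite addr0.
have [->|aI] := eqVneq (a I) 0; first by rewrite mul0r.
suff : set_word I \in increasing_triples.
  move=> wI; rewrite -comb_eval_der_word comb_functionalE //; last first.
    exact: (allP (L_closed_sorted _ _ _ _ _)).
  have := L_closed_all A12 A34 a' c' (b%:C%C : R[i]).
  elim: increasing_triples wI => //= v s IH; rewrite inE => /orP[/eqP-> [-> _]|vs [_ /(IH vs)]] //.
  by rewrite mulr0.
apply: mem_increasing_triples; rewrite ?set_word_sorted //.
- by rewrite size_map -cardE (ha I aI).
- exact: set_word_lt.
by rewrite has_count count_set_word lt0n; apply: contraNneq aI => /a0 ->.
Qed.

Lemma d3_neq0 : A12 != 0 -> A34 != 0 -> b < 0 -> dr_neq0 X 3.
Proof.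
move=> a0 c0 b0; exists 0, 3, (Er_coset X 3 0 3 (Phi alpha)).
  exists (Phi alpha) => //; split.
    split; last by case.
    by apply: (Atot_frame hw (k := 3)); apply: homogeneous_comb.
  rewrite Dtot_alpha; split.
    by apply: (Atot_frame hw (k := 4)); apply: homogeneous_comb.
  move=> p' q' p3; apply: (type_part_frame0 hw (p := 3) (q := 1)); first exact: pure_comb.
  by rewrite xpair_eqE gtn_eqF // -ltz_nat.
(* With zero boundary corrections D alpha represents the image class; equality with the zero coset
   then places it in B_3^{3,1}. *)
move=> e; have : dr X 3 0 3 (Er_coset X 3 0 3 (Phi alpha)) (Phi dalpha).
  exists (Phi alpha); first by exists 0; [exact: Br0 | rewrite addr0].
  by rewrite Dtot_alpha; exists 0; [exact: Br0 | rewrite addr0].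
rewrite e => -[be [Fbe _] [gam [Fgam _] E]].
(* The integer indices of Z_2^{4,0} and Z_2^{1,2} reduce by computation to filtrations 4 and 1 in
   degrees 4 and 3. *)
have {}Fbe : Fil X 4 4 be by [].
have {}Fgam : Fil X 1 3 gam by [].
have : L dalpha = 0.
  apply: (frame_functional_eq0 hw pure_D1 pure_D2 structure_equations _ _ _ _ E).
  - exact: comb_functionalZ.
  - move=> x; rewrite /comb_functional.
    have Lw : all (fun t : R[i] * seq nat => [&& sorted ltn t.2,
        all (fun i => i < m)%N t.2 & count P t.2 < 4]%N) (comb_L A12 A34 a' c' b%:C%C) by [].
    rewrite big1_seq // => t /(allP Lw)/and3P[st bt t4].
    by rewrite (Fil_coef hw _ Fbe) ?mulr0 // -count_set_word word_setK.
  - move=> x; apply: L_closed; first by have [aG _] := Fgam; exact: (@Atot_coef R 5 X w 3 gam x aG).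
    by move=> I I0; apply: (Fil_coef hw (p := 1) (k := 3)); rewrite ?I0.
  - by case: Fgam => -[].
rewrite comb_functionalE // L_d_alpha => /eqP.
rewrite !mulf_eq0 !conjc_eq0 (negPf a0) (negPf c0) /= subr_eq0 => /eqP.
rewrite -!sqr_normc => eq.
(* The left side is negative because b < 0, while the right side is positive. *)
have : `|A12| ^+ 2 * b%:C%C < `|A34| ^+ 2 :> R[i].
  apply: (@lt_trans _ _ 0); last by rewrite exprn_gt0 // normr_gt0.
  by rewrite pmulr_rlt0 ?exprn_gt0 ?normr_gt0 // ltcR.
by rewrite eq ltxx.
Qed.

End MainTheorem.

Theorem theorem6p9 (R : realType) (X : complexNilmanifold R 5)
    (w1 w2 w3 w4 w5 : cform R (2 * 5)) (A12 A34 : R[i]) (b : R)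
    (hw : coframe10 X [tuple w1; w2; w3; w4; w5])
    (hA12 : A12 != 0) (hA34 : A34 != 0) (hb : -1 < b < 0)
    (hA : `|A12| ^+ 2 + `|A34| ^+ 2 = (6 * (b + 1))%:C%C)
    (dw1 : dform w1 = 0) (dw2 : dform w2 = 0)
    (dw3 : dform w3 = 0) (dw4 : dform w4 = 0)
    (dw5 : dform w5 = fscale A12 (fwedge w1 w2) + fscale A34 (fwedge w3 w4)
                      + fwedge w1 (fconj w1) + fwedge w2 (fconj w2)
                      + fwedge w3 (fconj w3) + fscale b%:C%C (fwedge w4 (fconj w4))) :
  [/\ exists F' : cform R (2 * 5),
        [/\ hermitian_metric X F', astheno_Kahler X F' & strongly_Gauduchon X F'],
      exists F'' : cform R (2 * 5), hermitian_metric X F'' /\ balanced X F''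
    & dr_neq0 X 3].
Proof.
have b0 : b < 0 by case/andP: hb.
split; last exact: (d3_neq0 hw dw1 dw2 dw3 dw4 dw5).
  exists (diag_metric w1 w2 w3 w4 w5 1); split.
  - exact: (diag_metric_hermitian hw).
  - exact: (diag_metric_astheno hw dw1 dw2 dw3 dw4 dw5 hA).
  - exact: (diag_metric_strongly_Gauduchon hw dw1 dw2 dw3 dw4 dw5 hA12).
exists (diag_metric w1 w2 w3 w4 w5 (- b / 3)); split.
  by apply: (diag_metric_hermitian hw); rewrite divr_gt0 // oppr_gt0.
apply: (diag_metric_balanced hw dw1 dw2 dw3 dw4 dw5).
by field.
Qed.
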